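(* Every confluent temperature-1 tile assembly system either has a finite maximal producible assembly $\alpha_{\max}$ or is para-periodic, i.e. $\alpha_{\max}$ contains an ultimately periodic assembly path.
   Context: Directions $D=\{E=(1,0),N=(0,1),S=(0,-1),W=(-1,0)\}$; $\mathbb Z^2$ is the grid graph; a free path is a word over $D$ whose walk is simple; $\vec m$ is the displacement of finite $m$. A tile type is a map $t:D\to\Sigma$ ($\Sigma$ a finite set of glues). A temperature-1 TAS is a pair $(T,\sigma)$ with $T$ a finite set of tile types and $\sigma$ a seed tile type. An assembly is a partial map $\alpha:\mathbb Z^2\to T\cup\{\sigma\}$; its binding graph has vertices $\mathrm{Dom}(\alpha)$ and an edge $\{v,v+d\}$ iff $\alpha(v)_d=\alpha(v+d)_{-d}$. It is producible if its binding graph is connected and $\alpha((0,0))=\sigma$. The TAS is confluent if any two producible assemblies agree on the intersection of their domains; then there is a unique maximal producible assembly $\alpha_{\max}$ whose domain contains the domain of every producible assembly. An ultimately periodic assembly path is a producible assembly whose binding graph is a path $(0,0).mp^\omega$ ($m,p$ finite words, $p\ne\epsilon$, following the letters from the origin) and such that $\alpha(\vec m+i\vec p+\vec q)=\alpha(\vec m+\vec q)$ for all $i\ge 0$ and all prefixes $q$ of $p$. $\alpha_{\max}$ contains such a path if it is the restriction of $\alpha_{\max}$ to a path of its binding graph. *)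

(* Defs.v *)
From Stdlib Require Import ZArith List Relations.
Import ListNotations.
Set Implicit Arguments.

Inductive Dir := DE | DN | DS | DW.

Definition dvec (d : Dir) : Z * Z :=
  match d with
  | DE => (1, 0)%Z | DN => (0, 1)%Z | DS => (0, -1)%Z | DW => (-1, 0)%Z
  end.

Definition dopp (d : Dir) : Dir :=
  match d with DE => DW | DW => DE | DN => DS | DS => DN end.

Definition Point := (Z * Z)%type.

Definition padd (u v : Point) : Point := (fst u + fst v, snd u + snd v)%Z.

Definition disp (w : list Dir) : Point :=
  fold_right (fun d acc => padd (dvec d) acc) (0%Z, 0%Z) w.

Definition Tile (Sigma : Type) := Dir -> Sigma.

Definition Assembly (Sigma : Type) := Point -> option (Tile Sigma).

Definition in_dom Sigma (a : Assembly Sigma) (v : Point) : Prop := a v <> None.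

Definition bond Sigma (a : Assembly Sigma) (u v : Point) : Prop :=
  exists d t t', v = padd u (dvec d) /\ a u = Some t /\ a v = Some t' /\
                 t d = t' (dopp d).

Definition bconnected Sigma (a : Assembly Sigma) : Prop :=
  forall u v, in_dom a u -> in_dom a v ->
    clos_refl_trans Point (fun x y => bond a x y \/ bond a y x) u v.

Definition tiles_from Sigma (T : list (Tile Sigma)) (s : Tile Sigma)
  (a : Assembly Sigma) : Prop :=
  forall v t, a v = Some t -> In t T \/ t = s.

Definition producible Sigma (T : list (Tile Sigma)) (s : Tile Sigma)
  (a : Assembly Sigma) : Prop :=
  tiles_from T s a /\ bconnected a /\ a (0%Z, 0%Z) = Some s.

Definition confluent Sigma (T : list (Tile Sigma)) (s : Tile Sigma) : Prop :=
  forall a b, producible T s a -> producible T s b ->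
    forall v t t', a v = Some t -> b v = Some t' -> t = t'.

Definition is_max_producible Sigma (T : list (Tile Sigma)) (s : Tile Sigma)
  (a : Assembly Sigma) : Prop :=
  producible T s a /\
  forall b, producible T s b -> forall v, in_dom b v -> in_dom a v.

Definition finite_assembly Sigma (a : Assembly Sigma) : Prop :=
  exists l : list Point, forall v, in_dom a v -> In v l.

Definition wletter (m p : list Dir) (k : nat) : Dir :=
  if Nat.ltb k (length m) then nth k m DE
  else nth (Nat.modulo (k - length m) (length p)) p DE.

Definition vertex (m p : list Dir) (k : nat) : Point :=
  disp (map (wletter m p) (seq 0 k)).

Definition up_assembly_path Sigma (T : list (Tile Sigma)) (s : Tile Sigma)
  (m p : list Dir) (b : Assembly Sigma) : Prop :=
  p <> [] /\
  producible T s b /\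
  (forall i j, vertex m p i = vertex m p j -> i = j) /\
  (forall v, in_dom b v <-> exists k, v = vertex m p k) /\
  (forall u v, bond b u v <->
     exists k, (u = vertex m p k /\ v = vertex m p (S k)) \/
               (v = vertex m p k /\ u = vertex m p (S k))) /\
  (forall (i : nat) (q r : list Dir), q ++ r = p ->
     b (padd (disp m) (padd (disp (concat (repeat p i))) (disp q)))
     = b (padd (disp m) (disp q))).

Definition contains_up_path Sigma (T : list (Tile Sigma)) (s : Tile Sigma)
  (a : Assembly Sigma) : Prop :=
  exists m p b, up_assembly_path T s m p b /\
    forall v, in_dom b v -> b v = a v.

(* Main.v *)
(* Let alpha be the maximal assembly, and suppose that it is infinite. By confluence, a path of
   alpha continued by the translate of another bonded path of alpha with the same tile at the
   junction reproduces the tiles of that path until it runs into itself. Hence, if a leftmost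
   (or rightmost) infinite path r passes twice through the same tile with the same local
   directions, then either its two tails are translates of each other, so that r is ultimately
   periodic, or the translated tail leaves r on the extremal side and, by extremality, is forced
   back to an earlier part of r, forming an arc. Infinitely many vertices over which no arc
   passes ("exposed" vertices) therefore give periodicity, by the pigeonhole principle.

   Let r be leftmost. Arcs of r with disjoint ends do not meet, and when two of them cross, the
   second one closes on the right of r: it is a loop. If the loops are bounded, arcs that are
   not crossed give infinitely many exposed vertices. If they are unbounded, but the bonded
   closed walks that wind around the origin all come near it, then the foot h of a far loop
   cannot be bonded to the end of the loop, so every path to the far side of the loop goes
   through h, and the rightmost ray is exposed at each such h.

   If bonded closed walks wind around the origin arbitrarily far out, counting the crossings of
   a half-line from the origin shows that for infinitely many columns n, a path that reaches
   the column n can make an excursion in [x <= n] around the origin and come back to this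
   column. The rightmost such excursion is determined by the local state at its start, so it has
   bounded length, which is absurd when it encloses the origin and n is large; otherwise it is
   an infinite path confined to a half-plane. In a half-plane, the vertices of a leftmost path
   that can be seen from infinity play the role of the exposed vertices.

   Jumping along a periodic path to the farthest bonded vertex makes it induced. *)
Require Import Defs.
From Stdlib Require Import ZArith List.
From Stdlib Require Import Lia Classical ClassicalEpsilon Arith Relations.
Import ListNotations.
Set Implicit Arguments.

(** The closing edge of an arc is in general not a bond: the translated tail stops at a vertex of
    [r] whose tile may differ from the one that the translation would put there, so the edge is only
    known to fit some tile at its far end ([bondable]). Confluence turns such an edge into a bond as
    soon as a bonded path from the origin arrives at its near end without having visited the far end
    ([grow_step]). This asymmetry shapes the treatment of loops: if the last vertex of a loop could
    be reached without the vertex [h] where the loop closes, the closing edge would be a bond and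
    the loop a bonded closed walk around the origin. Hence the case distinction on such walks.

    All planarity is drawn from winding numbers of closed lattice walks around unit squares. Squares
    are used rather than vertices because the vertices of interest often lie on the curve itself;
    its two sides at such a vertex are read off the four squares around it. *)

(** * Grid points, directions and turns *)

Definition step (p : Point) (d : Dir) : Point := padd p (dvec d).
Definition adj (p q : Point) : Prop := exists d, q = step p d.
Definition dirof (p q : Point) : Dir :=
  if Z.eqb (fst q) (fst p + 1) then DE
  else if Z.eqb (fst q) (fst p - 1) then DW
  else if Z.eqb (snd q) (snd p + 1) then DN else DS.

Lemma pt_eq (p q : Point) : fst p = fst q -> snd p = snd q -> p = q.
Proof. destruct p, q; simpl; congruence. Qed.

Ltac pts :=
  repeat match goal with
  | H : @eq Point ?a ?b |- _ =>
      let H1 := fresh "Hx" in let H2 := fresh "Hy" in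
      pose proof (f_equal fst H) as H1; pose proof (f_equal snd H) as H2; clear H
  end;
  unfold step, padd, dvec in *; simpl fst in *; simpl snd in *;
  try (apply pt_eq); simpl fst; simpl snd; try lia.

Lemma pt_dec (p q : Point) : {p = q} + {p <> q}.
Proof. decide equality; apply Z.eq_dec. Defined.

Ltac eqbs :=
  repeat match goal with
  | |- context [Z.eqb ?a ?b] => destruct (Z.eqb_spec a b); try lia
  | |- context [Z.leb ?a ?b] => destruct (Z.leb_spec a b); try lia
  end.

Lemma dirof_step p d : dirof p (step p d) = d.
Proof.
  destruct p as [x y]; destruct d; unfold dirof, step, padd; simpl; eqbs; reflexivity.
Qed.

Lemma step_dirof p q : adj p q -> step p (dirof p q) = q.
Proof. intros [d ->]. now rewrite dirof_step. Qed.

Lemma dirof_inj p q q' : adj p q -> adj p q' -> dirof p q = dirof p q' -> q = q'.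
Proof. intros H H' E. rewrite <- (step_dirof H), <- (step_dirof H'). now rewrite E. Qed.

Lemma step_opp p d : step (step p d) (dopp d) = p.
Proof. destruct d; pts. Qed.

Lemma dopp_dopp d : dopp (dopp d) = d.
Proof. now destruct d. Qed.

Lemma adj_sym p q : adj p q -> adj q p.
Proof. intros [d ->]. exists (dopp d). now rewrite step_opp. Qed.

Lemma adj_neq p q : adj p q -> p <> q.
Proof. intros [d ->] E. destruct d; pts. Qed.

Lemma dirof_padd p q v : dirof (padd p v) (padd q v) = dirof p q.
Proof.
  destruct p, q, v; unfold dirof, padd; simpl; eqbs; reflexivity.
Qed.

Lemma adj_padd p q v : adj p q -> adj (padd p v) (padd q v).
Proof. intros [d ->]. exists d. pts. Qed.

(** Counterclockwise numbering, so that [off a b] is the number of left quarter turns from [a] to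
    [b]. The left and right sides of a path at a vertex become the two sectors between its incoming
    and outgoing directions. *)
Definition idx (d : Dir) : nat := match d with DE => 0 | DN => 1 | DW => 2 | DS => 3 end.
Definition off (a b : Dir) : nat := (idx b + 4 - idx a) mod 4.
(* [i] points back to the previous vertex of a path and [o] to the next one. *)
Definition Left (i o d : Dir) : Prop := 0 < off o d < off o i.
Definition Right (i o d : Dir) : Prop := off o i < off o d.
(* [d] turns further left ([c = true]) or further right ([c = false]) than [o]. *)
Definition better (c : bool) (i o d : Dir) : Prop :=
  if c then off i o < off i d else 0 < off i d < off i o.

Definition LeftP (a p b x : Point) := Left (dirof p a) (dirof p b) (dirof p x).
Definition RightP (a p b x : Point) := Right (dirof p a) (dirof p b) (dirof p x).
Definition betterP c (a p b x : Point) := better c (dirof p a) (dirof p b) (dirof p x).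

Ltac dirs := unfold LeftP, RightP, betterP, Left, Right, better in *;
  repeat match goal with
  | |- context [dirof ?p ?q] => generalize dependent (dirof p q); intros
  | H : context [dirof ?p ?q] |- _ => generalize dependent (dirof p q); intros
  end;
  repeat match goal with d : Dir |- _ => destruct d end;
  cbn in *; try lia; try congruence.

Lemma left_or_right i o d : i <> o -> d <> i -> d <> o -> Left i o d \/ Right i o d.
Proof. destruct i, o, d; unfold Left, Right; cbn; intros; try congruence; lia. Qed.

Lemma better_total c i o d : i <> o -> d <> i -> o <> d -> better c i o d \/ better c i d o.
Proof. destruct c, i, o, d; unfold better; cbn; intros; try congruence; lia. Qed.

(** Clockwise quarter turn: [F p d] and [F p (rotm d)] are the squares to the left and to the right
    of the edge that leaves [p] in direction [d]. *)
Definition rotm (d : Dir) : Dir := match d with DE => DS | DN => DE | DW => DN | DS => DW end.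

(* The unit square with lower left corner [f] is represented by [f]; [F p d] is the
   square at [p] met just after direction [d] when turning counterclockwise. *)
Definition F (p : Point) (d : Dir) : Point :=
  match d with
  | DE => p
  | DN => (fst p - 1, snd p)%Z
  | DW => (fst p - 1, snd p - 1)%Z
  | DS => (fst p, snd p - 1)%Z
  end.

(** * Discrete line integrals along lists of points *)

Fixpoint sumw (g : Point -> Point -> Z) (l : list Point) : Z :=
  match l with
  | p :: ((q :: _) as t) => (g p q + sumw g t)%Z
  | _ => 0%Z
  end.

Fixpoint chain (R : Point -> Point -> Prop) (l : list Point) : Prop :=
  match l with
  | p :: ((q :: _) as t) => R p q /\ chain R t
  | _ => True
  end.

Definition stp (l : list Point) (p q : Point) : Prop := exists a b, l = a ++ p :: q :: b.

(** Closed walks are stored without their repeated endpoint, so that [NoDup l] can express that the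
    curve is simple; [cl] restores the closing step. *)
Definition cl (l : list Point) : list Point :=
  match l with [] => [] | p :: _ => l ++ [p] end.

Lemma sumw_app g l1 p l2 :
  sumw g (l1 ++ p :: l2) = (sumw g (l1 ++ [p]) + sumw g (p :: l2))%Z.
Proof.
  induction l1 as [|a l1 IH]; simpl app.
  - simpl. destruct l2; lia.
  - destruct l1 as [|b l1].
    + simpl app. change (sumw g (a :: p :: l2)) with (g a p + sumw g (p :: l2))%Z.
      simpl (sumw g [a; p]). lia.
    + simpl app in *. change (sumw g (a :: b :: l1 ++ p :: l2)) with (g a b + sumw g (b :: l1 ++ p :: l2))%Z.
      change (sumw g (a :: b :: l1 ++ [p])) with (g a b + sumw g (b :: l1 ++ [p]))%Z.
      rewrite IH. lia.
Qed.

Lemma sumw_rev g l : (forall p q, g q p = - g p q)%Z -> (sumw g (rev l) = - sumw g l)%Z.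
Proof.
  intros Hg. induction l as [|p [|q t] IH]; try reflexivity.
  change (rev (p :: q :: t)) with ((rev t ++ [q]) ++ [p]).
  rewrite <- app_assoc. simpl app at 2. rewrite sumw_app.
  change (rev t ++ [q]) with (rev (q :: t)). rewrite IH.
  change (sumw g (p :: q :: t)) with (g p q + sumw g (q :: t))%Z.
  simpl (sumw g [q; p]). rewrite Hg. lia.
Qed.

Lemma sumw_ext g h l : (forall p q, stp l p q -> g p q = h p q) -> sumw g l = sumw h l.
Proof.
  induction l as [|p [|q t] IH]; intros H; try reflexivity.
  change (g p q + sumw g (q :: t) = h p q + sumw h (q :: t))%Z.
  rewrite IH. { rewrite (H p q); [reflexivity|]. exists [], t. reflexivity. }
  intros a b [u [v E]]. apply H. exists (p :: u), v. simpl. now rewrite E.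
Qed.

Lemma sumw_lin g h k l : sumw (fun p q => g p q - h p q - k p q)%Z l = (sumw g l - sumw h l - sumw k l)%Z.
Proof.
  induction l as [|p [|q t] IH]; try reflexivity.
  set (f := fun p q => _) in *.
  change (f p q + sumw f (q :: t) = (g p q + sumw g (q :: t)) - (h p q + sumw h (q :: t)) - (k p q + sumw k (q :: t)))%Z.
  rewrite IH. unfold f. lia.
Qed.

Lemma last_cons {X} (q : X) t p : last (q :: t) p = last t q.
Proof.
  revert q p. induction t as [|x t IH]; intros q p; [reflexivity|].
  change (last (x :: t) p = last (x :: t) q). now rewrite !IH.
Qed.

Lemma sumw_tele (I : Point -> Z) p l :
  sumw (fun p q => I q - I p)%Z (p :: l) = (I (last l p) - I p)%Z.
Proof.
  revert p. induction l as [|q t IH]; intros p.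
  - simpl. lia.
  - set (f := fun p q => _) in *.
    change (f p q + sumw f (q :: t) = I (last (q :: t) p) - I p)%Z. rewrite IH. unfold f.
    rewrite last_cons. lia.
Qed.

Lemma last_app_one {X} (l : list X) x d : last (l ++ [x]) d = x.
Proof. apply last_last. Qed.

Lemma sumw_closed I l : sumw (fun p q => I q - I p)%Z (cl l) = 0%Z.
Proof.
  destruct l as [|p l]; [reflexivity|]. simpl cl. change (p :: l ++ [p]) with (p :: (l ++ [p])).
  rewrite sumw_tele, last_app_one. lia.
Qed.

Lemma chain_stp R l : chain R l <-> (forall p q, stp l p q -> R p q).
Proof.
  split.
  - intros H p q [a [b ->]]. induction a as [|x a IH].
    + simpl in H. tauto.
    + destruct a as [|y a]; simpl app in *; apply IH; destruct H; assumption.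
  - induction l as [|p [|q t] IH]; intros H; try exact I. split.
    + apply H. exists [], t. reflexivity.
    + apply IH. intros a b [u [v E]]. apply H. exists (p :: u), v. simpl. now rewrite E.
Qed.

Lemma chain_app R l1 p l2 : chain R (l1 ++ p :: l2) <-> chain R (l1 ++ [p]) /\ chain R (p :: l2).
Proof.
  induction l1 as [|a l1 IH]; simpl app.
  - simpl. tauto.
  - destruct l1 as [|b l1].
    + simpl app. change (chain R (a :: p :: l2)) with (R a p /\ chain R (p :: l2)). simpl (chain R [a; p]). tauto.
    + simpl app in *. change (chain R (a :: b :: l1 ++ p :: l2)) with (R a b /\ chain R (b :: l1 ++ p :: l2)).
      change (chain R (a :: b :: l1 ++ [p])) with (R a b /\ chain R (b :: l1 ++ [p])). tauto.
Qed.

Lemma chain_impl (R R' : Point -> Point -> Prop) l :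
  (forall p q, R p q -> R' p q) -> chain R l -> chain R' l.
Proof. intros H. rewrite !chain_stp. auto. Qed.

Lemma chain_rev (R : Point -> Point -> Prop) l :
  (forall p q, R p q -> R q p) -> chain R l -> chain R (rev l).
Proof.
  intros Hs. induction l as [|p [|q t] IH]; intros H; try exact I.
  change (rev (p :: q :: t)) with ((rev t ++ [q]) ++ [p]). rewrite <- app_assoc. simpl app at 2.
  apply chain_app. destruct H as [H1 H2]. split; [exact (IH H2)|]. simpl. auto.
Qed.

(** * Winding numbers *)

(* Crossing number of a step with the half-line that runs west from the centre of the square [f]. *)
Definition dl (f p q : Point) : Z :=
  if andb (Z.eqb (fst p) (fst q)) (Z.leb (fst p) (fst f)) then
    if andb (Z.eqb (snd p) (snd f)) (Z.eqb (snd q) (snd f + 1)) then (-1)%Z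
    else if andb (Z.eqb (snd q) (snd f)) (Z.eqb (snd p) (snd f + 1)) then 1%Z else 0%Z
  else 0%Z.

(** The winding number around the centre of the square [f], positive counterclockwise. The half-line
    from a square centre contains no lattice point, so no degenerate crossing has to be
    discussed. *)
Definition wnd (l : list Point) (f : Point) : Z := sumw (dl f) (cl l).

Definition ind (a b p q : Point) : Z :=
  if andb (andb (Z.eqb (fst a) (fst p)) (Z.eqb (snd a) (snd p)))
          (andb (Z.eqb (fst b) (fst q)) (Z.eqb (snd b) (snd q))) then 1%Z else 0%Z.

Lemma ind_1 a b : ind a b a b = 1%Z.
Proof. unfold ind. now rewrite !Z.eqb_refl. Qed.

Lemma ind_0 a b p q : a <> p \/ b <> q -> ind a b p q = 0%Z.
Proof.
  intros H. unfold ind. destruct a, b, p, q; cbn. eqbs; cbn; try reflexivity.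
  subst. destruct H; congruence.
Qed.

Lemma dl_anti f p q : (dl f q p = - dl f p q)%Z.
Proof.
  destruct f as [a b], p as [x y], q as [z t]; unfold dl; cbn [fst snd].
  eqbs; cbn; try reflexivity; eqbs; cbn; try lia.
Qed.

Lemma dl_h x y p q : adj p q ->
  (dl (x, y) p q - dl (x - 1, y) p q =
   ind (x, y + 1) (x, y) p q - ind (x, y) (x, y + 1) p q)%Z.
Proof.
  intros [d ->]. destruct p as [u v]. unfold dl, ind, step, padd; cbn [fst snd].
  destruct d; cbn [dvec fst snd]; repeat (eqbs; cbn [andb]); try lia.
Qed.

Definition I2 (x y : Z) (p : Point) : Z := if andb (Z.eqb (snd p) y) (Z.leb (fst p) x) then 1%Z else 0%Z.

(** Between the half-lines of two vertically adjacent squares lie the points of one row. Apart from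
    the edge in front of the tips, the two counts differ exactly when a step enters or leaves this
    piece of row; that is a difference of the potential [I2] and telescopes to 0 along a closed
    walk. *)
Lemma dl_v x y p q : adj p q ->
  (dl (x, y) p q - dl (x, y - 1) p q -
   (ind (x, y) (x + 1, y) p q - ind (x + 1, y) (x, y) p q) = I2 x y q - I2 x y p)%Z.
Proof.
  intros [d ->]. destruct p as [u v]. unfold dl, ind, I2, step, padd; cbn [fst snd].
  destruct d; cbn [dvec fst snd]; repeat (eqbs; cbn [andb]); try lia.
Qed.

Definition cadj (l : list Point) := chain adj (cl l).

Lemma sumw_0 l : sumw (fun _ _ => 0%Z) l = 0%Z.
Proof. induction l as [|p [|q t] IH]; simpl in *; auto. Qed.

Lemma wnd_h l x y : cadj l ->
  (wnd l (x, y) - wnd l (x - 1, y) =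
   sumw (ind (x, y + 1) (x, y)) (cl l) - sumw (ind (x, y) (x, y + 1)) (cl l))%Z.
Proof.
  intros H. unfold cadj in H. rewrite chain_stp in H. unfold wnd.
  pose proof (@sumw_ext (fun p q => dl (x, y) p q - dl (x - 1, y) p q - ind (x, y + 1) (x, y) p q)%Z
     (fun p q => 0 - 0 - ind (x, y) (x, y + 1) p q)%Z (cl l)) as E.
  rewrite !sumw_lin in E.
  rewrite sumw_0 in E.
  assert (E' := E (fun p q s => ltac:(pose proof (dl_h x y (H p q s)); lia))). lia.
Qed.

Lemma wnd_v l x y : cadj l ->
  (wnd l (x, y) - wnd l (x, y - 1) =
   sumw (ind (x, y) (x + 1, y)) (cl l) - sumw (ind (x + 1, y) (x, y)) (cl l))%Z.
Proof.
  intros H. unfold cadj in H. rewrite chain_stp in H. unfold wnd.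
  pose proof (@sumw_ext (fun p q => dl (x, y) p q - dl (x, y - 1) p q - ind (x, y) (x + 1, y) p q)%Z
     (fun p q => (I2 x y q - I2 x y p) - 0 - ind (x + 1, y) (x, y) p q)%Z (cl l)) as E.
  rewrite !sumw_lin in E.
  rewrite sumw_0, sumw_closed in E.
  assert (E' := E (fun p q s => ltac:(pose proof (dl_v x y (H p q s)); lia))). lia.
Qed.

(** The jump rule behind all later side arguments. On a simple curve the right-hand side is 1, -1 or
    0, which makes the discrete Jordan theorem a local computation around each vertex. *)
Lemma wnd_cross l p d : cadj l ->
  (wnd l (F p d) - wnd l (F p (rotm d)) =
   sumw (ind p (step p d)) (cl l) - sumw (ind (step p d) p) (cl l))%Z.
Proof.
  intros H. destruct p as [x y]. destruct d; cbn [F rotm fst snd].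
  - pose proof (wnd_v l x y H). unfold step, padd; cbn [dvec fst snd].
    replace (y + 0)%Z with y by lia. lia.
  - pose proof (wnd_h l x y H). unfold step, padd; cbn [dvec fst snd].
    replace (x + 0)%Z with x by lia. lia.
  - pose proof (wnd_h l x (y - 1) H) as E. unfold step, padd; cbn [dvec fst snd].
    replace (x + 0)%Z with x by lia. replace (y + -1)%Z with (y - 1)%Z by lia.
    replace (y - 1 + 1)%Z with y in E by lia. lia.
  - pose proof (wnd_v l (x - 1) y H) as E. unfold step, padd; cbn [dvec fst snd].
    replace (y + 0)%Z with y by lia. replace (x + -1)%Z with (x - 1)%Z by lia.
    replace (x - 1 + 1)%Z with x in E by lia. lia.
Qed.

Lemma stp_app l1 p l2 a b : stp (l1 ++ p :: l2) a b <-> stp (l1 ++ [p]) a b \/ stp (p :: l2) a b.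
Proof.
  split.
  - intros [u [v E]]. revert u E. induction l1 as [|x l1 IH]; intros u E.
    + right. exists u, v. exact E.
    + destruct u as [|y u]; simpl in E; injection E as -> E.
      * left. destruct l1 as [|z l1]; simpl in E; injection E as -> E.
        -- exists [], []. reflexivity.
        -- exists [], (l1 ++ [p]). reflexivity.
      * destruct (IH u E) as [[u' [v' E']]|H]; [left|right; exact H].
        exists (y :: u'), v'. simpl. now rewrite E'.
  - intros [[u [v E]]|[u [v E]]].
    + exists u. destruct (exists_last (l := b :: v)) as [w [z Ez]]; [discriminate|].
      assert (E2 : l1 ++ [p] = (u ++ a :: w) ++ [z]).
      { rewrite E, <- app_assoc. simpl. now rewrite Ez. }
      apply app_inj_tail in E2 as [-> ->]. exists (match w with [] => l2 | _ :: w' => w' ++ z :: l2 end).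
      destruct w as [|y w]; simpl in Ez; injection Ez as -> E3; rewrite <- app_assoc; reflexivity.
    + exists (l1 ++ u), v. rewrite <- app_assoc. now rewrite E.
Qed.

Lemma stp_cons p q l a b : stp (p :: q :: l) a b <-> (a = p /\ b = q) \/ stp (q :: l) a b.
Proof.
  split.
  - intros [[|x u] [v E]]; simpl in E.
    + left. inversion E; auto.
    + right. exists u, v. now inversion E.
  - intros [[-> ->]|[u [v E]]]; [exists [], l; reflexivity|]. exists (p :: u), v. simpl. now rewrite E.
Qed.

Lemma stp_one p a b : ~ stp [p] a b.
Proof. intros [[|x [|y u]] [v E]]; discriminate. Qed.

Lemma stp_in l a b : stp l a b -> In a l /\ In b l.
Proof. intros [u [v ->]]. split; apply in_or_app; right; simpl; auto. Qed.

Lemma cl_in l x : In x (cl l) <-> In x l.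
Proof.
  destruct l as [|p l]; [reflexivity|]. simpl. rewrite in_app_iff. simpl. tauto.
Qed.

Lemma cl_split l1 a l2 b : 
  cl ((a :: l1) ++ b :: l2) = (a :: l1) ++ b :: l2 ++ [a].
Proof. simpl. rewrite <- app_assoc. reflexivity. Qed.

Lemma sumw_cl_rot g l1 l2 : sumw g (cl (l1 ++ l2)) = sumw g (cl (l2 ++ l1)).
Proof.
  destruct l1 as [|a l1]; [now rewrite app_nil_r|].
  destruct l2 as [|b l2]; [now rewrite app_nil_r|].
  rewrite !cl_split, (sumw_app g (a :: l1)), (sumw_app g (b :: l2)).
  simpl app. lia.
Qed.

Lemma stp_cl_rot l1 l2 x y : stp (cl (l1 ++ l2)) x y <-> stp (cl (l2 ++ l1)) x y.
Proof.
  destruct l1 as [|a l1]; [now rewrite app_nil_r|].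
  destruct l2 as [|b l2]; [now rewrite app_nil_r|].
  rewrite !cl_split, (stp_app (a :: l1)), (stp_app (b :: l2)).
  simpl app. tauto.
Qed.

Lemma wnd_rot l1 l2 f : wnd (l1 ++ l2) f = wnd (l2 ++ l1) f.
Proof. apply sumw_cl_rot. Qed.

Lemma wnd_split a p b c f :
  wnd (a ++ p :: b ++ p :: c) f = (wnd (p :: b) f + wnd (a ++ p :: c) f)%Z.
Proof.
  rewrite (wnd_rot a), (wnd_rot a (p :: c)). unfold wnd. simpl app. unfold cl.
  replace ((p :: (b ++ p :: c) ++ a) ++ [p]) with ((p :: b) ++ p :: (c ++ a) ++ [p])
    by (simpl; rewrite <- !app_assoc; reflexivity).
  rewrite sumw_app. simpl app. reflexivity.
Qed.

Lemma cnt_0 a b l : ~ stp l a b -> sumw (ind a b) l = 0%Z.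
Proof.
  induction l as [|p [|q t] IH]; intros H; try reflexivity.
  change (ind a b p q + sumw (ind a b) (q :: t) = 0)%Z. rewrite stp_cons in H.
  rewrite IH by tauto. rewrite ind_0; [reflexivity|].
  destruct (pt_dec a p); destruct (pt_dec b q); tauto.
Qed.

Lemma cnt_1 a b l x : NoDup l -> stp (l ++ [x]) a b -> sumw (ind a b) (l ++ [x]) = 1%Z.
Proof.
  induction l as [|p l IH]; intros N H; [destruct (stp_one H)|].
  inversion N as [|? ? Np Nl]; subst.
  assert (Hq : exists q t, l ++ [x] = q :: t) by (destruct l; eexists; eexists; reflexivity).
  destruct Hq as [q [t Hq]]. simpl app in *. rewrite Hq in *.
  change (ind a b p q + sumw (ind a b) (q :: t) = 1)%Z. apply stp_cons in H.
  assert (Hno : ~ stp (q :: t) p b).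
  { rewrite <- Hq. intros [u [v E]].
    assert (In p l); [|tauto].
    destruct (exists_last (l := b :: v)) as [w [z Ez]]; [discriminate|].
    assert (E2 : l ++ [x] = (u ++ p :: w) ++ [z]) by (rewrite E, <- app_assoc; simpl; now rewrite Ez).
    apply app_inj_tail in E2 as [-> _]. apply in_or_app; simpl; auto. }
  destruct H as [[-> ->]|H].
  - rewrite ind_1, cnt_0; [reflexivity|exact Hno].
  - rewrite IH; auto. rewrite ind_0; [reflexivity|]. left. intros ->. tauto.
Qed.

Lemma cnt_cl a b l : NoDup l -> sumw (ind a b) (cl l) = 1%Z /\ stp (cl l) a b \/
  sumw (ind a b) (cl l) = 0%Z /\ ~ stp (cl l) a b.
Proof.
  intros N. destruct (classic (stp (cl l) a b)) as [H|H].
  - left. split; auto. destruct l; [destruct H as [[|] [? E]]; discriminate|]. now apply cnt_1.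
  - right. split; auto. now apply cnt_0.
Qed.

(** * Simple closed curves *)

(** The bound on the length excludes a single edge run through back and forth, which has no
    inside. *)
Definition Simple (l : list Point) := NoDup l /\ cadj l /\ 3 <= length l.

Lemma NoDup_swap {X} (l1 l2 : list X) : NoDup (l1 ++ l2) -> NoDup (l2 ++ l1).
Proof. intros H. apply NoDup_app; apply NoDup_app_remove_l in H as H1; apply NoDup_app_remove_r in H as H2; auto.
  intros a Ha Hb. clear H1 H2. induction l1 as [|x l1 IH]; [destruct Hb|].
  simpl in H. inversion H; subst. destruct Hb as [->|Hb]; [|auto].
  apply H2. apply in_or_app; auto.
Qed.

Lemma simple_at l p : Simple l -> In p l ->
  exists b t a, (forall x y, stp (cl l) x y <-> stp (p :: b :: t ++ [a; p]) x y) /\ NoDup (p :: b :: t ++ [a]).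
Proof.
  intros [N [C L]] Hp. apply in_split in Hp as [l1 [l2 ->]].
  assert (N' := NoDup_swap _ _ N). simpl in N'.
  destruct (l2 ++ l1) as [|b t'] eqn:E.
  { apply (f_equal (@length _)) in E. rewrite length_app in *. simpl in *. lia. }
  destruct (exists_last (l := t')) as [t [a Ea]].
  { intros ->. apply (f_equal (@length _)) in E. rewrite length_app in *. simpl in *. lia. }
  exists b, t, a. split.
  - intros x y. rewrite stp_cl_rot. simpl app. rewrite E, Ea. simpl cl. rewrite <- app_assoc. reflexivity.
  - rewrite Ea in N'. exact N'.
Qed.

Lemma simple_nbrs l p : Simple l -> In p l -> exists a b, a <> b /\
  (forall x, stp (cl l) p x <-> x = b) /\ (forall x, stp (cl l) x p <-> x = a).
Proof.
  intros S Hp. destruct (simple_at p S Hp) as [b [t [a [E N]]]].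
  exists a, b. inversion N as [|? ? N1 N2]; subst. inversion N2 as [|? ? N3 N4]; subst.
  split; [intros ->; apply N3; apply in_or_app; simpl; auto|].
  assert (Hu : forall x, stp (p :: b :: t ++ [a; p]) p x -> x = b).
  { intros x. rewrite stp_cons. intros [[_ H]|[u [v H]]]; auto. exfalso.
    change (b :: t ++ [a; p]) with ((b :: t) ++ [a] ++ [p]) in H. rewrite app_assoc in H.
    destruct (exists_last (l := x :: v)) as [w [z Ez]]; [discriminate|].
    rewrite Ez in H. 
    replace (u ++ p :: w ++ [z]) with ((u ++ p :: w) ++ [z]) in H by (rewrite <- app_assoc; reflexivity).
    apply app_inj_tail in H as [H _].
    apply N1. change (b :: t ++ [a]) with ((b :: t) ++ [a]). rewrite H. apply in_or_app; simpl; auto. }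
  split; intros x; rewrite E.
  - split; [apply Hu|]. intros ->. exists [], (t ++ [a; p]). reflexivity.
  - split.
    + intros [u [v H]]. destruct v as [|y v].
      * change (p :: b :: t ++ [a; p]) with ((p :: b :: t) ++ [a] ++ [p]) in H. rewrite app_assoc in H.
        replace (u ++ [x; p]) with ((u ++ [x]) ++ [p]) in H by (rewrite <- app_assoc; reflexivity).
        apply app_inj_tail in H as [H _]. apply app_inj_tail in H as [_ H]. auto.
      * exfalso.
        destruct (exists_last (l := y :: v)) as [w [z Ez]]; [discriminate|].
        change (p :: b :: t ++ [a; p]) with ((p :: b :: t) ++ [a] ++ [p]) in H. rewrite app_assoc in H.
        rewrite Ez in H.
        replace (u ++ x :: p :: w ++ [z]) with ((u ++ x :: p :: w) ++ [z]) in H by (rewrite <- app_assoc; reflexivity).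
        apply app_inj_tail in H as [H _].
        apply (f_equal (@tl _)) in H. simpl in H. apply N1. rewrite H.
        destruct u as [|c u]; simpl; [auto|]. apply in_or_app; simpl; auto.
    + intros ->. exists (p :: b :: t), []. reflexivity.
Qed.

Lemma rotm_face p d : F (step p d) (rotm (dopp d)) = F p d.
Proof. destruct p, d; unfold step, padd; cbn; f_equal; lia. Qed.

(** No edge at [p] is traversed, so the four squares around [p] have the same winding number. This
    is why [wnd l p] may be read as the winding number around the vertex [p], although formally it
    refers to the square at its upper right. *)
Lemma face_off l p : cadj l -> ~ In p l -> forall d, wnd l (F p d) = wnd l p.
Proof.
  intros C Hp.
  assert (H : forall d, wnd l (F p d) = wnd l (F p (rotm d))).
  { intros d. pose proof (wnd_cross l p d C).
    rewrite !cnt_0 in H; [lia| |]; intros Hs; apply stp_in in Hs; rewrite !cl_in in Hs; tauto. }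
  intros d. transitivity (wnd l (F p DE)); [|reflexivity].
  destruct d; [reflexivity| | |].
  - exact (H DN).
  - exact (eq_sym (H DE)).
  - exact (eq_sym (eq_trans (H DE) (H DS))).
Qed.

(** The square beside the edge from [p] to [x] is also one of the squares around [x]. This transfers
    the side of the curve towards which [x] lies, seen from a vertex [p] of the curve, to the
    winding number of [x]. *)
Lemma face_to l p x : cadj l -> adj p x -> ~ In x l -> wnd l (F p (dirof p x)) = wnd l x.
Proof.
  intros C [d ->] Hx. rewrite dirof_step, <- rotm_face. now apply face_off.
Qed.

Lemma wv_adj l p q : cadj l -> adj p q -> ~ In p l -> ~ In q l -> wnd l p = wnd l q.
Proof. intros C A Hp Hq. rewrite <- (face_to l C A Hq). symmetry. now apply face_off. Qed.

Lemma wv_chain l p s : cadj l -> chain adj (p :: s) -> (forall x, In x (p :: s) -> ~ In x l) ->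
  forall x, In x (p :: s) -> wnd l x = wnd l p.
Proof.
  intros C. revert p. induction s as [|q s IH]; intros p A H x [<-|Hx]; auto; [destruct Hx|].
  destruct A as [A1 A2]. rewrite (IH q); auto.
  - symmetry. apply wv_adj; auto; apply H; simpl; auto.
  - intros y Hy. apply H. right. exact Hy.
Qed.

Lemma wv_seq l (y : nat -> Point) n : cadj l -> (forall t, t < n -> adj (y t) (y (S t))) ->
  (forall t, t <= n -> ~ In (y t) l) -> wnd l (y n) = wnd l (y 0).
Proof.
  intros C. induction n; intros A H; auto. rewrite <- IHn; auto.
  symmetry. apply wv_adj; auto.
Qed.

Lemma wnd_far_x l f : (forall p, In p l -> (fst f < fst p)%Z) -> wnd l f = 0%Z.
Proof.
  intros H. unfold wnd. rewrite <- (sumw_0 (cl l)) at 1. apply sumw_ext. intros p q S.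
  apply stp_in in S as [S _]. rewrite cl_in in S. apply H in S. unfold dl. 
  repeat (eqbs; cbn [andb]); reflexivity.
Qed.

Lemma wnd_far_y l f : (forall p, In p l -> snd p <> snd f) -> wnd l f = 0%Z.
Proof.
  intros H. unfold wnd. rewrite <- (sumw_0 (cl l)) at 1. apply sumw_ext. intros p q S.
  apply stp_in in S as [S S']. rewrite cl_in in S, S'. apply H in S. apply H in S'. unfold dl. 
  repeat (eqbs; cbn [andb]); reflexivity.
Qed.

(** The half-line may well meet the curve here. But the curve does not pass east of the tip, so
    every crossing of the whole horizontal line is counted, and the net number of these telescopes
    to 0. *)
Lemma wnd_far_max l f : cadj l -> (forall p, In p l -> (fst p <= fst f)%Z) -> wnd l f = 0%Z.
Proof.
  intros C H. unfold wnd. 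
  set (I := fun p : Point => (if Z.leb (snd f + 1) (snd p) then -1 else 0)%Z).
  rewrite <- (sumw_closed I l). apply sumw_ext. intros p q S. unfold cadj in C. rewrite chain_stp in C.
  pose proof (C _ _ S) as [d ->].
  apply stp_in in S as [S S']. rewrite cl_in in S, S'. apply H in S. apply H in S'. unfold dl, I.
  destruct d; unfold step, padd in *; cbn in *;
  repeat (eqbs; cbn [andb]); reflexivity.
Qed.

(** Turning around a vertex [p] within the left sector, from the incoming to the outgoing edge,
    crosses no edge of the curve; so the square on the left is carried along from edge to edge
    without a jump. *)
Lemma simple_const l : Simple l -> exists k, forall p b, stp (cl l) p b -> wnd l (F p (dirof p b)) = k.
Proof.
  intros S. pose proof S as [N [C L]]. set (g := fun p b => wnd l (F p (dirof p b))).
  assert (A : forall p q, stp (cl l) p q -> adj p q) by now apply chain_stp.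
  assert (T : forall a p b, stp (cl l) a p -> stp (cl l) p b -> g a p = g p b).
  { intros a p b H1 H2. unfold g.
    pose proof (A _ _ H1) as A1. pose proof (A _ _ H2) as A2.
    assert (E : F a (dirof a p) = F p (rotm (dirof p a))).
    { destruct A1 as [d ->]. rewrite dirof_step, <- (rotm_face a d). f_equal. f_equal.
      rewrite <- (step_opp a d) at 2. now rewrite dirof_step. }
    rewrite E. clear E.
    apply adj_sym in A1.
    assert (Hp : In p l) by (apply stp_in in H2; rewrite <- cl_in; tauto).
    destruct (simple_nbrs p S Hp) as [a' [b' [Nab [Hn Hv]]]].
    apply Hv in H1 as ->. apply Hn in H2 as ->.
    assert (K : forall d, d <> dirof p a' -> d <> dirof p b' -> wnd l (F p d) = wnd l (F p (rotm d))).
    { intros d D1 D2. pose proof (wnd_cross l p d C) as W. rewrite !cnt_0 in W; [lia| |].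
      - rewrite Hv. intros <-. now rewrite dirof_step in D1.
      - rewrite Hn. intros <-. now rewrite dirof_step in D2. }
    assert (D : dirof p a' <> dirof p b') by (intros D; apply Nab; now apply (dirof_inj A1 A2)).
    generalize dependent (dirof p a'). generalize dependent (dirof p b'). intros o i K D.
    pose proof (K DE) as KE. pose proof (K DN) as KN. pose proof (K DW) as KW. pose proof (K DS) as KS.
    clear - D KE KN KW KS. cbn [rotm] in *.
    destruct i, o; try congruence;
    repeat match goal with H : ?a <> ?b -> _ |- _ => first [specialize (H ltac:(congruence)) | clear H] end;
    cbn [rotm] in *; congruence. }
  destruct (cl l) as [|p0 [|q0 L0]] eqn:E.
  - exists 0%Z. intros p b [[|] [? H]]; discriminate.
  - exists 0%Z. intros p b H. destruct (stp_one H).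
  - exists (g p0 q0). intros p b [u [v H]]. change (g p b = g p0 q0). revert p b v H.
    induction u as [|x u IH] using rev_ind; intros p b v H.
    + injection H as -> -> _. reflexivity.
    + rewrite <- app_assoc in H. simpl in H. rewrite <- (IH x p (b :: v) H). symmetry. apply T.
      * exists u, (b :: v). exact H.
      * exists (u ++ [x]), v. rewrite <- app_assoc. exact H.
Qed.

Lemma exists_max (l : list Point) (f : Point -> Z) : l <> [] -> exists p, In p l /\ forall q, In q l -> (f q <= f p)%Z.
Proof.
  induction l as [|p l IH]; [congruence|]. intros _. destruct l as [|q l].
  - exists p. simpl. split; auto. intros q [->|[]]. lia.
  - destruct IH as [m [Hm H]]; [discriminate|]. destruct (Z.leb_spec (f p) (f m)).
    + exists m. split; [right; auto|]. intros x [<-|Hx]; auto.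
    + exists p. split; [left; auto|]. intros x [<-|Hx]; [lia|]. apply H in Hx. lia.
Qed.

(** Discrete Jordan curve theorem in local form. The two sides differ by 1 because each edge is run
    through once and never backwards. The value is fixed at an easternmost vertex, whose eastern
    square has winding number 0: [k] is 1 for a counterclockwise curve and 0 for a clockwise one. *)
Theorem simple_sides l : Simple l -> exists k, (k = 0 \/ k = 1)%Z /\
  forall a p b, stp (cl l) a p -> stp (cl l) p b ->
    a <> b /\ wnd l (F p (dirof p b)) = k /\
    (forall d, Left (dirof p a) (dirof p b) d -> wnd l (F p d) = k) /\
    (forall d, Right (dirof p a) (dirof p b) d -> wnd l (F p d) = (k - 1)%Z).
Proof.
  intros S. pose proof S as [N [C L]]. destruct (simple_const S) as [k Hk].
  assert (A : forall p q, stp (cl l) p q -> adj p q) by now apply chain_stp.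
  assert (M : forall a p b, stp (cl l) a p -> stp (cl l) p b ->
    a <> b /\ wnd l (F p (dirof p b)) = k /\
    (forall d, Left (dirof p a) (dirof p b) d -> wnd l (F p d) = k) /\
    (forall d, Right (dirof p a) (dirof p b) d -> wnd l (F p d) = (k - 1)%Z)).
  { intros a p b H1 H2. pose proof (Hk _ _ H2) as Kb.
    pose proof (A _ _ H1) as A1. pose proof (A _ _ H2) as A2. apply adj_sym in A1.
    assert (Hp : In p l) by (apply stp_in in H2; rewrite <- cl_in; tauto).
    destruct (simple_nbrs p S Hp) as [a' [b' [Nab [Hn Hv]]]].
    apply Hv in H1 as ->. apply Hn in H2 as ->. split; auto. split; auto.
    assert (K : forall d, d <> dirof p a' -> d <> dirof p b' -> wnd l (F p d) = wnd l (F p (rotm d))).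
    { intros d D1 D2. pose proof (wnd_cross l p d C) as W. rewrite !cnt_0 in W; [lia| |].
      - rewrite Hv. intros <-. now rewrite dirof_step in D1.
      - rewrite Hn. intros <-. now rewrite dirof_step in D2. }
    assert (K2 : wnd l (F p (rotm (dirof p b'))) = (k - 1)%Z).
    { pose proof (wnd_cross l p (dirof p b') C) as W. rewrite (step_dirof A2) in W.
      destruct (cnt_cl p b' N) as [[W1 _]|[_ W1]]; [|exfalso; apply W1; now apply Hn].
      destruct (cnt_cl b' p N) as [[_ W2]|[W2 _]]; [apply Hv in W2; congruence|]. lia. }
    assert (D : dirof p a' <> dirof p b') by (intros D; apply Nab; now apply (dirof_inj A1 A2)).
    generalize dependent (dirof p a'). generalize dependent (dirof p b'). intros o Kb K2 i K D.
    pose proof (K DE) as KE. pose proof (K DN) as KN. pose proof (K DW) as KW. pose proof (K DS) as KS.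
    clear - Kb K2 D KE KN KW KS. cbn [rotm] in *.
    split; intros d; destruct i, o; try congruence; destruct d; unfold Left, Right; cbn -[F]; intros HH; try lia;
    repeat match goal with H : ?a <> ?b -> _ |- _ => first [specialize (H ltac:(congruence)) | clear H] end;
    cbn [rotm] in *; congruence. }
  exists k. split; [|exact M].
  destruct (@exists_max l fst) as [p [Hp Hmax]]; [intros ->; simpl in L; lia|].
  destruct (simple_nbrs p S Hp) as [a [b [Nab [Hn Hv]]]].
  assert (H1 : stp (cl l) a p) by now apply Hv. assert (H2 : stp (cl l) p b) by now apply Hn.
  destruct (M _ _ _ H1 H2) as [_ [_ [ML MR]]].
  pose proof (A _ _ H1) as A1. pose proof (A _ _ H2) as A2. apply adj_sym in A1.
  assert (W : wnd l (F p DE) = 0%Z) by (apply wnd_far_max; auto).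
  assert (Da : DE <> dirof p a).
  { intros E. apply step_dirof in A1. rewrite <- E in A1.
    apply stp_in in H1 as [H1 _]. rewrite cl_in in H1. apply Hmax in H1. rewrite <- A1 in H1.
    unfold step, padd in H1; cbn in H1; lia. }
  assert (Db : DE <> dirof p b).
  { intros E. apply step_dirof in A2. rewrite <- E in A2.
    apply stp_in in H2 as [_ H2]. rewrite cl_in in H2. apply Hmax in H2. rewrite <- A2 in H2.
    unfold step, padd in H2; cbn in H2; lia. }
  destruct (@left_or_right (dirof p a) (dirof p b) DE) as [HL|HR]; auto.
  - intros E. apply Nab. now apply (dirof_inj A1 A2).
  - apply ML in HL. lia.
  - apply MR in HR. lia.
Qed.

(** * Boxes and infinite simple paths *)

Fixpoint zseq (a : Z) (n : nat) : list Z := match n with 0 => [] | S n => a :: zseq (a + 1) n end.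

Lemma zseq_in a n x : (a <= x < a + Z.of_nat n)%Z -> In x (zseq a n).
Proof.
  revert a. induction n; intros a H; [lia|]. simpl.
  destruct (Z.eq_dec a x); [left; auto|right]. apply IHn. lia.
Qed.

Lemma box_list (B : Z) : exists L : list Point, forall p : Point,
  (- B <= fst p <= B)%Z -> (- B <= snd p <= B)%Z -> In p L.
Proof.
  set (s := zseq (- B) (Z.to_nat (2 * B + 1))). exists (list_prod s s).
  intros [x y] H1 H2. cbn [fst snd] in *. apply in_prod; apply zseq_in; lia.
Qed.

Lemma inj_leaves {X} (y : nat -> X) (L : list X) : (forall i j, y i = y j -> i = j) ->
  forall N, exists t, N <= t /\ ~ In (y t) L.
Proof.
  intros Hi N. apply NNPP. intros H.
  assert (Hin : incl (map y (seq N (S (length L)))) L).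
  { intros x Hx. apply in_map_iff in Hx as [t [<- Ht]]. apply in_seq in Ht.
    apply NNPP. intros Hn. apply H. exists t. split; [lia|auto]. }
  apply NoDup_incl_length in Hin.
  - rewrite length_map, length_seq in Hin. lia.
  - apply NoDup_map_NoDup_ForallPairs; [intros ? ? _ _; apply Hi|apply seq_NoDup].
Qed.

Lemma bound_list (l : list Point) : exists B, forall p, In p l -> (- B < fst p < B)%Z /\ (- B < snd p < B)%Z.
Proof.
  induction l as [|p l [B H]]; [exists 0%Z; intros p []|].
  exists (Z.abs B + Z.abs (fst p) + Z.abs (snd p) + 1)%Z. intros q [->|Hq]; [lia|].
  apply H in Hq. lia.
Qed.

(* An infinite simple path leaves every box, so it starts outside a curve it never meets. *)
Lemma wv_infinite l (y : nat -> Point) : cadj l -> (forall t, adj (y t) (y (S t))) ->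
  (forall i j, y i = y j -> i = j) -> (forall t, ~ In (y t) l) -> wnd l (y 0) = 0%Z.
Proof.
  intros C A Hi H. destruct (bound_list l) as [B HB]. destruct (box_list B) as [L HL].
  destruct (inj_leaves y L Hi 0) as [t [_ Ht]].
  rewrite <- (wv_seq l y (n := t)); auto.
  destruct (Z.lt_ge_cases (fst (y t)) (- B)).
  { apply wnd_far_x. intros p Hp. apply HB in Hp. lia. }
  destruct (Z.lt_ge_cases B (fst (y t))).
  { apply wnd_far_max; auto. intros p Hp. apply HB in Hp. lia. }
  apply wnd_far_y. intros p Hp E. apply HB in Hp. apply Ht, HL; lia.
Qed.

(** * Bonded paths and the abstract system *)

Definition org : Point := (0%Z, 0%Z).

Definition bdOf {X} (at_ : Dir -> X -> X -> Prop) (a : Point -> option X) (p q : Point) : Prop :=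
  exists d t t', q = step p d /\ a p = Some t /\ a q = Some t' /\ at_ d t t'.

Definition pathOf (B : Point -> Point -> Prop) (z : nat -> Point) (n : nat) : Prop :=
  z 0 = org /\ (forall i, i < n -> B (z i) (z (S i))) /\
  (forall i j, i <= n -> j <= n -> z i = z j -> i = j).

Definition cut (z : nat -> Point) (n : nat) (x : nat -> Point) : nat -> Point :=
  fun t => if t <=? n then z t else x (t - n).

Lemma cut_le z n x t : t <= n -> cut z n x t = z t.
Proof. intros H. unfold cut. destruct (Nat.leb_spec t n); [auto|lia]. Qed.

Lemma cut_gt z n x t : n < t -> cut z n x t = x (t - n).
Proof. intros H. unfold cut. destruct (Nat.leb_spec t n); [lia|auto]. Qed.

Lemma cut_add z n x k : x 0 = z n -> cut z n x (n + k) = x k.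
Proof.
  intros H. destruct (Nat.eq_dec k 0) as [->|]; [rewrite cut_le by lia; rewrite Nat.add_0_r; auto|].
  rewrite cut_gt by lia. f_equal. lia.
Qed.

Lemma pathOf_snoc (B : Point -> Point -> Prop) z n q : pathOf B z n -> B (z n) q ->
  (forall i, i <= n -> z i <> q) -> pathOf B (cut z n (fun _ => q)) (S n).
Proof.
  intros [H0 [H1 H2]] Bq N. split; [rewrite cut_le; auto; lia|]. split.
  - intros i Hi. destruct (Nat.eq_dec i n) as [->|]; [rewrite cut_le, cut_gt by lia; auto|].
    rewrite !cut_le by lia. apply H1. lia.
  - intros i j Hi Hj. destruct (Nat.le_gt_cases i n), (Nat.le_gt_cases j n).
    + rewrite !cut_le by lia. auto.
    + rewrite cut_le, cut_gt by lia. intros E. exfalso. apply (N i); auto.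
    + rewrite cut_gt, cut_le by lia. intros E. exfalso. apply (N j); auto.
    + lia.
Qed.

(* [sys_grow] is the only consequence of confluence that is used: a tile which fits at the
   end of a bonded path is the tile of the maximal assembly. *)
Class Sys := mkSys {
  tile : Type;
  att : Dir -> tile -> tile -> Prop;
  al : Point -> option tile;
  tls : list tile;
  att_sym : forall d t t', att d t t' -> att (dopp d) t' t;
  al_tls : forall p t, al p = Some t -> In t tls;
  sys_grow : forall z n d t t', pathOf (bdOf att al) z n -> al (z n) = Some t ->
    (forall i, i <= n -> z i <> step (z n) d) -> In t' tls -> att d t t' ->
    al (step (z n) d) = Some t';
  sys_reach : forall p, al p <> None -> exists z n, pathOf (bdOf att al) z n /\ z n = p
}.

(** * Infinite pigeonhole and extremal sequences *)

Lemma pigeon {V} (vals : list V) (P : nat -> V -> Prop) :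
  (forall N, exists n v, N <= n /\ In v vals /\ P n v) ->
  exists v, forall N, exists n, N <= n /\ P n v.
Proof.
  induction vals as [|v vals IH]; intros H.
  - destruct (H 0) as [n [v [_ [[] _]]]].
  - destruct (classic (forall N, exists n, N <= n /\ P n v)) as [A|A]; [exists v; auto|].
    apply not_all_ex_not in A as [N0 A]. apply IH. intros N.
    destruct (H (Nat.max N N0)) as [n [u [L [[<-|I] Pn]]]].
    + exfalso. apply A. exists n. split; [lia|auto].
    + exists n, u. split; [lia|auto].
Qed.

(** Dependent choice. A stage never changes the values that were fixed before it, so the stages have
    a limit, each prefix of which comes from a stage that satisfies [P]. *)
Lemma build (P : (nat -> Point) -> nat -> Prop) z0 n0 : P z0 n0 ->
  (forall z n, n0 <= n -> P z n -> exists z', (forall i, i <= n -> z' i = z i) /\ P z' (S n)) ->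
  exists r, (forall i, i <= n0 -> r i = z0 i) /\
    forall n, n0 <= n -> exists z, P z n /\ forall i, i <= n -> r i = z i.
Proof.
  intros H0 HS.
  assert (nx : forall m (z : {z | P z (n0 + m)}),
    {z' : {z' | P z' (n0 + S m)} | forall i, i <= n0 + m -> proj1_sig z' i = proj1_sig z i}).
  { intros m [z Pz]. apply constructive_indefinite_description.
    destruct (HS z (n0 + m)) as [z' [A B]]; [lia|auto|].
    replace (S (n0 + m)) with (n0 + S m) in B by lia. exists (exist _ z' B). exact A. }
  rewrite <- (Nat.add_0_r n0) in H0.
  set (s := fix s m : {z | P z (n0 + m)} :=
    match m with 0 => exist _ z0 H0 | S m => proj1_sig (nx m (s m)) end).
  assert (A : forall m k i, i <= n0 + m -> proj1_sig (s (m + k)) i = proj1_sig (s m) i).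
  { intros m k. induction k; intros i Hi; [now rewrite Nat.add_0_r|].
    rewrite Nat.add_succ_r. simpl. rewrite (proj2_sig (nx (m + k) (s (m + k)))) by lia. auto. }
  exists (fun i => proj1_sig (s (i - n0)) i). split.
  - intros i Hi. replace (i - n0) with 0 by lia. reflexivity.
  - intros n Hn. exists (proj1_sig (s (n - n0))). split.
    + pose proof (proj2_sig (s (n - n0))) as H. simpl in H. now replace (n0 + (n - n0)) with n in H by lia.
    + intros i Hi. replace (n - n0) with ((i - n0) + (n - n0 - (i - n0))) by lia.
      symmetry. apply A. lia.
Qed.

Lemma nat_min (P : nat -> Prop) : (exists n, P n) -> exists n, P n /\ forall m, P m -> n <= m.
Proof.
  intros [n H]. apply NNPP. intros C.
  assert (A : forall k m, m < k -> ~ P m).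
  { induction k; intros m Hm; [lia|]. intros Pm. apply C. exists m. split; auto.
    intros j Pj. destruct (Nat.le_gt_cases m j); auto. exfalso. apply (IHk j); [lia|auto]. }
  apply (A (S n) n); auto.
Qed.

(** At each step the best of the finitely many turns that extend to a member of [Cl] is taken. [Cl]
    need not be closed under limits, so only the prefixes of [r] are claimed to come from members of
    [Cl]. *)
Lemma greedy (c : bool) (Cl : (nat -> Point) -> Prop) z0 n0 : 1 <= n0 -> Cl z0 ->
  exists r, (forall i, i <= n0 -> r i = z0 i) /\
    (forall n, exists z, Cl z /\ forall i, i <= n -> r i = z i) /\
    forall n z, n0 <= n -> Cl z -> (forall i, i <= n -> z i = r i) ->
      ~ betterP c (r (n - 1)) (r n) (r (n + 1)) (z (n + 1)).
Proof.
  intros L C0.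
  set (opt := fun (r : nat -> Point) n => forall z, Cl z -> (forall i, i <= n -> z i = r i) ->
      ~ betterP c (r (n - 1)) (r n) (r (n + 1)) (z (n + 1))).
  assert (X : forall r r' n, (forall i, i <= S n -> r i = r' i) -> opt r n -> opt r' n).
  { intros r r' n E O z Cz Ez. rewrite <- !E by lia. apply O; auto. intros i Hi. rewrite Ez, E by lia. auto. }
  destruct (@build (fun z n => Cl z /\ forall k, n0 <= k -> k < n -> opt z k) z0 n0) as [r [R1 R2]].
  - split; auto. intros; lia.
  - intros z n Ln [Cz Oz].
    (* Smaller ranks are better; offset 0 is the way back to the previous vertex and receives the
       worst rank 4. *)
    set (mu := fun x => let k := off (dirof (z n) (z (n - 1))) (dirof (z n) x) in
      if c then 4 - k else if k =? 0 then 4 else k).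
    destruct (@nat_min (fun m => exists y, Cl y /\ (forall i, i <= n -> y i = z i) /\ mu (y (n + 1)) = m))
      as [m [[y [Cy [Ey Em]]] Hm]].
    { exists (mu (z (n + 1))), z. auto. }
    exists y. split; auto. split; auto. intros k Hk Hk'.
    destruct (Nat.eq_dec k n) as [->|Nk].
    + intros x Cx Ex B. rewrite !Ey in B by lia.
      assert (M : mu (y (n + 1)) <= mu (x (n + 1))).
      { rewrite Em. apply Hm. exists x. split; auto. split; auto. intros i Hi. rewrite Ex, Ey; auto. }
      unfold mu in M. clear - B M. unfold betterP in B.
      destruct c; unfold better in B.
      * assert (forall a b, off a b < 4) by (intros [] []; cbn; lia).
        pose proof (H (dirof (z n) (z (n - 1))) (dirof (z n) (x (n+1)))). lia.
      * revert M. destruct (Nat.eqb_spec (off (dirof (z n) (z (n - 1))) (dirof (z n) (y (n + 1)))) 0);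
        destruct (Nat.eqb_spec (off (dirof (z n) (z (n - 1))) (dirof (z n) (x (n + 1)))) 0); lia.
    + apply X with z; [|apply Oz; lia]. intros i Hi. symmetry. apply Ey. lia.
  - exists r. split; auto. split.
    + intros n. destruct (R2 (Nat.max n n0)) as [z [[Cz _] E]]; [lia|]. exists z. split; auto.
      intros i Hi. apply E. lia.
    + intros n z Ln Cz Ez. destruct (R2 (S n)) as [y [[Cy Oy] E]]; [lia|].
      assert (O : opt r n); [|apply O; auto].
      apply X with y; [|apply Oy; lia]. intros i Hi. symmetry. apply E. lia.
Qed.

Section Sys.
Context {SS : Sys}.

Definition Bd : Point -> Point -> Prop := bdOf att al.
Definition dom (p : Point) : Prop := al p <> None.
Definition fpath : (nat -> Point) -> nat -> Prop := pathOf Bd.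

Lemma Bd_adj p q : Bd p q -> adj p q.
Proof. intros [d [t [t' [E _]]]]. exists d; auto. Qed.

Lemma Bd_sym p q : Bd p q -> Bd q p.
Proof.
  intros [d [t [t' [-> [H1 [H2 H3]]]]]]. exists (dopp d), t', t. rewrite step_opp.
  repeat split; auto. now apply att_sym.
Qed.

Lemma chain_Bd_adj l : chain Bd l -> chain adj l.
Proof. apply chain_impl, Bd_adj. Qed.

Lemma Bd_dom p q : Bd p q -> dom p /\ dom q.
Proof. intros [d [t [t' [-> [H1 [H2 H3]]]]]]. unfold dom. rewrite H1, H2. split; congruence. Qed.

Lemma Bd_neq p q : Bd p q -> p <> q.
Proof. intros H. apply adj_neq. now apply Bd_adj. Qed.

(* The tile at [q], if there is one, plays no role here. *)
Definition bondable (p q : Point) : Prop :=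
  exists d t t', q = step p d /\ al p = Some t /\ In t' tls /\ att d t t'.

Lemma bondable_adj p q : bondable p q -> adj p q.
Proof. intros [d [t [t' [E _]]]]. exists d; auto. Qed.

Lemma Bd_shift p q p' q' v : Bd p q -> p' = padd p v -> q' = padd q v ->
  al p' = al p -> al q' = al q -> Bd p' q'.
Proof.
  intros [d [t [t' [-> [H1 [H2 H3]]]]]] -> -> E1 E2. exists d, t, t'.
  rewrite E1, E2. repeat split; auto. pts.
Qed.

Lemma bondable_shift p q p' q' v : Bd p q -> p' = padd p v -> q' = padd q v ->
  al p' = al p -> bondable p' q'.
Proof.
  intros [d [t [t' [-> [H1 [H2 H3]]]]]] -> -> E1. exists d, t, t'.
  rewrite E1. repeat split; auto; [pts|]. now apply al_tls in H2.
Qed.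

Lemma fpath_ext z z' n : (forall i, i <= n -> z' i = z i) -> fpath z n -> fpath z' n.
Proof.
  intros E [H0 [H1 H2]]. split; [rewrite E; auto; lia|]. split.
  - intros i Hi. rewrite !E by lia. auto.
  - intros i j Hi Hj. rewrite !E by lia. auto.
Qed.

Lemma fpath_le z n m : m <= n -> fpath z n -> fpath z m.
Proof.
  intros L [H0 [H1 H2]]. split; auto. split; intros; [apply H1|apply H2]; auto; lia.
Qed.

Lemma grow_step z n q : fpath z n -> bondable (z n) q -> (forall i, i <= n -> z i <> q) -> Bd (z n) q.
Proof.
  intros H [d [t [t' [-> [E1 [E2 E3]]]]]] N. exists d, t, t'. repeat split; auto.
  eapply sys_grow; eauto.
Qed.

(* A bonded path translated to the end of a path of the same tile reproduces its tiles as long as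
   it does not run into that path. *)
Lemma grow z n (y x : nat -> Point) v K : fpath z n -> x 0 = z n -> al (y 0) = al (z n) ->
  (forall k, x k = padd (y k) v) ->
  (forall k, k < K -> Bd (y k) (y (S k))) ->
  (forall k k', k <= K -> k' <= K -> y k = y k' -> k = k') ->
  (forall k i, 1 <= k -> k <= K -> i <= n -> x k <> z i) ->
  fpath (cut z n x) (n + K) /\ (forall k, k <= K -> al (x k) = al (y k)) /\
  (forall k, k < K -> Bd (x k) (x (S k))).
Proof.
  intros Hz X0 A0 Ex. induction K as [|K IH]; intros HB Hi Ha.
  - split; [|split].
    + rewrite Nat.add_0_r. apply fpath_ext with z; auto. intros; now apply cut_le.
    + intros k Hk. replace k with 0 by lia. congruence.
    + intros; lia.
  - destruct IH as [F1 [F2 F3]]; auto.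
    assert (Hx : forall k k', k <= S K -> k' <= S K -> x k = x k' -> k = k').
    { intros k k' H H' E. apply Hi; auto. rewrite !Ex in E. pts. }
    assert (Hn : forall i, i <= n + K -> cut z n x i <> x (S K)).
    { intros i Hle E. destruct (Nat.le_gt_cases i n).
      - rewrite cut_le in E by auto. apply (Ha (S K) i); auto; lia.
      - rewrite cut_gt in E by auto. apply Hx in E; lia. }
    assert (B : Bd (x K) (x (S K))).
    { rewrite <- (@cut_add z n x K) by auto. apply grow_step; auto.
      rewrite cut_add by auto. apply bondable_shift with (y K) (y (S K)) v; auto. }
    assert (E : al (x (S K)) = al (y (S K))).
    { pose proof (HB K (le_n _)) as [d [t [t' [E1 [E2 [E3 E4]]]]]].
      rewrite E3. replace (x (S K)) with (step (cut z n x (n + K)) d).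
      - apply sys_grow with t; auto.
        + rewrite cut_add by auto. rewrite F2; auto.
        + intros i Hle. specialize (Hn i Hle). intros C. apply Hn. rewrite C, cut_add by auto.
          rewrite !Ex, E1. pts.
        + now apply al_tls in E3.
      - rewrite cut_add by auto. rewrite !Ex, E1. pts. }
    split; [|split].
    + destruct F1 as [G0 [G1 G2]]. split; auto. split.
      * intros i Hle. destruct (Nat.eq_dec i (n + K)) as [->|].
        -- rewrite cut_add by auto. replace (S (n + K)) with (n + S K) by lia. rewrite cut_add; auto.
        -- apply G1. lia.
      * replace (n + S K) with (S (n + K)) by lia. intros i j Hle Hj Eij.
        assert (Q : cut z n x (S (n + K)) = x (S K)).
        { replace (S (n + K)) with (n + S K) by lia. now rewrite cut_add. }
        destruct (Nat.eq_dec i (S (n + K))) as [->|], (Nat.eq_dec j (S (n + K))) as [->|]; auto.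
        -- rewrite Q in Eij. exfalso. apply (Hn j); auto; lia.
        -- rewrite Q in Eij. exfalso. apply (Hn i); auto; lia.
        -- apply G2; auto; lia.
    + intros k Hk. destruct (Nat.eq_dec k (S K)) as [->|]; auto. apply F2. lia.
    + intros k Hk. destruct (Nat.eq_dec k K) as [->|]; auto. apply F3. lia.
Qed.

(** * Rays *)

Definition isray (r : nat -> Point) : Prop :=
  r 0 = org /\ (forall i, Bd (r i) (r (S i))) /\ (forall i j, r i = r j -> i = j).

Lemma isray_fpath r : isray r <-> forall n, fpath r n.
Proof.
  split.
  - intros [H0 [H1 H2]] n. split; auto.
  - intros H. split; [apply (H 0)|]. split.
    + intros i. apply (H (S i)). lia.
    + intros i j. apply (H (Nat.max i j)); lia.
Qed.

(* The extremal rays: [r] cannot be rerouted to the better side after [k0], within [D] from there on. *)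
Definition extremal (c : bool) (D : Point -> Prop) (k0 : nat) (r : nat -> Point) : Prop :=
  isray r /\ 1 <= k0 /\ (forall i, k0 < i -> D (r i)) /\
  forall z n, k0 <= n -> isray z -> (forall i, i <= n -> z i = r i) -> (forall i, n < i -> D (z i)) ->
    ~ betterP c (r (n - 1)) (r n) (r (n + 1)) (z (n + 1)).

Lemma extremal_ray c D k0 z0 : 1 <= k0 -> isray z0 -> (forall i, k0 < i -> D (z0 i)) ->
  exists r, extremal c D k0 r /\ forall i, i <= k0 -> r i = z0 i.
Proof.
  intros L R0 D0.
  destruct (@greedy c (fun z => isray z /\ forall i, k0 < i -> D (z i)) z0 k0) as [r [E [H O]]]; auto.
  assert (Dr : forall i, k0 < i -> D (r i)).
  { intros i Hi. destruct (H i) as [z [[_ Dz] Ez]]. rewrite Ez; auto. }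
  exists r. split; auto. split; [|split; auto].
  - apply isray_fpath. intros n. destruct (H n) as [z [[Rz _] Ez]]. apply fpath_ext with z; auto.
    now apply isray_fpath.
  - split; auto. intros z n Hn Rz Ez Dz. apply O; auto. split; auto. intros i Hi.
    destruct (Nat.le_gt_cases i n); auto. rewrite Ez; auto.
Qed.

(** Only prefixes with arbitrarily long extensions are kept; the pigeonhole principle over the four
    directions extends such a prefix by one step. *)
Lemma konig : (forall N, exists z, fpath z N) -> exists r, isray r.
Proof.
  intros H.
  set (P := fun z n => forall N, exists z', fpath z' N /\ forall i, i <= n -> z' i = z i).
  destruct (@build P (fun _ => org) 0) as [r [_ R]].
  - intros N. destruct (H N) as [z Hz]. exists z. split; auto. intros i Hi. 
    replace i with 0 by lia. apply Hz.
  - intros z n _ Pz.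
    destruct (@pigeon _ [DE; DN; DS; DW] (fun N d => exists z', fpath z' N /\ (forall i, i <= n -> z' i = z i)
       /\ z' (S n) = step (z n) d)) as [d Hd].
    + intros N. destruct (Pz (Nat.max N (S n))) as [z' [F E]].
      exists (Nat.max N (S n)), (dirof (z n) (z' (S n))). split; [lia|]. split.
      * destruct (dirof (z n) (z' (S n))); simpl; auto.
      * exists z'. split; auto. split; auto. symmetry. rewrite <- (E n) by lia. apply step_dirof.
        apply Bd_adj. apply F. lia.
    + exists (fun i => if i <=? n then z i else step (z n) d). split.
      * intros i Hi. destruct (Nat.leb_spec i n); [auto|lia].
      * intros N. destruct (Hd N) as [N' [L [z' [F [E1 E2]]]]]. exists z'. split.
        -- apply fpath_le with N'; auto.
        -- intros i Hi. destruct (Nat.leb_spec i n); [auto|]. replace i with (S n) by lia. auto.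
  - exists r. apply isray_fpath. intros n. destruct (R n) as [z [Pz E]]; [lia|].
    destruct (Pz n) as [z' [F E']]. apply fpath_ext with z'; auto. intros i Hi. rewrite E', E; auto.
Qed.

Lemma isray_cut r n x : isray r -> x 0 = r n -> (forall k, Bd (x k) (x (S k))) ->
  (forall k k', x k = x k' -> k = k') -> (forall k i, 1 <= k -> i <= n -> x k <> r i) ->
  isray (cut r n x).
Proof.
  intros [H0 [H1 H2]] X0 XB XI XN. split; [rewrite cut_le; auto; lia|]. split.
  - intros i. destruct (Nat.lt_trichotomy i n) as [L|[->|L]].
    + rewrite !cut_le by lia. auto.
    + rewrite cut_le, cut_gt by lia. rewrite <- X0. replace (S n - n) with 1 by lia. auto.
    + rewrite !cut_gt by lia. replace (S i - n) with (S (i - n)) by lia. auto.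
  - intros i j. destruct (Nat.le_gt_cases i n), (Nat.le_gt_cases j n).
    + rewrite !cut_le by lia. auto.
    + rewrite cut_le, cut_gt by lia. intros E. exfalso. apply (XN (j - n) i); auto; lia.
    + rewrite cut_gt, cut_le by lia. intros E. exfalso. apply (XN (i - n) j); auto; lia.
    + rewrite !cut_gt by lia. intros E. apply XI in E. lia.
Qed.

(* [r 0 .. r n], then the list [X], then [r b], [r (b+1)], ... *)
Definition via (r : nat -> Point) (n : nat) (X : list Point) (b : nat) : nat -> Point :=
  cut r n (fun k => if k =? 0 then r n else if k <=? length X then nth (k - 1) X org else r (k - 1 - length X + b)).

Lemma isray_via r n X b : isray r -> n < b -> NoDup X -> (forall p i, In p X -> p <> r i) ->
  chain Bd (r n :: X ++ [r b]) -> isray (via r n X b).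
Proof.
  intros R L ND Hn C. pose proof R as [H0 [H1 H2]].
  set (x := fun k => if k =? 0 then r n else if k <=? length X then nth (k - 1) X org else r (k - 1 - length X + b)).
  assert (X1 : forall k, 1 <= k <= length X -> x k = nth (k - 1) X org /\ In (x k) X).
  { intros k Hk. unfold x. destruct (Nat.eqb_spec k 0); [lia|]. destruct (Nat.leb_spec k (length X)); [|lia].
    split; auto. apply nth_In. lia. }
  assert (X2 : forall k, length X < k -> x k = r (k - 1 - length X + b)).
  { intros k Hk. unfold x. destruct (Nat.eqb_spec k 0); [lia|]. destruct (Nat.leb_spec k (length X)); [lia|auto]. }
  apply isray_cut; auto.
  - intros k. fold (x k) (x (S k)).
    destruct (Nat.le_gt_cases k (length X)) as [Lk|Lk].
    + assert (E : forall j, j <= S (length X) -> nth j (r n :: X ++ [r b]) org = x j).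
      { intros j Hj. destruct j as [|j]; [reflexivity|]. simpl. destruct (Nat.le_gt_cases (S j) (length X)).
        - rewrite app_nth1 by lia. rewrite (proj1 (X1 (S j) ltac:(lia))). f_equal. lia.
        - rewrite app_nth2 by lia. replace (j - length X) with 0 by lia. rewrite X2 by lia.
          simpl. f_equal. lia. }
      rewrite <- !E by lia. clear E. revert C.
      assert (Lk2 : S k < length (r n :: X ++ [r b])) by (simpl; rewrite length_app; simpl; lia).
      revert Lk2. generalize (r n :: X ++ [r b]). clear.
      induction k; intros [|p [|q t]]; simpl; try lia; intros Lk C; [tauto|].
      apply (IHk (q :: t)); simpl; [lia|tauto].
    + rewrite !X2 by lia. replace (S k - 1 - length X + b) with (S (k - 1 - length X + b)) by lia. auto.
  - intros k k'. fold (x k) (x k'). intros E.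
    assert (W : forall k k', x k = x k' -> k <= k' -> k = k'); [|destruct (Nat.le_ge_cases k k'); [|symmetry]; auto].
    clear k k' E. intros k k' E Hk.
    destruct (Nat.eq_dec k 0) as [->|].
    + destruct (Nat.eq_dec k' 0); auto. exfalso. change (x 0) with (r n) in E.
      destruct (Nat.le_gt_cases k' (length X)).
      * apply (Hn (x k') n); auto. apply X1; lia.
      * rewrite X2 in E by auto. apply H2 in E. lia.
    + destruct (Nat.le_gt_cases k (length X)), (Nat.le_gt_cases k' (length X)).
      * rewrite (proj1 (X1 k ltac:(lia))), (proj1 (X1 k' ltac:(lia))) in E.
        apply (proj1 (NoDup_nth X org)) in E; auto; lia.
      * exfalso. rewrite (X2 k') in E by auto. destruct (X1 k ltac:(lia)) as [_ I]. now apply Hn in E.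
      * lia.
      * rewrite !X2 in E by auto. apply H2 in E. lia.
  - intros k i Hk Hi. fold (x k). destruct (Nat.le_gt_cases k (length X)).
    + apply Hn. apply X1. lia.
    + rewrite X2 by auto. intros E. apply H2 in E. lia.
Qed.

Lemma via_le r n X b i : i <= n -> via r n X b i = r i.
Proof. apply cut_le. Qed.

Lemma via_next r n X b : via r n X b (n + 1) = hd (r b) X.
Proof.
  unfold via. rewrite cut_gt by lia. replace (n + 1 - n) with 1 by lia. destruct X; simpl; auto.
Qed.

Lemma via_in r n X b i : n < i -> In (via r n X b i) X \/ exists j, b <= j /\ via r n X b i = r j.
Proof.
  intros H. unfold via. rewrite cut_gt by lia. destruct (Nat.eqb_spec (i - n) 0); [lia|].
  destruct (Nat.leb_spec (i - n) (length X)).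
  - left. apply nth_In. lia.
  - right. eexists. split; [|reflexivity]. lia.
Qed.

(** The equation is [r (j + m) = r (i + m) + (r j - r i)], written without subtraction. *)
Definition rayper (r : nat -> Point) : Prop :=
  exists i j, i < j /\ forall m, padd (r (i + m)) (r j) = padd (r (j + m)) (r i) /\ al (r (i + m)) = al (r (j + m)).

End Sys.

(** * Comparing a ray with its own translate *)

Definition psub (a b : Point) : Point := (fst a - fst b, snd a - snd b)%Z.

Section Sys.
Context {SS : Sys}.

(** Equal outgoing directions give the two tails a common first step. Where they separate later,
    they therefore arrive from the same direction, and their continuations can be compared by
    [better]. *)
Definition same_state (r : nat -> Point) (i j : nat) : Prop :=
  al (r i) = al (r j) /\ dirof (r i) (r (i - 1)) = dirof (r j) (r (j - 1)) /\
  dirof (r i) (r (i + 1)) = dirof (r j) (r (j + 1)).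

(* The part of [r] after [j], translated to [i], follows [r] for [m] steps, leaves it at [r (i + m)]
   towards the better side, and its [k]-th point after that is either on [r] before [i] or outside [D]. *)
Definition deviates (c : bool) (D : Point -> Prop) (r : nat -> Point) (i j : nat) : Prop :=
  exists m k (x : nat -> Point), 1 <= m /\ 1 <= k /\
    (forall t, x t = padd (r (j + m + t)) (psub (r i) (r j))) /\ x 0 = r (i + m) /\
    (forall t, t <= m -> r (i + t) = padd (r (j + t)) (psub (r i) (r j))) /\
    betterP c (r (i + m - 1)) (r (i + m)) (r (i + m + 1)) (x 1) /\
    (forall t s, 1 <= t -> t < k -> x t <> r s) /\
    (forall t, 1 <= t -> t < k -> D (x t)) /\
    (forall t, t + 1 < k -> Bd (x t) (x (t + 1))) /\
    bondable (x (k - 1)) (x k) /\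
    ((exists a, a < i /\ x k = r a) \/
     ((forall s, x k <> r s) /\ ~ D (x k) /\ Bd (x (k - 1)) (x k))).

(** After the separation the translate [x] is followed until it meets [r] or leaves [D]. It cannot
    meet [r] between [i] and [i + m], since that part and [x] are translates by the same vector of
    disjoint parts of [r]. A meeting after [i + m] would give a better detour. So a meeting takes
    place before [i]. *)
Lemma compare_half c D k0 r i j m : extremal c D k0 r -> k0 < i -> al (r i) = al (r j) -> 1 <= m ->
  (forall t, t <= m -> r (i + t) = padd (r (j + t)) (psub (r i) (r j))) ->
  betterP c (r (i + m - 1)) (r (i + m)) (r (i + m + 1)) (padd (r (j + m + 1)) (psub (r i) (r j))) ->
  deviates c D r i j.
Proof.
  intros [R [L0 [HD O]]] Hi A Hm C B. pose proof R as [R0 [R1 R2]].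
  set (v := psub (r i) (r j)) in *.
  set (x := fun t => padd (r (j + m + t)) v).
  assert (X0 : x 0 = r (i + m)) by (unfold x; rewrite C by lia; now rewrite Nat.add_0_r).
  assert (Xi : forall t t', x t = x t' -> t = t').
  { intros t t' E. assert (j + m + t = j + m + t'); [|lia]. apply R2. unfold x in E. pts. }
  (* The common part is a translated path, so it carries the same tiles; the translation can thus be
     restarted at [r (i + m)]. *)
  assert (A' : al (r (j + m)) = al (r (i + m))).
  { destruct (@grow _ r i (fun t => r (j + t)) (fun t => padd (r (j + t)) v) v m) as [_ [G _]]; auto.
    - now apply isray_fpath.
    - rewrite <- C by lia. now rewrite Nat.add_0_r.
    - now rewrite Nat.add_0_r.
    - intros k Hk. rewrite Nat.add_succ_r. auto.
    - intros k k' _ _ E. apply R2 in E. lia.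
    - intros k s H1 H2 Hs E. rewrite <- C in E by lia. apply R2 in E. lia.
    - specialize (G m (le_n _)). rewrite <- G, <- C; auto. }
  assert (HG : forall K, (forall k s, 1 <= k -> k <= K -> s <= i + m -> x k <> r s) ->
     fpath (cut r (i + m) x) (i + m + K) /\ (forall k, k <= K -> al (x k) = al (r (j + m + k))) /\
     (forall k, k < K -> Bd (x k) (x (S k)))).
  { intros K HK. apply (@grow _ r (i + m) (fun t => r (j + m + t)) x v K); auto.
    - now apply isray_fpath.
    - now rewrite Nat.add_0_r.
    - intros k Hk. rewrite Nat.add_succ_r. auto.
    - intros k k' _ _ E. apply R2 in E. lia. }
  (* If this never happened, [r] up to [i + m] followed by [x] would be a ray on the better side,
     against extremality. *)
  destruct (@nat_min (fun k => 1 <= k /\ ((exists s, x k = r s) \/ ~ D (x k)))) as [k [[K1 K2] Kmin]].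
  { apply NNPP. intros N.
    assert (N' : forall k, 1 <= k -> (forall s, x k <> r s) /\ D (x k)).
    { intros k Hk. split.
      - intros s E. apply N. exists k. split; auto. left. exists s; auto.
      - apply NNPP. intros ND. apply N. exists k. auto. }
    apply (O (cut r (i + m) x) (i + m)); auto; try lia.
    - apply isray_cut; auto.
      + intros k. apply (HG (S k)); [|lia]. intros k' s H1 _ _. now apply N'.
      + intros k s Hk _. now apply N'.
    - intros t Ht. now apply cut_le.
    - intros t Ht. rewrite cut_gt by auto. apply N'. lia.
    - rewrite cut_add; auto. }
  assert (N' : forall t, 1 <= t -> t < k -> (forall s, x t <> r s) /\ D (x t)).
  { intros t T1 T2. split.
    - intros s E. assert (k <= t); [|lia]. apply Kmin. split; auto. left. exists s; auto.
    - apply NNPP. intros ND. assert (k <= t); [|lia]. apply Kmin. auto. }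
  destruct (HG (k - 1)) as [G1 [G2 G3]].
  { intros t s T1 T2 _. apply N'; lia. }
  assert (BB : bondable (x (k - 1)) (x k)).
  { apply bondable_shift with (r (j + m + (k - 1))) (r (j + m + k)) v; auto.
    - replace (j + m + k) with (S (j + m + (k - 1))) by lia. auto. }
  exists m, k, x.
  split; [auto|]. split; [auto|]. split; [auto|]. split; [auto|]. split; [auto|]. split; [auto|].
  split; [intros; now apply N'|]. split; [intros; now apply N'|].
  split; [intros t Ht; rewrite Nat.add_1_r; apply G3; lia|]. split; [auto|].
  assert (Gk : (forall s, s <= i + m -> x k <> r s) -> Bd (x (k - 1)) (x k)).
  { intros Hs. destruct (HG k) as [_ [_ G]].
    - intros t s T1 T2 S1. destruct (Nat.eq_dec t k) as [->|]; auto. apply N'; lia.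
    - specialize (G (k - 1)). replace (S (k - 1)) with k in G by lia. apply G. lia. }
  destruct (classic (exists s, x k = r s)) as [[s Es]|Ns].
  - left. destruct (Nat.le_gt_cases s (i + m)) as [Ls|Ls].
    + exists s. split; auto. destruct (Nat.lt_ge_cases s i); auto. exfalso.
      assert (E : r (i + (s - i)) = padd (r (j + (s - i))) v) by (apply C; lia).
      replace (i + (s - i)) with s in E by lia. rewrite <- Es in E. unfold x in E.
      assert (j + m + k = j + (s - i)); [|lia]. apply R2. pts.
    (* The translate comes back to a later vertex [r s] and is bonded to it, as it has not visited
       [r s] before. Rejoining [r] there gives a better ray, unless the detour is the step of [r]
       itself, which is not better than itself. *)
    + exfalso. 
      assert (Hb : Bd (x (k - 1)) (x k)).
      { apply Gk. intros s' Hs' E. rewrite Es in E. apply R2 in E. lia. }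
      set (X := map x (seq 1 (k - 1))).
      assert (InX : forall p, In p X -> exists t, 1 <= t < k /\ p = x t).
      { intros p Hp. apply in_map_iff in Hp as [t [<- Ht]]. apply in_seq in Ht. exists t. split; auto; lia. }
      destruct (Nat.eq_dec k 1) as [->|Nk].
      * destruct (Nat.eq_dec s (i + m + 1)) as [->|].
        -- fold v in B. change (padd (r (j + m + 1)) v) with (x 1) in B. rewrite Es in B. clear - B.
           destruct c; dirs.
        -- apply (O (via r (i + m) [] s) (i + m)); auto; try lia.
           ++ apply isray_via; auto.
              ** apply NoDup_nil.
              ** simpl. split; auto. rewrite <- X0, <- Es. exact Hb.
           ++ intros t Ht. now apply via_le.
           ++ intros t Ht. destruct (via_in r [] s Ht) as [[]|[q [Hq ->]]]. apply HD. lia.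
           ++ rewrite via_next. simpl. rewrite <- Es. exact B.
      * apply (O (via r (i + m) X s) (i + m)); auto; try lia.
        -- apply isray_via; auto.
           ++ unfold X. apply NoDup_map_NoDup_ForallPairs; [intros ? ? _ _; apply Xi|apply seq_NoDup].
           ++ intros p q Hp. apply InX in Hp as [t [Ht ->]]. apply N'; lia.
           ++ rewrite <- X0, <- Es. unfold X.
              replace (x 0 :: map x (seq 1 (k - 1)) ++ [x k]) with (map x (seq 0 (S k))).
              ** assert (Q : forall t, t < k -> Bd (x t) (x (S t))).
                 { intros t Ht. destruct (Nat.eq_dec t (k - 1)) as [->|]; [|apply G3; lia].
                   now replace (S (k - 1)) with k by lia. }
                 clear - Q. assert (W : forall n a, a + n <= k -> chain Bd (map x (seq a (S n)))).
                 { induction n; intros a Ha; simpl; auto. split; [apply Q; lia|]. apply (IHn (S a)). lia. }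
                 apply W. lia.
              ** replace (S k) with (S (k - 1 + 1)) by lia. simpl. rewrite seq_app, map_app. simpl. 
                 repeat f_equal. lia.
        -- intros t Ht. now apply via_le.
        -- intros t Ht. destruct (via_in r X s Ht) as [Hx|[q [Hq ->]]]; [|apply HD; lia].
           apply InX in Hx as [t' [Ht' ->]]. apply N'; lia.
        -- rewrite via_next. unfold X. destruct k as [|[|k]]; [lia|lia|]. simpl. exact B.
  - right. assert (Ns' : forall s, x k <> r s) by (intros s E; apply Ns; exists s; auto).
    split; auto. split; auto. destruct K2 as [[s E]|]; auto. now apply Ns' in E.
Qed.

(** At the first separation one of the two directions is better, but not known which; hence the two
    symmetric alternatives, according to which tail is translated onto the other. *)
Lemma compare c D k0 r i j : extremal c D k0 r -> k0 < i -> k0 < j -> same_state r i j ->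
  (forall m, padd (r (i + m)) (r j) = padd (r (j + m)) (r i) /\ al (r (i + m)) = al (r (j + m))) \/
  deviates c D r i j \/ deviates c D r j i.
Proof.
  intros H Hi Hj [A [E1 E2]]. pose proof H as [R [L0 [HD O]]]. pose proof R as [R0 [R1 R2]].
  set (P := fun t => r (i + t) = padd (r (j + t)) (psub (r i) (r j))).
  assert (P' : forall t, P t -> r (j + t) = padd (r (i + t)) (psub (r j) (r i))).
  { intros t Ht. red in Ht. unfold psub in *. pts. }
  destruct (classic (forall t, P t)) as [C|C].
  - left. intros m. split; [pose proof (C m) as Cm; red in Cm; unfold psub in Cm; pts|].
    destruct (@grow _ r i (fun t => r (j + t)) (fun t => padd (r (j + t)) (psub (r i) (r j))) (psub (r i) (r j)) m) as [_ [G _]]; auto.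
    + now apply isray_fpath.
    + rewrite <- (C 0). now rewrite Nat.add_0_r.
    + rewrite Nat.add_0_r; auto.
    + intros k Hk. rewrite Nat.add_succ_r. auto.
    + intros k k' _ _ E. apply R2 in E. lia.
    + intros k s K1 K2 Hs E. rewrite <- (C k) in E by lia. apply R2 in E. lia.
    + specialize (G m (le_n _)). now rewrite <- G, <- (C m).
  - right. destruct (@nat_min (fun t => ~ P t)) as [m' [Nm Hm]].
    { apply not_all_ex_not in C. exact C. }
    assert (Q : forall t, t < m' -> P t).
    { intros t Ht. apply NNPP. intros N. apply Hm in N. lia. }
    assert (P0 : P 0) by (red; rewrite !Nat.add_0_r; unfold psub; pts).
    assert (P1 : P 1).
    { red. pose proof (step_dirof (Bd_adj (R1 i))) as S1. pose proof (step_dirof (Bd_adj (R1 j))) as S2.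
      rewrite !Nat.add_1_r in *. rewrite <- S1, <- S2, E2. unfold psub. pts. }
    assert (2 <= m'). { destruct m' as [|[|m']]; [tauto|tauto|lia]. }
    set (m := m' - 1). replace m' with (S m) in * by lia.
    set (v := psub (r i) (r j)) in *.
    assert (Hin : dirof (r (i + m)) (r (i + m - 1)) = dirof (r (j + m)) (r (j + m - 1))).
    { pose proof (Q (m - 1) ltac:(lia)) as Q1. pose proof (Q m ltac:(lia)) as Q2. red in Q1, Q2.
      replace (i + (m - 1)) with (i + m - 1) in Q1 by lia. replace (j + (m - 1)) with (j + m - 1) in Q1 by lia.
      rewrite Q1, Q2. apply dirof_padd. }
    set (di := dirof (r (i + m)) (r (i + m + 1))).
    set (dj := dirof (r (j + m)) (r (j + m + 1))).
    assert (Ai : adj (r (i + m)) (r (i + m + 1))) by (rewrite Nat.add_1_r; apply Bd_adj; auto).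
    assert (Aj : adj (r (j + m)) (r (j + m + 1))) by (rewrite Nat.add_1_r; apply Bd_adj; auto).
    assert (Nd : di <> dj).
    { intros E. apply Nm. red. rewrite <- !Nat.add_succ_comm. 
      pose proof (Q m ltac:(lia)) as Q2. red in Q2.
      pose proof (step_dirof Ai) as S1. pose proof (step_dirof Aj) as S2. fold di in S1. fold dj in S2.
      replace (S i + m) with (i + m + 1) by lia. replace (S j + m) with (j + m + 1) by lia.
      rewrite <- S1, <- S2, E, Q2. pts. }
    assert (Nb : forall q, adj (r (q + m)) (r (q + m + 1)) -> dirof (r (q + m)) (r (q + m - 1)) <> dirof (r (q + m)) (r (q + m + 1))).
    { intros q Aq E. apply dirof_inj in E; auto.
      - apply R2 in E. lia.
      - apply adj_sym. pose proof (R1 (q + m - 1)) as Bq. apply Bd_adj in Bq.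
        now replace (S (q + m - 1)) with (q + m) in Bq by lia. }
    assert (D1 : dirof (r (i + m)) (padd (r (j + m + 1)) v) = dj).
    { pose proof (Q m ltac:(lia)) as Q2. red in Q2. rewrite Q2. apply dirof_padd. }
    assert (D2 : dirof (r (j + m)) (padd (r (i + m + 1)) (psub (r j) (r i))) = di).
    { pose proof (P' _ (Q m ltac:(lia))) as Q2. rewrite Q2. apply dirof_padd. }
    destruct (@better_total c (dirof (r (i + m)) (r (i + m - 1))) di dj) as [B|B]; auto.
    + rewrite Hin. apply not_eq_sym. now apply Nb.
    + left. eapply compare_half with (m := m); eauto; try lia.
      * intros t Ht. apply Q. lia.
      * red. fold v. now rewrite D1.
    + right. eapply compare_half with (m := m); eauto; try lia.
      * intros t Ht. apply P', Q. lia.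
      * red. rewrite D2. rewrite <- Hin. exact B.
Qed.

(** * Arcs and exposed vertices *)

(* An arc from [r b] that leaves [r] on the better side and could be bonded back to [r a]. *)
Definition larc (c : bool) (r : nat -> Point) (a b : nat) (A : list Point) : Prop :=
  a < b /\ NoDup A /\ (forall p s, In p A -> p <> r s) /\ chain Bd (r b :: A) /\
  betterP c (r (b - 1)) (r b) (r (b + 1)) (hd (r a) A) /\ bondable (last A (r b)) (r a).

Definition exposed (c : bool) (r : nat -> Point) (j : nat) : Prop :=
  forall a b A, larc c r a b A -> ~ (a < j /\ j < b).

Lemma chain_map_seq (R : Point -> Point -> Prop) x n a :
  (forall t, a <= t -> t < a + n -> R (x t) (x (S t))) -> chain R (map x (seq a (S n))).
Proof.
  revert a. induction n; intros a Q; simpl; auto. split; [apply Q; lia|].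
  apply (IHn (S a)). intros; apply Q; lia.
Qed.

Lemma map_seq_snoc (x : nat -> Point) a n : map x (seq a (S n)) = map x (seq a n) ++ [x (a + n)].
Proof. rewrite seq_S, map_app. reflexivity. Qed.

Lemma last_map_seq (x : nat -> Point) n d : x 0 = d -> last (map x (seq 1 n)) d = x n.
Proof.
  intros H. destruct n; [auto|]. rewrite map_seq_snoc, last_last. reflexivity.
Qed.

Lemma state_pigeon (r : nat -> Point) (P : nat -> Prop) : (forall N, exists n, N <= n /\ P n) ->
  (forall i, dom (r i)) ->
  exists i, P i /\ exists j, i < j /\ P j /\ same_state r i j.
Proof.
  intros H Hd.
  set (dl4 := [DE; DN; DS; DW]). assert (Hdl : forall d, In d dl4) by (intros []; simpl; auto).
  destruct (@pigeon _ (list_prod (list_prod tls dl4) dl4) (fun n v => P n /\ al (r n) = Some (fst (fst v))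
     /\ dirof (r n) (r (n - 1)) = snd (fst v) /\ dirof (r n) (r (n + 1)) = snd v)) as [v Hv].
  - intros N. destruct (H N) as [n [L Pn]]. specialize (Hd n). red in Hd.
    destruct (al (r n)) as [t|] eqn:E; [|congruence].
    exists n, (t, dirof (r n) (r (n - 1)), dirof (r n) (r (n + 1))). split; auto. split.
    + repeat apply in_prod; auto. now apply al_tls in E.
    + simpl. auto.
  - destruct (Hv 0) as [i [_ [Pi [I1 [I2 I3]]]]]. destruct (Hv (S i)) as [j [L [Pj [J1 [J2 J3]]]]].
    exists i. split; auto. exists j. split; auto. split; auto. red. rewrite I1, I2, I3, J1, J2, J3. auto.
Qed.

Lemma isray_dom r i : isray r -> dom (r i).
Proof. intros [_ [H _]]. apply (Bd_dom (H i)). Qed.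

(** With [D] the whole plane, a deviation at [i] can only end on [r] before [i]. It then is an arc
    from [i + m] back to some [a < i], and passes over [i]. *)
Lemma exposed_periodic c k0 r : extremal c (fun _ => True) k0 r ->
  (forall N, exists n, N <= n /\ exposed c r n) -> rayper r.
Proof.
  intros H E. pose proof H as [R _].
  destruct (@state_pigeon r (fun n => k0 < n /\ exposed c r n)) as [i [[Li Xi] [j [Lij [[Lj Xj] S]]]]].
  - intros N. destruct (E (Nat.max N (S k0))) as [n [L X]]. exists n. split; [lia|]. split; [lia|auto].
  - intros i. now apply isray_dom.
  - assert (W : forall i j, exposed c r i -> ~ deviates c (fun _ => True) r i j).
    { clear - R. intros i j X [m [k [x [M1 [K1 [EX [X0 [_ [B [N [_ [C [BB [[a [La Ea]]|[_ [F _]]]]]]]]]]]]]]]].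
      2:{ apply F; auto. }
      apply (X a (i + m) (map x (seq 1 (k - 1)))); [|lia]. split; [lia|]. split; [|split; [|split; [|split]]].
      - apply NoDup_map_NoDup_ForallPairs; [|apply seq_NoDup]. intros t t' _ _ Et. rewrite !EX in Et.
        assert (j + m + t = j + m + t'); [|lia]. apply R. pts.
      - intros p s Hp. apply in_map_iff in Hp as [t [<- Ht]]. apply in_seq in Ht. apply N; lia.
      - rewrite <- X0. apply (@chain_map_seq Bd x (k - 1) 0). intros t _ Ht. rewrite <- Nat.add_1_r. apply C. lia.
      - rewrite <- Ea. destruct k as [|[|k]]; [lia|exact B|exact B].
      - rewrite last_map_seq by auto. now rewrite <- Ea. }
    destruct (compare H Li Lj S) as [C|[C|C]].
    + exists i, j. auto.
    + exfalso. now apply (W i j).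
    + exfalso. now apply (W j i).
Qed.

End Sys.

(** * Segments of a ray and the curves closed by arcs *)

Definition seg (r : nat -> Point) (a b : nat) : list Point := map r (seq a (S b - a)).

Lemma in_seg r a b p : In p (seg r a b) <-> exists t, a <= t <= b /\ p = r t.
Proof.
  unfold seg. rewrite in_map_iff. split.
  - intros [t [<- H]]. apply in_seq in H. exists t. split; auto; lia.
  - intros [t [H ->]]. exists t. split; auto. apply in_seq. lia.
Qed.

Lemma seg_cons r a b : a <= b -> seg r a b = r a :: seg r (S a) b.
Proof. intros H. unfold seg. replace (S b - a) with (S (S b - S a)) by lia. reflexivity. Qed.

Lemma seg_snoc r a b : a <= S b -> seg r a (S b) = seg r a b ++ [r (S b)].
Proof.
  intros H. unfold seg. replace (S (S b) - a) with (S (S b - a)) by lia. rewrite map_seq_snoc.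
  do 3 f_equal. lia.
Qed.

Lemma seg_split r a b c : a <= b -> b <= S c -> seg r a c = seg r a (b - 1) ++ seg r b c \/ b = 0.
Proof.
  intros H H'. destruct b as [|b]; [right; auto|left]. unfold seg. rewrite <- map_app. f_equal.
  replace (S (S b - 1) - a) with (S b - a) by lia.
  replace (S c - a) with ((S b - a) + (S c - S b)) by lia. rewrite seq_app. do 2 f_equal. lia.
Qed.

Lemma seg_one r a : seg r a a = [r a].
Proof. unfold seg. now replace (S a - a) with 1 by lia. Qed.

Lemma seg_chain (R : Point -> Point -> Prop) r a b : (forall t, a <= t -> t < b -> R (r t) (r (S t))) -> chain R (seg r a b).
Proof.
  intros H. unfold seg. destruct (S b - a) as [|n] eqn:E; [exact I|].
  apply chain_map_seq. intros; apply H; lia.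
Qed.

Lemma NoDup_map_inj {X} (r : nat -> X) l : (forall i j, r i = r j -> i = j) -> NoDup l -> NoDup (map r l).
Proof. intros H N. apply NoDup_map_NoDup_ForallPairs; auto. intros ? ? _ _; apply H. Qed.

Lemma seg_NoDup r a b : (forall i j, r i = r j -> i = j) -> NoDup (seg r a b).
Proof. intros H. apply NoDup_map_inj; auto. apply seq_NoDup. Qed.

Lemma stp_seg r a b t : a <= t -> t < b -> stp (seg r a b) (r t) (r (S t)).
Proof.
  intros H1 H2. exists (map r (seq a (t - a))), (map r (seq (S (S t)) (b - S t))).
  unfold seg. change (r t :: r (S t) :: map r (seq (S (S t)) (b - S t))) with (map r (seq t (S (S (b - S t))))).
  rewrite <- map_app. f_equal. replace (S b - a) with ((t - a) + S (S (b - S t))) by lia.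
  rewrite seq_app. do 2 f_equal. lia.
Qed.

Lemma stp_l l1 l2 a b : stp l1 a b -> stp (l1 ++ l2) a b.
Proof. intros [u [v ->]]. exists u, (v ++ l2). now rewrite <- app_assoc. Qed.

Lemma stp_r l1 l2 a b : stp l2 a b -> stp (l1 ++ l2) a b.
Proof. intros [u [v ->]]. exists (l1 ++ u), v. now rewrite <- app_assoc. Qed.

Lemma last_in {X} (l : list X) d : In (last l d) (d :: l).
Proof.
  revert d. induction l as [|x l IH]; intros d; [simpl; auto|]. rewrite last_cons. right. apply IH.
Qed.

Lemma first_hit {X} (Q : X -> Prop) l : (exists p, In p l /\ Q p) ->
  exists P x S, l = P ++ x :: S /\ Q x /\ forall p, In p P -> ~ Q p.
Proof.
  induction l as [|y l IH]; intros [p [Hp Qp]]; [destruct Hp|].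
  destruct (classic (Q y)) as [Qy|Qy].
  - exists [], y, l. simpl. auto.
  - destruct Hp as [->|Hp]; [tauto|]. destruct IH as [P [x [S [-> [Qx H]]]]]; [exists p; auto|].
    exists (y :: P), x, S. split; auto. split; auto. intros q [<-|Hq]; auto.
Qed.

Lemma chain_snoc (R : Point -> Point -> Prop) l p q : chain R (p :: l) -> R (last l p) q -> chain R (p :: l ++ [q]).
Proof.
  revert p. induction l as [|x l IH]; intros p H1 H2; simpl.
  - simpl in *. auto.
  - destruct H1. split; auto. apply IH; auto. now rewrite last_cons in H2.
Qed.

Lemma stp_last l p : l <> [] -> forall q, stp (l ++ [q]) (last l p) q.
Proof.
  intros H q. destruct (exists_last H) as [w [z ->]]. rewrite last_last. exists w, []. 
  now rewrite <- app_assoc.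
Qed.

Section Sys.
Context {SS : Sys}.

Lemma closed_simple (r : nat -> Point) a b A : a < b -> (forall i j, a <= i <= b -> a <= j <= b -> r i = r j -> i = j) ->
  (forall t, a <= t -> t < b -> adj (r t) (r (S t))) ->
  NoDup A -> (forall p t, In p A -> a <= t <= b -> p <> r t) -> chain adj (r b :: A) -> adj (last A (r b)) (r a) ->
  3 <= S b - a + length A ->
  cl (seg r a b ++ A) = seg r a b ++ A ++ [r a] /\ Simple (seg r a b ++ A).
Proof.
  intros L RI RA N D C Al Ln.
  assert (E : cl (seg r a b ++ A) = seg r a b ++ A ++ [r a]).
  { rewrite seg_cons by lia. simpl. now rewrite <- app_assoc. }
  split; auto. split; [|split].
  - apply NoDup_app; auto.
    + unfold seg. apply NoDup_map_NoDup_ForallPairs; [|apply seq_NoDup].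
      intros i j Hi Hj. apply in_seq in Hi, Hj. apply RI; lia.
    + intros p Hp HA. apply in_seg in Hp as [t [Ht ->]]. now apply (D (r t) t).
  - unfold cadj. rewrite E. destruct b as [|b]; [lia|]. rewrite seg_snoc by lia. rewrite <- app_assoc.
    simpl app. apply chain_app. split.
    + rewrite <- (@seg_snoc r a b) by lia. apply seg_chain; auto.
    + apply chain_snoc; auto.
  - rewrite length_app. unfold seg. rewrite length_map, length_seq. lia.
Qed.

Lemma stp_close (r : nat -> Point) a b A : a < b ->
  cl (seg r a b ++ A) = seg r a b ++ A ++ [r a] ->
  (forall t, a <= t -> t < b -> stp (cl (seg r a b ++ A)) (r t) (r (S t))) /\
  stp (cl (seg r a b ++ A)) (r b) (hd (r a) A) /\ stp (cl (seg r a b ++ A)) (last A (r b)) (r a).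
Proof.
  intros L E. rewrite E. split; [|split].
  - intros t H1 H2. apply stp_l. now apply stp_seg.
  - destruct b as [|b]; [lia|]. rewrite seg_snoc by lia. rewrite <- app_assoc. apply stp_r. simpl.
    destruct A as [|x A]; simpl.
    + exists [], []. reflexivity.
    + exists [], (A ++ [r a]). reflexivity.
  - destruct b as [|b]; [lia|]. rewrite seg_snoc by lia. rewrite <- app_assoc. apply stp_r. simpl.
    change (r (S b) :: A ++ [r a]) with ((r (S b) :: A) ++ [r a]). rewrite <- (last_cons (r (S b)) A org).
    apply stp_last. discriminate.
Qed.

(* The geometric part of [larc]. *)
Definition garc (c : bool) (r : nat -> Point) (a b : nat) (A : list Point) : Prop :=
  a < b /\ NoDup A /\ (forall p s, In p A -> p <> r s) /\ chain adj (r b :: A) /\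
  betterP c (r (b - 1)) (r b) (r (b + 1)) (hd (r a) A) /\ adj (last A (r b)) (r a).

Lemma larc_garc c r a b A : larc c r a b A -> garc c r a b A.
Proof.
  intros [L [N [D [C [B Bl]]]]]. repeat split; auto.
  - now apply chain_Bd_adj.
  - now apply bondable_adj.
Qed.

Lemma garc_simple c r a b A : isray r -> garc c r a b A ->
  cl (seg r a b ++ A) = seg r a b ++ A ++ [r a] /\ Simple (seg r a b ++ A).
Proof.
  intros [R0 [R1 R2]] [L [N [D [C [B Bl]]]]]. apply closed_simple; auto.
  - intros t _ _. now apply Bd_adj.
  (* An empty arc with [b = a + 1] would go straight back along [r], and that direction is never
     better. *)
  - destruct A as [|x A]; cbn [length]; [|lia]. destruct (Nat.eq_dec b (S a)) as [->|]; [|lia].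
    exfalso. cbn [hd] in B. replace (S a - 1) with a in B by lia. clear - B. destruct c; dirs.
Qed.

(** Winding number on the left of the curve closed by an arc: a left arc closes it counterclockwise,
    a right arc clockwise. *)
Definition side (c : bool) : Z := if c then 1%Z else 0%Z.

Lemma tail_out (r : nat -> Point) l t : isray r -> cadj l -> (forall s, t <= s -> ~ In (r s) l) -> wnd l (r t) = 0%Z.
Proof.
  intros [R0 [R1 R2]] C H. pose proof (@wv_infinite l (fun s => r (t + s)) C) as W.
  cbv beta in W. rewrite Nat.add_0_r in W. apply W.
  - intros s. rewrite Nat.add_succ_r. now apply Bd_adj.
  - intros i j E. apply R2 in E. lia.
  - intros s. apply H. lia.
Qed.

Lemma garc_tail c r a b A t : isray r -> garc c r a b A -> b < t ->
  ~ In (r t) (seg r a b ++ A) /\ wnd (seg r a b ++ A) (r t) = 0%Z.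
Proof.
  intros R H Ht. pose proof R as [R0 [R1 R2]].
  assert (N : forall s, t <= s -> ~ In (r s) (seg r a b ++ A)).
  { intros s Hs I. apply in_app_or in I as [I|I].
    - apply in_seg in I as [u [Hu E]]. apply R2 in E. lia.
    - destruct H as [_ [_ [D _]]]. exact (D (r s) s I eq_refl). }
  split; [now apply N|]. apply tail_out; auto. now apply (garc_simple R H).
Qed.

Lemma ray_turn r n : isray r -> 1 <= n -> dirof (r n) (r (n - 1)) <> dirof (r n) (r (n + 1)).
Proof.
  intros [_ [R1 R2]] L E. apply dirof_inj in E.
  - apply R2 in E. lia.
  - apply adj_sym. replace n with (S (n - 1)) at 2 by lia. now apply Bd_adj.
  - rewrite Nat.add_1_r. now apply Bd_adj.
Qed.

(** The orientation is read at [r b]: the tail of [r] is outside the curve, and as the arc leaves on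
    the better side, the tail starts on the other side of the curve. *)
Lemma garc_sides c r a b A : isray r -> garc c r a b A -> forall u p v,
  stp (cl (seg r a b ++ A)) u p -> stp (cl (seg r a b ++ A)) p v ->
  u <> v /\ wnd (seg r a b ++ A) (F p (dirof p v)) = side c /\
  (forall d, Left (dirof p u) (dirof p v) d -> wnd (seg r a b ++ A) (F p d) = side c) /\
  (forall d, Right (dirof p u) (dirof p v) d -> wnd (seg r a b ++ A) (F p d) = (side c - 1)%Z).
Proof.
  intros R H. pose proof R as [R0 [R1 R2]]. destruct (garc_simple R H) as [E SC].
  pose proof H as [L [N [D [C [B Bl]]]]].
  destruct (simple_sides SC) as [k [Hk K]]. destruct (stp_close r A L E) as [S1 [S2 S3]].
  assert (k = side c); [|now subst k].
  destruct b as [|b]; [lia|]. specialize (S1 b). 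
  destruct (K _ _ _ (S1 ltac:(lia) ltac:(lia)) S2) as [_ [_ [KL KR]]].
  assert (T : wnd (seg r a (S b) ++ A) (F (r (S b)) (dirof (r (S b)) (r (S b + 1)))) = 0%Z).
  { rewrite Nat.add_1_r, face_to; [|apply SC|now apply Bd_adj|]; apply (garc_tail (t := S (S b)) R H); lia. }
  pose proof (@ray_turn r (S b) R) as Tn.
  replace (S b - 1) with b in * by lia. specialize (Tn ltac:(lia)). destruct c.
  - rewrite KR in T; [simpl; lia|]. clear - B Tn. dirs.
  - rewrite KL in T; [simpl; lia|]. clear - B Tn. dirs.
Qed.

Lemma larc_simple c r a b A : isray r -> larc c r a b A ->
  cl (seg r a b ++ A) = seg r a b ++ A ++ [r a] /\ Simple (seg r a b ++ A).
Proof. intros R H. apply garc_simple with c; auto. now apply larc_garc. Qed.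

Lemma larc_tail c r a b A t : isray r -> larc c r a b A -> b < t ->
  ~ In (r t) (seg r a b ++ A) /\ wnd (seg r a b ++ A) (r t) = 0%Z.
Proof. intros R H. apply garc_tail with c; auto. now apply larc_garc. Qed.

Lemma larc_sides c r a b A : isray r -> larc c r a b A -> forall u p v,
  stp (cl (seg r a b ++ A)) u p -> stp (cl (seg r a b ++ A)) p v ->
  u <> v /\ wnd (seg r a b ++ A) (F p (dirof p v)) = side c /\
  (forall d, Left (dirof p u) (dirof p v) d -> wnd (seg r a b ++ A) (F p d) = side c) /\
  (forall d, Right (dirof p u) (dirof p v) d -> wnd (seg r a b ++ A) (F p d) = (side c - 1)%Z).
Proof. intros R H. apply garc_sides; auto. now apply larc_garc. Qed.

(* Two meeting arcs would give a detour of [r] on its better side. *)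
Lemma no_meet c r a1 b1 A1 a2 b2 A2 : extremal c (fun _ => True) 1 r -> b1 < b2 ->
  larc c r a1 b1 A1 -> larc c r a2 b2 A2 -> forall p, In p A1 -> In p A2 -> False.
Proof.
  intros [R [_ [_ O]]] L H1 H2 p P1 P2.
  destruct (@first_hit _ (fun p => In p A2) A1) as [P [x [Q [E1 [I2 NP]]]]]; [exists p; auto|].
  destruct (in_split _ _ I2) as [P' [Q' E2]].
  destruct H1 as [L1 [N1 [D1 [C1 [B1 _]]]]]. destruct H2 as [L2 [N2 [D2 [C2 [B2 _]]]]].
  assert (ER : x :: rev P' = rev (P' ++ [x])) by (rewrite rev_app_distr; reflexivity).
  assert (E2' : A2 = (P' ++ [x]) ++ Q') by (rewrite E2, <- app_assoc; reflexivity).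
  assert (ND : NoDup (P ++ x :: rev P')).
  { rewrite ER. apply NoDup_app.
    - subst A1. now apply NoDup_app_remove_r in N1.
    - apply NoDup_rev. rewrite E2' in N2. now apply NoDup_app_remove_r in N2.
    - intros y Hy Hy'. apply (NP y Hy). rewrite E2'. apply in_or_app. left. now apply in_rev. }
  assert (IX : forall y, In y (P ++ x :: rev P') -> In y A1 \/ In y A2).
  { intros y Hy. rewrite ER in Hy. apply in_app_or in Hy as [Hy|Hy].
    - left. rewrite E1. apply in_or_app; auto.
    - right. rewrite E2'. apply in_or_app. left. now apply in_rev. }
  apply (O (via r b1 (P ++ x :: rev P') b2) b1); auto; try lia.
  - apply isray_via; auto.
    + intros y s Hy. apply IX in Hy as [Hy|Hy]; [now apply D1|now apply D2].
    + rewrite E1 in C1. rewrite E2 in C2. rewrite <- app_assoc.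
      apply (chain_app Bd (r b1 :: P) x Q) in C1 as [C1 _]. apply (chain_app Bd (r b2 :: P') x Q') in C2 as [C2 _].
      apply (chain_app Bd (r b1 :: P) x (rev P' ++ [r b2])). split; auto.
      apply (chain_rev Bd _ Bd_sym) in C2. rewrite rev_app_distr in C2. simpl in C2. exact C2.
  - intros t Ht. now apply via_le.
  - rewrite via_next. rewrite E1 in B1. destruct P; exact B1.
Qed.

(** The last vertex of an arc that closes before [j] is a neighbour of one of finitely many
    vertices. Arcs with different starts have different last vertices, because [r] is injective,
    arcs avoid [r], and two arcs do not meet. *)
Lemma arcs_bounded c r : extremal c (fun _ => True) 1 r -> forall j, exists K, forall a b A, larc c r a b A -> a < j -> b <= K.
Proof.
  intros H j. pose proof H as [[R0 [R1 R2]] _]. apply NNPP. intros N.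
  destruct (@pigeon _ (flat_map (fun a => map (step (r a)) [DE; DN; DS; DW]) (seq 0 j))
     (fun n v => exists a A, larc c r a n A /\ a < j /\ v = last A (r n))) as [v Hv].
  - intros K. apply NNPP. intros M. apply N. exists K. intros a b A La Lj.
    destruct (Nat.le_gt_cases b K); auto. exfalso. apply M. exists b, (last A (r b)). split; [lia|].
    split; [|exists a, A; auto]. apply in_flat_map. exists a. split; [apply in_seq; lia|].
    destruct La as [_ [_ [_ [_ [_ Bl]]]]]. apply bondable_adj, adj_sym in Bl as [d ->].
    destruct d; simpl; auto.
  - destruct (Hv 0) as [n1 [_ [a1 [A1 [H1 [_ E1]]]]]]. destruct (Hv (S n1)) as [n2 [L [a2 [A2 [H2 [_ E2]]]]]].
    destruct (last_in A1 (r n1)) as [I1|I1]; destruct (last_in A2 (r n2)) as [I2|I2]; rewrite <- E1 in I1; rewrite <- E2 in I2.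
    + rewrite <- I1 in I2. apply R2 in I2. lia.
    + destruct H2 as [_ [_ [D2 _]]]. now apply (D2 v n1).
    + destruct H1 as [_ [_ [D1 _]]]. now apply (D1 v n2).
    + apply (no_meet H (b1 := n1) (b2 := n2)) with (3 := H2) (p := v) (2 := H1); auto.
Qed.

(** The arc leaves on the left of [r] and arrives on its right. The part of [r] before [a], and with
    it the origin, is then inside the closed curve. *)
Definition loop (r : nat -> Point) (a b : nat) (A : list Point) : Prop :=
  larc true r a b A /\ 1 <= a /\ RightP (r (a - 1)) (r a) (r (a + 1)) (last A (r b)).

(** The second arc starts outside the curve of the first one and cannot meet it, so it arrives at
    [r a2], a vertex of this curve, from outside. Outside is on the right. *)
Lemma crossing_loop r a1 b1 A1 a2 b2 A2 : extremal true (fun _ => True) 1 r -> larc true r a1 b1 A1 -> larc true r a2 b2 A2 ->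
  a1 < a2 -> a2 < b1 -> b1 < b2 -> loop r a2 b2 A2.
Proof.
  intros H H1 H2 L1 L2 L3. split; auto. split; [lia|]. pose proof H as [R _]. pose proof R as [R0 [R1 R2]].
  set (x := last A2 (r b2)).
  destruct (larc_tail (t := b2) R H1) as [T0 T]; [lia|].
  destruct (larc_simple R H1) as [E [S1 [S2 S3]]].
  pose proof H2 as [_ [_ [D2 [C2 [_ Bl]]]]].
  assert (NC : forall y, In y (r b2 :: A2) -> ~ In y (seg r a1 b1 ++ A1)).
  { intros y [<-|Hy]; auto. intros Hc. apply in_app_or in Hc as [Hc|Hc].
    - apply in_seg in Hc as [s [_ Es]]. now apply (D2 y s).
    - apply (no_meet H L3 H1 H2 y Hc Hy). }
  assert (Wx : wnd (seg r a1 b1 ++ A1) x = 0%Z).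
  { rewrite <- T. apply (wv_chain (seg r a1 b1 ++ A1) (s := A2) S2); auto.
    - now apply chain_Bd_adj.
    - apply last_in. }
  assert (Nx : ~ In x (seg r a1 b1 ++ A1)) by (apply NC, last_in).
  apply bondable_adj, adj_sym in Bl. fold x in Bl.
  destruct (stp_close r (a := a1) (b := b1) A1) as [ST _]; [lia|auto|].
  assert (P1 : stp (cl (seg r a1 b1 ++ A1)) (r (a2 - 1)) (r a2)).
  { replace a2 with (S (a2 - 1)) at 2 by lia. apply ST; lia. }
  assert (P2 : stp (cl (seg r a1 b1 ++ A1)) (r a2) (r (a2 + 1))).
  { rewrite Nat.add_1_r. apply ST; lia. }
  destruct (larc_sides R H1 P1 P2) as [Nab [_ [KL KR]]].
  assert (Wf : wnd (seg r a1 b1 ++ A1) (F (r a2) (dirof (r a2) x)) = 0%Z) by (rewrite face_to; auto).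
  assert (Q1 : adj (r a2) (r (a2 - 1))).
  { apply adj_sym. replace a2 with (S (a2 - 1)) at 2 by lia. now apply Bd_adj. }
  assert (Q2 : adj (r a2) (r (a2 + 1))) by (rewrite Nat.add_1_r; now apply Bd_adj).
  apply stp_in in P1 as I1. apply stp_in in P2 as I2. rewrite !cl_in in I1, I2.
  destruct (@left_or_right (dirof (r a2) (r (a2 - 1))) (dirof (r a2) (r (a2 + 1))) (dirof (r a2) x)) as [HL|HR]; auto.
  - intros Ed. apply Nab. now apply (dirof_inj Q1 Q2).
  - intros Ed. apply (dirof_inj Bl Q1) in Ed. rewrite Ed in Nx. tauto.
  - intros Ed. apply (dirof_inj Bl Q2) in Ed. rewrite Ed in Nx. tauto.
  - apply KL in HL. rewrite HL in Wf. discriminate.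
Qed.

(* Among the arcs over a far vertex, the one with the largest end is not crossed: its end is exposed. *)
Theorem loops_bounded_periodic r B : extremal true (fun _ => True) 1 r ->
  (forall a b A, loop r a b A -> b <= B) -> rayper r.
Proof.
  intros H HB. apply exposed_periodic with true 1; auto. intros N.
  set (j := S (Nat.max N B)).
  destruct (classic (exposed true r j)) as [X|X]; [exists j; split; auto; lia|].
  destruct (arcs_bounded H j) as [K HK].
  destruct (@nat_min (fun m => exists a b A, larc true r a b A /\ a < j /\ j < b /\ b + m = K)) as [m [[a [b [A [Ha [L1 [L2 Em]]]]]] Hm]].
  { apply not_all_ex_not in X as [a X]. apply not_all_ex_not in X as [b X]. apply not_all_ex_not in X as [A X].
    apply imply_to_and in X as [Ha X]. apply NNPP in X as [L1 L2]. pose proof (HK _ _ _ Ha L1).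
    exists (K - b), a, b, A. split; auto. split; auto. split; auto. lia. }
  exists b. split; [lia|]. intros a2 b2 A2 H2 [L3 L4].
  destruct (Nat.lt_ge_cases a2 j) as [La|La].
  - pose proof (HK _ _ _ H2 La). assert (m <= K - b2); [|lia]. apply Hm. exists a2, b2, A2.
    split; auto. split; auto. split; lia.
  - assert (Lp : loop r a2 b2 A2) by (apply (crossing_loop H Ha H2); lia).
    apply HB in Lp. lia.
Qed.

End Sys.

Lemma last_app_cons {X} (l : list X) p A d : last (l ++ p :: A) d = last A p.
Proof.
  revert d. induction l as [|y l IH]; intros d; simpl app; rewrite last_cons; auto.
Qed.

Lemma eventually_out {X} (r : nat -> X) (L : list X) : (forall i j, r i = r j -> i = j) ->
  exists N, forall n, N <= n -> ~ In (r n) L.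
Proof.
  intros H. induction L as [|x L [N HN]]; [exists 0; auto|].
  destruct (classic (exists m, r m = x)) as [[m Hm]|Hm].
  - exists (Nat.max N (S m)). intros n Hn [E|I].
    + rewrite <- Hm in E. apply H in E. lia.
    + apply (HN n); auto. lia.
  - exists N. intros n Hn [E|I]; [|now apply (HN n)]. apply Hm. exists n; auto.
Qed.

Lemma sumw_app1 g h l1 p l2 :
  sumw g (h :: l1 ++ p :: l2) = (sumw g (h :: l1 ++ [p]) + sumw g (p :: l2))%Z.
Proof. exact (sumw_app g (h :: l1) p l2). Qed.

(** * Unbounded loops *)

Section Avoid.
Context {SS : Sys}.
Variable h : Point.

(* Reachable from the origin while avoiding [h]; the other points are dominated by [h]. *)
Definition RA (p : Point) : Prop := exists z n, fpath z n /\ z n = p /\ forall i, i <= n -> z i <> h.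

Lemma RA_neq p : RA p -> p <> h.
Proof. intros [z [n [_ [<- H]]]]. auto. Qed.

Lemma RA_step p q : RA p -> Bd p q -> q <> h -> RA q.
Proof.
  intros [z [n [F [E H]]]] B Nq. destruct (classic (exists i, i <= n /\ z i = q)) as [[i [Li Ei]]|N].
  - exists z, i. split; [now apply fpath_le with n|]. split; auto. intros; apply H; lia.
  - exists (cut z n (fun _ => q)), (S n). split; [|split].
    + apply pathOf_snoc; auto; [now rewrite E|]. intros i Li Ei. apply N. exists i; auto.
    + now rewrite cut_gt by lia.
    + intros i Li. destruct (Nat.le_gt_cases i n); [rewrite cut_le by lia; auto|now rewrite cut_gt by lia].
Qed.

Lemma RA_chain p L : chain Bd (p :: L) -> RA p -> ~ In h L -> forall q, In q L -> RA q.
Proof.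
  revert p. induction L as [|y L IH]; intros p C P N q []; destruct C as [C1 C2].
  - subst. apply RA_step with p; auto. intros ->. apply N. simpl; auto.
  - apply (IH y); auto.
    + apply RA_step with p; auto. intros ->. apply N. simpl; auto.
    + intros I. apply N. simpl; auto.
Qed.

Lemma D_chain p L : chain Bd (p :: L) -> ~ RA p -> p <> h -> ~ In h L -> forall q, In q L -> ~ RA q.
Proof.
  revert p. induction L as [|y L IH]; intros p C P Np N q []; destruct C as [C1 C2].
  - subst. intros Q. apply P. apply RA_step with q; auto. now apply Bd_sym.
  - apply (IH y); auto.
    + intros Q. apply P. apply RA_step with y; auto. now apply Bd_sym.
    + intros ->. apply N. simpl; auto.
    + intros I. apply N. simpl; auto.
Qed.

Lemma RA_seq (r : nat -> Point) n : (forall i, Bd (r i) (r (S i))) -> (forall i, n <= i -> r i <> h) ->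
  RA (r n) -> forall t, n <= t -> RA (r t).
Proof.
  intros B N P t L. replace t with (n + (t - n)) by lia. induction (t - n) as [|k IH]; [now rewrite Nat.add_0_r|].
  rewrite Nat.add_succ_r. apply RA_step with (r (n + k)); auto. apply N. lia.
Qed.

End Avoid.

Section Loop.
Context {SS : Sys}.
Variables (r : nat -> Point) (k0 a b : nat) (A : list Point).
Hypothesis Hr : isray r.
Hypothesis NBC : forall c, c <> [] -> chain Bd (cl c) -> (forall p i, In p c -> i <= k0 -> p <> r i) -> wnd c org = 0%Z.
Hypothesis HL : loop r a b A.
Hypothesis Hk : k0 < a.

(** [C] is the whole loop, listed from the vertex [h] where it closes, and [x] is the vertex just
    before the closing edge. [FF], the loop without [h], is the part that turns out to be dominated
    by [h]. *)
Let h := r a.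
Let x := last A (r b).
Let FF := seg r (S a) b ++ A.
Let C := h :: FF.

Local Definition L_ab : a < b := proj1 (proj1 HL).

Lemma C_eq : seg r a b ++ A = C.
Proof. pose proof L_ab. unfold C, FF. rewrite seg_cons by lia. reflexivity. Qed.

Lemma FF_eq : FF = seg r (S a) (b - 1) ++ r b :: A.
Proof.
  pose proof L_ab. unfold FF. destruct b as [|b']; [lia|]. rewrite seg_snoc by lia.
  rewrite <- app_assoc. replace (S b' - 1) with b' by lia. reflexivity.
Qed.

Lemma FF_last d : last FF d = x.
Proof. rewrite FF_eq. apply last_app_cons. Qed.

Lemma FF_snoc : exists F2, FF = F2 ++ [x].
Proof.
  destruct (@exists_last _ FF) as [F2 [y E]]; [rewrite FF_eq; intros E; now apply app_eq_nil in E as [_ E]|].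
  exists F2. rewrite E. do 2 f_equal. rewrite <- (FF_last h), E. now rewrite last_last.
Qed.

Lemma x_in : In x FF.
Proof. destruct FF_snoc as [F2 ->]. apply in_or_app; simpl; auto. Qed.

Lemma C_chain : chain Bd C.
Proof.
  pose proof L_ab. pose proof Hr as [R0 [R1 R2]]. unfold C. rewrite FF_eq.
  apply (chain_app Bd (h :: seg r (S a) (b - 1))). split.
  - unfold h. rewrite <- seg_cons by lia. replace b with (S (b - 1)) at 2 by lia. rewrite <- seg_snoc by lia.
    apply seg_chain. auto.
  - apply HL.
Qed.

Lemma C_simple : Simple C.
Proof. rewrite <- C_eq. apply (larc_simple Hr (proj1 HL)). Qed.

Lemma C_in p : In p C -> (exists t, a <= t <= b /\ p = r t) \/ In p A.
Proof. rewrite <- C_eq. intros H. apply in_app_or in H as [H|H]; auto. left. now apply in_seg. Qed.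

Lemma C_off i : i < a -> ~ In (r i) C.
Proof.
  intros L I. pose proof Hr as [R0 [R1 R2]]. apply C_in in I as [[t [Ht E]]|I].
  - apply R2 in E. lia.
  - destruct HL as [[_ [_ [D _]]] _]. exact (D _ i I eq_refl).
Qed.

Lemma h_notin : ~ In h FF.
Proof. destruct C_simple as [N _]. inversion N; auto. Qed.

Lemma x_adj : adj x h.
Proof. apply bondable_adj. apply HL. Qed.

Lemma C_prev : stp (cl C) x h.
Proof.
  destruct (larc_simple Hr (proj1 HL)) as [E _]. rewrite <- C_eq.
  apply (stp_close r A L_ab E).
Qed.

Lemma C_next : stp (cl C) h (r (a + 1)).
Proof.
  destruct (larc_simple Hr (proj1 HL)) as [E _]. rewrite <- C_eq. rewrite Nat.add_1_r.
  apply (stp_close r A L_ab E); auto. apply L_ab.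
Qed.

(** Since the closing edge arrives on the right of [r], the vertex [r (a - 1)] is on the left of [C]
    at [h], hence inside; and [r] does not meet [C] between the origin and this vertex. *)
Lemma C_org : wnd C org = 1%Z.
Proof.
  pose proof Hr as [R0 [R1 R2]]. pose proof HL as [Hla [La HR]].
  destruct C_simple as [N [Ca _]].
  assert (W : wnd C (r (a - 1)) = 1%Z).
  { rewrite <- (face_to (p := h) (x := r (a - 1)) C Ca).
    - rewrite <- C_eq. apply (larc_sides Hr Hla (u := x) (v := r (a + 1))).
      + rewrite C_eq. apply C_prev.
      + rewrite C_eq. apply C_next.
      + fold x h in HR. pose proof (ray_turn Hr La) as T. fold h in T. clear - HR T.
        unfold RightP in HR. dirs.
    - apply adj_sym. unfold h. replace a with (S (a - 1)) at 2 by lia. now apply Bd_adj.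
    - apply C_off. lia. }
  rewrite <- R0. rewrite <- (wv_seq C (fun t => r t) (n := a - 1)); auto.
  - intros t Ht. now apply Bd_adj.
  - intros t Ht. apply C_off. lia.
Qed.

(** All other edges of [C] are bonds, so [C] would be a bonded closed walk around the origin that
    avoids the vertices of [r] up to [k0]. *)
Lemma x_nonbond : ~ Bd x h.
Proof.
  intros B. assert (W : wnd C org = 0%Z); [|rewrite C_org in W; discriminate].
  apply NBC; [discriminate| |].
  - change (cl C) with (h :: FF ++ [h]). apply chain_snoc; [apply C_chain|]. now rewrite FF_last.
  - intros p i Hp Hi E. subst p. revert Hp. apply C_off. lia.
Qed.

(** The bonds of [C] lead from each of its vertices to [x] without passing [h]. A path that reaches
    [x] without [h] would be extendable by the closing edge, and this edge would be a bond. *)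
Lemma FF_dominated p : In p FF -> ~ RA h p.
Proof.
  intros Hp P. apply in_split in Hp as [l1 [l2 E]].
  assert (X : RA h x).
  { pose proof (FF_last p) as Lx. rewrite E, last_app_cons in Lx.
    destruct l2 as [|q l2]; [simpl in Lx; now rewrite <- Lx|].
    apply RA_chain with (p := p) (L := q :: l2); auto.
    - pose proof C_chain as Cc. unfold C in Cc. rewrite E in Cc. now apply (chain_app Bd (h :: l1)) in Cc.
    - intros I. apply h_notin. rewrite E. apply in_or_app. right. right. exact I.
    - rewrite <- Lx, last_cons. apply last_in. }
  destruct X as [z [n [F [Ez Nz]]]]. apply x_nonbond. rewrite <- Ez. apply grow_step; auto.
  rewrite Ez. apply HL.
Qed.

Lemma RA_w p : RA h p -> ~ In p C /\ wnd C p = 1%Z.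
Proof.
  intros P. assert (N : forall q, RA h q -> ~ In q C).
  { intros q Q [E|I]; [apply RA_neq in Q; congruence|]. now apply FF_dominated in I. }
  split; [auto|]. destruct P as [z [n [F [<- Nz]]]]. rewrite <- C_org. pose proof F as [F0 [F1 F2]].
  rewrite <- F0. apply wv_seq; [apply C_simple| |].
  - intros t Ht. apply Bd_adj. auto.
  - intros t Ht. apply N. exists z, t. split; [now apply fpath_le with n|]. split; auto. intros; apply Nz; lia.
Qed.

(** What is reachable without [h] misses [C] and has winding number 1 like the origin, so it is
    enclosed by [C]; an infinite simple path cannot stay there. *)
Lemma RA_no_tail (R : nat -> Point) n : isray R -> (forall i, n <= i -> R i <> h) -> ~ RA h (R n).
Proof.
  intros HR N P. pose proof HR as [R0 [R1 R2]].
  pose proof (RA_seq R R1 N P) as Q. destruct (RA_w P) as [_ W].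
  rewrite (@tail_out _ R C n HR) in W; [discriminate|apply C_simple|]. intros s Hs. apply RA_w. auto.
Qed.

Lemma RA_prefix (R : nat -> Point) n : isray R -> (forall i, i <= n -> R i <> h) -> RA h (R n).
Proof. intros HR N. exists R, n. split; [now apply isray_fpath|]. auto. Qed.

Lemma R_hits (R : nat -> Point) : isray R -> exists c, 1 <= c /\ R c = h.
Proof.
  intros HR. apply NNPP. intros N. pose proof HR as [R0 [R1 R2]]. pose proof Hr as [S0 [S1 S2]].
  assert (N0 : R 0 <> h).
  { rewrite R0, <- S0. intros E. apply S2 in E. lia. }
  assert (M : forall i, R i <> h).
  { intros [|i] E; [auto|]. apply N. exists (S i). split; auto. lia. }
  apply (@RA_no_tail R 0 HR); auto. apply RA_prefix; auto.
Qed.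

Lemma r_dom t : a < t -> ~ RA h (r t).
Proof. intros L. apply RA_no_tail; auto. intros i Hi E. apply Hr in E. lia. Qed.

Lemma r_RA t : t < a -> RA h (r t).
Proof. intros L. apply RA_prefix; auto. intros i Hi E. apply Hr in E. lia. Qed.

(** The vertices of [r] before [a] are reached without [h]. Hence a walk through [h] and dominated
    vertices avoids [r] up to [k0 < a], as [NBC] demands. *)
Lemma NBC_dom c : c <> [] -> chain Bd (cl c) -> (forall p, In p c -> p = h \/ ~ RA h p) -> wnd c org = 0%Z.
Proof.
  intros N Cc H. apply NBC; auto. intros p i Hp Hi E. apply H in Hp as [->|Hp].
  - apply Hr in E. lia.
  - apply Hp. rewrite E. apply r_RA. lia.
Qed.

Section Right.
Variables (R : nat -> Point) (c : nat).
Hypothesis HR : isray R.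
Hypothesis Hc : R c = h.
Hypothesis Lc : 1 <= c.

Lemma R_RA t : t < c -> RA h (R t).
Proof. intros L. apply RA_prefix; auto. intros i Hi E. rewrite <- Hc in E. apply HR in E. lia. Qed.

Lemma R_dom t : c < t -> ~ RA h (R t).
Proof. intros L. apply RA_no_tail; auto. intros i Hi E. rewrite <- Hc in E. apply HR in E. lia. Qed.

Lemma Rm_adj : adj h (R (c - 1)).
Proof. apply adj_sym. rewrite <- Hc. replace c with (S (c - 1)) at 2 by lia. apply Bd_adj, HR. Qed.

Lemma Rp_Bd : Bd h (R (c + 1)).
Proof. rewrite <- Hc, Nat.add_1_r. apply HR. Qed.

Lemma x_dom : ~ RA h x.
Proof. apply FF_dominated, x_in. Qed.

Lemma x_Rm : x <> R (c - 1).
Proof. intros E. apply x_dom. rewrite E. apply R_RA. lia. Qed.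

Lemma x_Rp : x <> R (c + 1).
Proof. intros E. apply x_nonbond. rewrite E. apply Bd_sym, Rp_Bd. Qed.

(* [R] does not meet such a walk before [h]. *)
Lemma w_Rm l : cadj l -> (forall p, In p l -> p = h \/ ~ RA h p) ->
  ~ In (R (c - 1)) l /\ wnd l (F h (dirof h (R (c - 1)))) = wnd l org.
Proof.
  intros Ca H. assert (N : forall t, t < c -> ~ In (R t) l).
  { intros t Ht I. pose proof (R_RA Ht) as P. apply H in I as [E|I]; [|auto]. apply RA_neq in P. congruence. }
  split; [apply N; lia|].
  rewrite face_to; auto; [|apply Rm_adj|apply N; lia].
  pose proof HR as [R0 [R1 R2]]. rewrite <- R0. apply (wv_seq l (fun t => R t)); auto.
  - intros t Ht. now apply Bd_adj.
  - intros t Ht. apply N. lia.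
Qed.

Lemma Rm_turn : dirof h (R (c - 1)) <> dirof h (R (c + 1)).
Proof. rewrite <- Hc. now apply ray_turn. Qed.

(* Otherwise [R] comes back to the loop [C] at [z]; exchanging the part [F1] of [C] before [z] for the
   part of [R] between [h] and [z] changes the winding number around the origin by that of a bonded
   walk, that is, by 0, and [R (c - 1)] lies on the wrong side of the new curve. *)
Lemma x_side : RightP (R (c - 1)) h (R (c + 1)) x.
Proof.
  pose proof x_adj as Xa. apply adj_sym in Xa. pose proof Rp_Bd as Rb.
  destruct (@left_or_right (dirof h (R (c - 1))) (dirof h (R (c + 1))) (dirof h x)) as [XL|XR]; auto.
  { apply Rm_turn. }
  { intros E. apply (dirof_inj Xa Rm_adj) in E. now apply x_Rm. }
  { intros E. apply (dirof_inj Xa (Bd_adj Rb)) in E. now apply x_Rp. }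
  exfalso.
  destruct C_simple as [ND [Ca Len]].
  assert (SC : forall d, Left (dirof h x) (dirof h (r (a + 1))) d -> wnd C (F h d) = 1%Z).
  { rewrite <- C_eq. apply (larc_sides Hr (proj1 HL)); rewrite C_eq; [apply C_prev|apply C_next]. }
  assert (SCR : forall d, Right (dirof h x) (dirof h (r (a + 1))) d -> wnd C (F h d) = 0%Z).
  { rewrite <- C_eq. apply (larc_sides Hr (proj1 HL)); rewrite C_eq; [apply C_prev|apply C_next]. }
  assert (CD : forall p, In p C -> p = h \/ ~ RA h p).
  { intros p [<-|I]; auto. right. now apply FF_dominated. }
  destruct (w_Rm C Ca CD) as [Nm Wm]. rewrite C_org in Wm.
  assert (Ar : adj h (r (a + 1))) by (rewrite Nat.add_1_r; apply Bd_adj, Hr).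
  assert (RL : Left (dirof h x) (dirof h (r (a + 1))) (dirof h (R (c - 1)))).
  { destruct (@left_or_right (dirof h x) (dirof h (r (a + 1))) (dirof h (R (c - 1)))) as [Q|Q]; auto.
    - intros E. apply (dirof_inj Xa Ar) in E. apply x_nonbond. rewrite E, Nat.add_1_r. apply Bd_sym, Hr.
    - intros E. apply (dirof_inj Rm_adj Xa) in E. now apply x_Rm.
    - intros E. apply (dirof_inj Rm_adj Ar) in E. apply (@r_dom (a + 1)); [lia|]. rewrite <- E. apply R_RA. lia.
    - apply SCR in Q. lia. }
  assert (PL : wnd C (F h (dirof h (R (c + 1)))) = 1%Z).
  { apply SC. clear - XL RL. dirs. }
  destruct (@nat_min (fun s => c < s /\ In (R s) C)) as [s [[Ls Is] Ms]].
  { apply NNPP. intros N.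
    assert (T : forall s, c + 1 <= s -> ~ In (R s) C) by (intros s Hs I; apply N; exists s; split; auto; lia).
    rewrite face_to in PL; auto; [|now apply Bd_adj]. rewrite (@tail_out _ R C (c + 1) HR Ca T) in PL. discriminate. }
  assert (Hs : forall t, c < t -> t < s -> ~ In (R t) C).
  { intros t H1 H2 I. assert (s <= t); [|lia]. apply Ms. auto. }
  destruct Is as [E|Is]; [rewrite <- Hc in E; apply HR in E; lia|].
  apply in_split in Is as [F1 [F2 EF]]. set (z := R s) in *.
  set (G := seg R (S c) (s - 1)).
  assert (HG : forall p, In p G -> ~ In p C /\ exists t, c < t < s /\ p = R t).
  { intros p Hp. apply in_seg in Hp as [t [Ht ->]]. split; [apply Hs; lia|]. exists t. split; auto; lia. }
  assert (Gc : chain Bd (h :: G ++ [z])).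
  { unfold G, z. replace s with (S (s - 1)) at 2 by lia. rewrite <- seg_snoc by lia.
    rewrite <- Hc. rewrite <- seg_cons by lia. apply seg_chain. intros; apply HR. }
  pose proof C_chain as Cc. unfold C in Cc. rewrite EF in Cc.
  assert (Cc1 : chain Bd (h :: F1 ++ [z])) by now apply (chain_app Bd (h :: F1)) in Cc.
  assert (Cc2 : chain Bd (z :: F2)) by now apply (chain_app Bd (h :: F1)) in Cc.
  set (T2 := h :: G ++ z :: F2). set (T1 := h :: G ++ z :: rev F1).
  assert (T1w : wnd T1 org = 0%Z).
  { apply NBC_dom; [discriminate| |].
    - change (cl T1) with ((h :: G ++ z :: rev F1) ++ [h]). simpl. rewrite <- app_assoc. simpl.
      apply (chain_app Bd (h :: G)). split; [exact Gc|].
      apply (chain_rev Bd _ Bd_sym) in Cc1. simpl in Cc1. rewrite rev_app_distr in Cc1. exact Cc1.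
    - intros p [<-|Hp]; auto. right. apply in_app_or in Hp as [Hp|[<-|Hp]].
      + apply HG in Hp as [_ [t [Ht ->]]]. apply R_dom. lia.
      + apply R_dom. lia.
      + apply FF_dominated. rewrite EF. apply in_or_app. left. now apply in_rev. }
  assert (W : forall f, wnd C f = (wnd T2 f - wnd T1 f)%Z).
  { intros f. unfold wnd, T2, T1, C. rewrite EF. simpl cl. rewrite <- !app_assoc. simpl app.
    rewrite (sumw_app1 (dl f) h F1 z (F2 ++ [h])), (sumw_app1 (dl f) h G z (F2 ++ [h])), (sumw_app1 (dl f) h G z (rev F1 ++ [h])).
    assert (Q : sumw (dl f) (z :: rev F1 ++ [h]) = (- sumw (dl f) (h :: F1 ++ [z]))%Z).
    { rewrite <- sumw_rev by (intros; apply dl_anti). simpl. now rewrite rev_app_distr. }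
    rewrite Q. lia. }
  assert (T2s : Simple T2).
  { split; [|split].
    - unfold C in ND. rewrite EF in ND. inversion ND as [|? ? N1 N2]; subst.
      constructor.
      + intros I. apply in_app_or in I as [I|I].
        * apply HG in I as [I _]. apply I. left; auto.
        * apply N1. apply in_or_app; auto.
      + apply NoDup_app.
        * apply seg_NoDup. apply HR.
        * now apply NoDup_app_remove_l in N2.
        * intros p Hp I. apply HG in Hp as [Hp _]. apply Hp. right. rewrite EF. apply in_or_app; auto.
    - unfold cadj. change (cl T2) with ((h :: G ++ z :: F2) ++ [h]). simpl. rewrite <- app_assoc. simpl.
      apply (chain_app adj (h :: G)). split.
      + now apply chain_Bd_adj.
      + apply chain_snoc; [now apply chain_Bd_adj|].
        pose proof (FF_last z) as Lx. rewrite EF, last_app_cons in Lx. rewrite Lx. apply x_adj.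
    - unfold T2. cbn [length]. rewrite length_app. cbn [length]. destruct G as [|g G'] eqn:EG; [|cbn [length]; lia].
      destruct F2 as [|f2 F2']; [|cbn [length]; lia]. exfalso.
      pose proof (FF_last z) as Lx. rewrite EF, last_app_cons in Lx. simpl in Lx.
      apply x_nonbond. rewrite <- Lx. apply Bd_sym. simpl in Gc. tauto. }
  destruct (w_Rm T2) as [Nm2 Wm2]; [apply T2s| |].
  { intros p [<-|Hp]; auto. right. apply in_app_or in Hp as [Hp|Hp].
    + apply HG in Hp as [_ [t [Ht ->]]]. apply R_dom. lia.
    + apply FF_dominated. rewrite EF. apply in_or_app; auto. }
  pose proof (W org) as W0. rewrite C_org, T1w in W0.
  destruct (simple_sides T2s) as [k [Kk K]].
  assert (P1 : stp (cl T2) x h).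
  { change (cl T2) with ((h :: G ++ z :: F2) ++ [h]). rewrite <- (FF_last h), EF, last_app_cons.
    rewrite <- (last_app_cons (h :: G) z F2 h). apply stp_last. discriminate. }
  assert (P2 : stp (cl T2) h (R (c + 1))).
  { change (cl T2) with ((h :: G ++ z :: F2) ++ [h]). apply stp_l. unfold G, z.
    destruct (Nat.eq_dec s (c + 1)) as [->|].
    - exists [], F2. replace (c + 1 - 1) with c by lia. unfold seg. replace (S c - S c) with 0 by lia. reflexivity.
    - rewrite seg_cons by lia. rewrite Nat.add_1_r. eexists [], _. reflexivity. }
  destruct (K _ _ _ P1 P2) as [_ [_ [_ KR]]].
  (* The origin has winding number 1 with respect to [T2], and so has [R (c - 1)]. But [R (c - 1)]
     lies on the right of [T2], where the value is [k - 1], at most 0. *)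
  rewrite KR in Wm2; [lia|]. pose proof Rm_turn as Tn. clear - XL Tn. dirs.
Qed.

(* The curve [K1] of an arc over [h] is cut by a path from [x] into [K2] and [K3]. As [K2] differs from
   [C] by a bonded walk, it winds once around the origin, which forces a winding number [-1] on the
   left of [K3]. *)
Lemma R_exposed : exposed false R c.
Proof.
  intros a1 b1 A1 HA [L1 L2].
  pose proof x_side as XR. pose proof x_adj as Xa. apply adj_sym in Xa. pose proof Rp_Bd as Rb.
  pose proof HR as [R0 [R1 R2]].
  destruct (larc_simple HR HA) as [E1 S1].
  pose proof HA as [La1 [N1 [D1 [C1 [B1 Bl1]]]]].
  set (P0 := seg R a1 (c - 1)). set (G := seg R (S c) b1 ++ A1).
  assert (EC : seg R a1 b1 ++ A1 = P0 ++ h :: G).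
  { unfold P0, G. destruct (@seg_split R a1 c b1) as [->|]; [lia|lia| |lia].
    rewrite <- app_assoc. rewrite <- Hc. rewrite (@seg_cons R c b1) by lia. reflexivity. }
  assert (Gd : forall p, In p G -> ~ RA h p /\ p <> h).
  { assert (NA : ~ In h A1) by (rewrite <- Hc; intros I; exact (D1 _ c I eq_refl)).
    intros p Hp. apply in_app_or in Hp as [Hp|Hp].
    - apply in_seg in Hp as [t [Ht ->]]. split; [apply R_dom; lia|]. rewrite <- Hc. intros E. apply R2 in E. lia.
    - split; [|intros ->; auto]. apply D_chain with (p := R b1) (L := A1); auto.
      + apply R_dom. lia.
      + rewrite <- Hc. intros E. apply R2 in E. lia. }
  (* the infinite dominated path that starts at [x], runs back along [A] and then follows [r] *)
  set (Pi := fun t => if t <? length A then nth t (rev A) org else r (b + (t - length A))).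
  assert (Pi0 : Pi 0 = x).
  { unfold Pi, x. destruct A as [|y A'] eqn:EA; [simpl; now rewrite Nat.add_0_r|].
    destruct (@exists_last _ (y :: A')) as [u [q Eq]]; [discriminate|]. rewrite Eq, last_last, rev_app_distr, length_app.
    simpl. destruct (Nat.ltb_spec 0 (length u + 1)); [auto|lia]. }
  assert (PiA : forall t, t < length A -> In (Pi t) A /\ Pi t = nth t (rev A) org).
  { intros t Ht. unfold Pi. destruct (Nat.ltb_spec t (length A)); [|lia]. split; auto.
    apply in_rev. apply nth_In. now rewrite length_rev. }
  assert (Pir : forall t, length A <= t -> Pi t = r (b + (t - length A))).
  { intros t Ht. unfold Pi. destruct (Nat.ltb_spec t (length A)); [lia|auto]. }
  pose proof Hr as [S0 [S1' S2]]. pose proof (proj1 HL) as [_ [NA [DA [CA [_ _]]]]].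
  assert (PiB : forall t, Bd (Pi t) (Pi (S t))).
  { intros t. destruct (Nat.lt_ge_cases t (length A)) as [Lt|Lt].
    - assert (Q : forall j, j <= length A -> Pi j = nth j (rev (r b :: A)) org).
      { intros j Hj. simpl. destruct (Nat.eq_dec j (length A)) as [->|].
        - rewrite Pir by lia. rewrite app_nth2 by (rewrite length_rev; lia). rewrite length_rev, Nat.sub_diag.
          simpl. f_equal. lia.
        - rewrite app_nth1 by (rewrite length_rev; lia). apply PiA. lia. }
      rewrite !Q by lia. apply (chain_rev Bd _ Bd_sym) in CA.
      assert (Ln : S t < length (rev (r b :: A))) by (rewrite length_rev; simpl; lia).
      revert CA Ln. generalize (rev (r b :: A)). clear.
      induction t as [|t IH]; intros [|p [|q l]]; simpl; try lia; intros Cc Ln; [tauto|].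
      apply (IH (q :: l)); simpl; [tauto|lia].
    - rewrite !Pir by lia. replace (S t - length A) with (S (t - length A)) by lia. rewrite Nat.add_succ_r. auto. }
  assert (Pii : forall i j, Pi i = Pi j -> i = j).
  { intros i j E. destruct (Nat.lt_ge_cases i (length A)), (Nat.lt_ge_cases j (length A)).
    - rewrite (proj2 (PiA i ltac:(auto))), (proj2 (PiA j ltac:(auto))) in E.
      apply (proj1 (NoDup_nth (rev A) org)) in E; auto; [now apply NoDup_rev|rewrite length_rev; lia..].
    - rewrite (Pir j) in E by auto. exfalso. destruct (PiA i) as [I _]; auto. exact (DA _ _ I E).
    - rewrite (Pir i) in E by auto. exfalso. destruct (PiA j) as [I _]; auto. exact (DA _ _ I (eq_sym E)).
    - rewrite !Pir in E by auto. apply S2 in E. lia. }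
  assert (Pid : forall t, ~ RA h (Pi t) /\ Pi t <> h).
  { intros t. pose proof L_ab. destruct (Nat.lt_ge_cases t (length A)) as [Lt|Lt].
    - destruct (PiA t Lt) as [I _]. assert (I2 : In (Pi t) FF) by (unfold FF; apply in_or_app; auto). split.
      + now apply FF_dominated.
      + intros E. rewrite E in I2. now apply h_notin.
    - rewrite Pir by auto. split; [apply r_dom; lia|]. intros E. apply S2 in E. lia. }
  destruct (stp_close R (a := a1) (b := b1) A1) as [ST _]; [lia|auto|].
  set (K1 := seg R a1 b1 ++ A1) in *.
  assert (Q1 : stp (cl K1) (R (c - 1)) h).
  { rewrite <- Hc. replace c with (S (c - 1)) at 2 by lia. apply ST; lia. }
  assert (Q2 : stp (cl K1) h (R (c + 1))).
  { rewrite <- Hc, Nat.add_1_r. apply ST; lia. }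
  destruct (larc_sides HR HA Q1 Q2) as [_ [K1f [_ K1R]]]. fold K1 in K1f, K1R.
  (* By [x_side], [x] is on the right of [R] at [h], where the curve of a right arc has winding
     number -1. The infinite path [Pi] from [x] therefore has to meet [K1]. *)
  destruct (@nat_min (fun s => In (Pi s) K1)) as [s [Is Ms]].
  { apply NNPP. intros N. assert (T : forall t, ~ In (Pi t) K1) by (intros t I; apply N; exists t; auto).
    pose proof (K1R _ XR) as W. rewrite <- Pi0 in W. rewrite face_to in W; auto.
    - rewrite wv_infinite in W; auto; [discriminate|apply S1|]. intros t. apply Bd_adj. auto.
    - apply S1.
    - now rewrite Pi0. }
  assert (Hs : forall t, t < s -> ~ In (Pi t) K1).
  { intros t Ht I. apply Ms in I. lia. }
  set (y := Pi s) in *.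
  assert (Iy : In y G).
  { rewrite EC in Is. apply in_app_or in Is as [I|[E|I]]; auto.
    - exfalso. apply in_seg in I as [t [Ht E]]. apply (proj1 (Pid s)). fold y. rewrite E. apply R_RA. lia.
    - exfalso. apply (proj2 (Pid s)). fold y. auto. }
  apply in_split in Iy as [G1 [G2 EG]].
  set (Ps := map Pi (seq 0 s)).
  assert (HPs : forall p, In p Ps -> exists t, t < s /\ p = Pi t).
  { intros p Hp. apply in_map_iff in Hp as [t [<- Ht]]. apply in_seq in Ht. exists t. split; auto; lia. }
  assert (NPs : NoDup Ps) by (apply NoDup_map_inj; auto; apply seq_NoDup).
  assert (CPs : chain Bd (Ps ++ [y])).
  { unfold Ps, y. change s with (0 + s) at 2. rewrite <- map_seq_snoc. apply chain_map_seq. auto. }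
  assert (CK1 : chain adj (P0 ++ h :: G1 ++ y :: G2 ++ [hd h P0])).
  { destruct S1 as [_ [Ca _]]. red in Ca. rewrite E1 in Ca. unfold K1 in EC.
    rewrite app_assoc, EC, EG in Ca. rewrite <- app_assoc in Ca. simpl in Ca. rewrite <- app_assoc in Ca. simpl in Ca.
    replace (hd h P0) with (R a1); auto. unfold P0. rewrite seg_cons by lia. reflexivity. }
  assert (CG : chain Bd (h :: G)).
  { unfold G. destruct b1 as [|b']; [lia|]. rewrite seg_snoc by lia. rewrite <- app_assoc. simpl.
    apply (chain_app Bd (h :: seg R (S c) b')). split; [|exact C1]. 
    rewrite <- Hc. rewrite <- seg_cons by lia. rewrite <- seg_snoc by lia. apply seg_chain. auto. }
  rewrite EG in CG. assert (CG1 : chain Bd (h :: G1 ++ [y])) by now apply (chain_app Bd (h :: G1)) in CG.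
  assert (hdPs : hd y Ps = x).
  { rewrite <- Pi0. unfold Ps, y. destruct s; reflexivity. }
  set (K2 := h :: G1 ++ y :: rev Ps). set (K3 := P0 ++ h :: Ps ++ y :: G2).
  assert (W123 : forall f, wnd K1 f = (wnd K2 f + wnd K3 f)%Z).
  { intros f. unfold K3. rewrite EC, EG. 
    rewrite (wnd_rot P0 (h :: G1 ++ y :: G2)), (wnd_rot P0 (h :: Ps ++ y :: G2)).
    unfold wnd, K2. simpl cl. rewrite <- !app_assoc. simpl app.
    rewrite (sumw_app1 (dl f) h G1 y (G2 ++ P0 ++ [h])), (sumw_app1 (dl f) h G1 y (rev Ps ++ [h])), (sumw_app1 (dl f) h Ps y (G2 ++ P0 ++ [h])).
    assert (Q : sumw (dl f) (y :: rev Ps ++ [h]) = (- sumw (dl f) (h :: Ps ++ [y]))%Z).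
    { rewrite <- sumw_rev by (intros; apply dl_anti). simpl. now rewrite rev_app_distr. }
    rewrite Q. lia. }
  assert (Ex : exists M, G1 ++ y :: rev Ps = M ++ [x]).
  { destruct (@exists_last _ (G1 ++ y :: rev Ps)) as [M [q EM]]; [intros E; now apply app_eq_nil in E as [_ E]|].
    exists M. rewrite EM. do 2 f_equal. rewrite <- hdPs. 
    assert (last (G1 ++ y :: rev Ps) h = q) as <- by (rewrite EM; apply last_last).
    rewrite last_app_cons. destruct Ps as [|u Ps']; [reflexivity|]. simpl. now rewrite last_last. }
  destruct Ex as [M EM]. destruct FF_snoc as [F2 EF].
  assert (CM : chain Bd (h :: M ++ [x])).
  { rewrite <- EM. apply (chain_app Bd (h :: G1)). split; [exact CG1|].
    apply (chain_rev Bd _ Bd_sym) in CPs. rewrite rev_app_distr in CPs. exact CPs. }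
  assert (DM : forall p, In p (M ++ [x]) -> ~ RA h p).
  { intros p. rewrite <- EM. intros Hp. apply in_app_or in Hp as [Hp|[<-|Hp]].
    - apply Gd. rewrite EG. apply in_or_app; auto.
    - apply Pid.
    - apply in_rev in Hp. apply HPs in Hp as [t [_ ->]]. apply Pid. }
  assert (WW : wnd (h :: M ++ x :: rev F2) org = 0%Z).
  { apply NBC_dom; [discriminate| |].
    - change (chain Bd ((h :: M ++ x :: rev F2) ++ [h])). simpl. rewrite <- app_assoc. simpl.
      apply (chain_app Bd (h :: M)). split; [exact CM|].
      pose proof C_chain as Cc. unfold C in Cc. rewrite EF in Cc. apply (chain_rev Bd _ Bd_sym) in Cc.
      simpl in Cc. rewrite rev_app_distr in Cc. exact Cc.
    - intros p [<-|Hp]; auto. right. apply in_app_or in Hp as [Hp|[<-|Hp]].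
      + apply DM. apply in_or_app; auto.
      + apply x_dom.
      + apply FF_dominated. rewrite EF. apply in_or_app. left. now apply in_rev. }
  assert (W2 : wnd K2 org = 1%Z).
  { rewrite <- C_org. apply Zminus_eq. rewrite <- WW. unfold wnd, K2, C. rewrite EM, EF. simpl cl.
    rewrite <- !app_assoc. simpl app.
    rewrite (sumw_app1 (dl org) h M x [h]), (sumw_app1 (dl org) h F2 x [h]), (sumw_app1 (dl org) h M x (rev F2 ++ [h])).
    assert (Q : sumw (dl org) (x :: rev F2 ++ [h]) = (- sumw (dl org) (h :: F2 ++ [x]))%Z).
    { rewrite <- sumw_rev by (intros; apply dl_anti). simpl. now rewrite rev_app_distr. }
    rewrite Q. lia. }
  destruct S1 as [ND1 [Ca1 Ln1]]. rewrite EC, EG in ND1.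
  assert (ND1' : NoDup (h :: G1 ++ y :: G2)) by now apply NoDup_app_remove_l in ND1.
  assert (K2s : Simple K2).
  { split; [|split].
    - unfold K2. change (h :: G1 ++ y :: rev Ps) with ((h :: G1) ++ y :: rev Ps).
      replace ((h :: G1) ++ y :: rev Ps) with ((h :: G1 ++ [y]) ++ rev Ps) by (simpl; now rewrite <- app_assoc).
      apply NoDup_app.
      + replace (h :: G1 ++ y :: G2) with ((h :: G1 ++ [y]) ++ G2) in ND1' by (simpl; now rewrite <- app_assoc).
        now apply NoDup_app_remove_r in ND1'.
      + now apply NoDup_rev.
      + intros p Hp I. apply in_rev in I. apply HPs in I as [t [Ht ->]]. apply (Hs t Ht). rewrite EC, EG.
        apply in_or_app. right. destruct Hp as [<-|Hp]; [left; auto|right]. apply in_app_or in Hp as [Hp|[<-|[]]];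
        apply in_or_app; [left|right; left]; auto.
    - unfold cadj. change (cl K2) with (h :: (G1 ++ y :: rev Ps) ++ [h]). rewrite EM. apply chain_snoc.
      + now apply chain_Bd_adj.
      + rewrite last_last. apply x_adj.
    - unfold K2. cbn [length]. rewrite length_app. cbn [length]. destruct G1 as [|g G1']; [|cbn [length]; lia].
      rewrite length_rev. destruct Ps as [|u Ps'] eqn:EPs; [|cbn [length]; lia]. exfalso.
      simpl in hdPs. simpl in CG1. apply x_nonbond. rewrite <- hdPs. apply Bd_sym. tauto. }
  assert (hdG : hd y G1 = R (c + 1)).
  { unfold G in EG. rewrite seg_cons in EG by lia. rewrite Nat.add_1_r. destruct G1; simpl in EG; injection EG; auto. }
  assert (P2n : stp (cl K2) h (R (c + 1))).
  { unfold K2. rewrite <- hdG. change (stp ((h :: G1 ++ y :: rev Ps) ++ [h]) h (hd y G1)). apply stp_l.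
    destruct G1; eexists [], _; reflexivity. }
  assert (P2p : stp (cl K2) x h).
  { change (cl K2) with (h :: (G1 ++ y :: rev Ps) ++ [h]). rewrite EM, <- app_assoc. exists (h :: M), []. reflexivity. }
  destruct (simple_sides K2s) as [k2 [Hk2 KK2]]. destruct (KK2 _ _ _ P2p P2n) as [_ [K2f [K2L K2R]]].
  destruct (w_Rm K2) as [_ Wm]; [apply K2s| |].
  { intros p [<-|Hp]; auto. right. apply DM. now rewrite <- EM. }
  rewrite W2 in Wm.
  (* [R (c - 1)] has winding number 1 like the origin, so it cannot be on the right of [K2], where
     the value is at most 0. *)
  assert (k2 = 1%Z).
  { destruct (@left_or_right (dirof h x) (dirof h (R (c + 1))) (dirof h (R (c - 1)))) as [Q|Q]; auto.
    - intros E. apply (dirof_inj Xa (Bd_adj Rb)) in E. now apply x_Rp.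
    - intros E. apply (dirof_inj Rm_adj Xa) in E. now apply x_Rm.
    - apply Rm_turn.
    - apply K2L in Q. lia.
    - apply K2R in Q. lia. }
  assert (K3s : Simple K3).
  { split; [|split].
    - unfold K3. apply NoDup_swap. simpl. replace ((Ps ++ y :: G2) ++ P0) with (Ps ++ (y :: G2 ++ P0)) by (now rewrite <- app_assoc).
      change (h :: Ps ++ y :: G2 ++ P0) with ((h :: Ps) ++ y :: G2 ++ P0). apply NoDup_swap.
      replace ((y :: G2 ++ P0) ++ h :: Ps) with ((y :: G2 ++ P0 ++ [h]) ++ Ps) by (simpl; now rewrite <- !app_assoc).
      apply NoDup_app; auto.
      + assert (X : NoDup ((P0 ++ h :: G1) ++ y :: G2)) by (rewrite <- app_assoc; exact ND1). apply NoDup_swap in X.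
        replace ((y :: G2) ++ P0 ++ h :: G1) with ((y :: G2 ++ P0 ++ [h]) ++ G1) in X by (simpl; now rewrite <- !app_assoc).
        now apply NoDup_app_remove_r in X.
      + intros p Hp I. apply HPs in I as [t [Ht ->]]. apply (Hs t Ht). rewrite EC, EG.
        destruct Hp as [<-|Hp]; [apply in_or_app; right; right; apply in_or_app; right; left; auto|].
        apply in_app_or in Hp as [Hp|Hp]; [apply in_or_app; right; right; apply in_or_app; right; right; auto|].
        apply in_app_or in Hp as [Hp|[<-|[]]]; apply in_or_app; [left|right; left]; auto.
    - assert (Ecl : cl K3 = P0 ++ h :: Ps ++ y :: G2 ++ [hd h P0]).
      { unfold K3, P0. rewrite (@seg_cons R a1) by lia. simpl. rewrite <- app_assoc. simpl. now rewrite <- app_assoc. }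
      unfold cadj. rewrite Ecl. apply (chain_app adj P0) in CK1 as [CKa CKb]. apply (chain_app adj (h :: G1)) in CKb as [_ CKb].
      apply chain_app. split; auto. apply (chain_app adj (h :: Ps)). split; auto.
      assert (exists w, Ps ++ [y] = x :: w) as [w Ew] by (rewrite <- hdPs; destruct Ps; eexists; reflexivity).
      change (chain adj (h :: (Ps ++ [y]))). rewrite Ew. split; auto. rewrite <- Ew.
      now apply chain_Bd_adj.
    - unfold K3. rewrite length_app. cbn [length]. rewrite length_app. cbn [length]. 
      unfold P0. rewrite seg_cons by lia. cbn [length]. lia. }
  assert (P3p : stp (cl K3) (R (c - 1)) h).
  { unfold K3. assert (Hs3 : stp (P0 ++ [h]) (R (c - 1)) h).
    { unfold P0. rewrite <- Hc. replace c with (S (c - 1)) at 2 by lia. rewrite <- seg_snoc by lia.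
      replace c with (S (c - 1)) at 3 by lia. apply stp_seg; lia. }
    unfold P0 in *. rewrite (@seg_cons R a1) in * by lia. 
    change (stp ((R a1 :: seg R (S a1) (c - 1) ++ h :: Ps ++ y :: G2) ++ [R a1]) (R (c - 1)) h). apply stp_l.
    apply (stp_app (R a1 :: seg R (S a1) (c - 1)) h). left. exact Hs3. }
  assert (P3n : stp (cl K3) h x).
  { unfold K3. assert (Hs3 : stp (P0 ++ h :: Ps ++ y :: G2) h x).
    { apply stp_r. rewrite <- hdPs. destruct Ps; eexists [], _; reflexivity. }
    unfold P0 in *. rewrite (@seg_cons R a1) in * by lia. apply stp_l with (l2 := [R a1]) in Hs3. exact Hs3. }
  destruct (simple_sides K3s) as [k3 [Hk3 KK3]]. destruct (KK3 _ _ _ P3p P3n) as [_ [_ [K3L _]]].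
  (* In the square on the left of the edge from [h] to [R (c + 1)], [K1] has winding number 0 and
     [K2] has 1, which leaves -1 for [K3]. This square is on the left of [K3], where only 0 and 1
     are possible. *)
  pose proof (W123 (F h (dirof h (R (c + 1))))) as Wf. rewrite K1f, K2f in Wf.
  rewrite K3L in Wf; [simpl in Wf; lia|]. pose proof Rm_turn as Tn. clear - XR Tn. dirs.
Qed.

End Right.
End Loop.

(** By [arcs_bounded], a loop with a late end [b] also closes late. Its vertex [h] is then after
    [k0] on [r] and, by the choice of [a0], is not among the first [N] vertices of [R]. So [R] has
    exposed vertices arbitrarily far out. *)
Theorem loops_unbounded_periodic {SS : Sys} r k0 : extremal true (fun _ => True) 1 r ->
  (forall c, c <> [] -> chain Bd (cl c) -> (forall p i, In p c -> i <= k0 -> p <> r i) -> wnd c org = 0%Z) ->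
  (forall B, exists a b A, loop r a b A /\ B < b) -> exists R, isray R /\ rayper R.
Proof.
  intros H NBC U. pose proof H as [Hr _].
  destruct (@extremal_ray _ false (fun _ => True) 1 r) as [R [HR _]]; auto.
  pose proof HR as [IR _]. exists R. split; auto. apply exposed_periodic with false 1; auto. intros N.
  destruct (eventually_out r (map R (seq 0 N))) as [a0 Ha0]; [apply Hr|].
  destruct (arcs_bounded H (S (Nat.max k0 a0))) as [K HK].
  destruct (U K) as [a [b [A [HL Lb]]]].
  assert (La : S (Nat.max k0 a0) <= a).
  { destruct (Nat.le_gt_cases (S (Nat.max k0 a0)) a); auto. destruct HL as [HA _]. apply HK in HA; lia. }
  destruct (R_hits Hr NBC HL) with (R := R) as [c [Lc Ec]]; auto; [lia|].
  exists c. split.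
  - destruct (Nat.le_gt_cases N c); auto. exfalso. apply (Ha0 a); [lia|]. rewrite <- Ec. apply in_map, in_seq. lia.
  - apply (R_exposed Hr NBC HL) with (1 := ltac:(lia) : k0 < a); auto.
Qed.

(** * Rays in a half-plane *)

Definition sl (p : Point) (d : Dir) (t : nat) : Point :=
  (fst p + Z.of_nat t * fst (dvec d), snd p + Z.of_nat t * snd (dvec d))%Z.

Definition ln (p : Point) (d : Dir) (n : nat) : list Point := seg (sl p d) 1 n.

Lemma sl_0 p d : sl p d 0 = p.
Proof. destruct p; unfold sl; cbn [fst snd]; f_equal; lia. Qed.

Lemma sl_S p d t : sl p d (S t) = step (sl p d t) d.
Proof. unfold sl, step, padd; destruct d; cbn [dvec fst snd]; f_equal; lia. Qed.

Lemma sl_inj p d i j : sl p d i = sl p d j -> i = j.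
Proof.
  unfold sl. intros E. pose proof (f_equal fst E) as E1. pose proof (f_equal snd E) as E2.
  destruct d; cbn [dvec fst snd] in *; lia.
Qed.

Lemma ln_seg p d n : p :: ln p d n = seg (sl p d) 0 n.
Proof. unfold ln. rewrite (@seg_cons (sl p d) 0) by lia. now rewrite sl_0. Qed.

Lemma ln_chain p d n : chain adj (p :: ln p d n).
Proof. rewrite ln_seg. apply seg_chain. intros t _ _. exists d. apply sl_S. Qed.

Lemma ln_last p d n : last (ln p d n) p = sl p d n.
Proof.
  unfold ln, seg. replace (S n - 1) with n by lia. apply last_map_seq. apply sl_0.
Qed.

Lemma ln_NoDup p d n : NoDup (ln p d n).
Proof. apply seg_NoDup. intros i j; apply sl_inj. Qed.

Lemma in_ln p d n q : In q (ln p d n) -> exists t, 1 <= t <= n /\ q = sl p d t.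
Proof. apply in_seg. Qed.

Lemma chain_cat (R : Point -> Point -> Prop) p l1 l2 :
  chain R (p :: l1) -> chain R (last l1 p :: l2) -> chain R (p :: l1 ++ l2).
Proof.
  revert p. induction l1 as [|q l1 IH]; intros p H1 H2; [exact H2|].
  destruct H1 as [H1 H3]. rewrite last_cons in H2.
  change (R p q /\ chain R (q :: l1 ++ l2)). split; auto.
Qed.

Lemma last_cat {X} (l1 l2 : list X) d : last (l1 ++ l2) d = last l2 (last l1 d).
Proof.
  revert d. induction l1 as [|x l1 IH]; intros d; [reflexivity|]. simpl app. rewrite !last_cons. apply IH.
Qed.

Section Sys.
Context {SS : Sys}.

(* A ray that starts under an arc can only escape by meeting it. *)
Lemma trapped r a b A i (xi : nat -> Point) : isray r -> garc true r a b A -> a < i -> i < b ->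
  (forall t, adj (xi t) (xi (S t))) -> (forall t t', xi t = xi t' -> t = t') -> adj (r i) (xi 0) ->
  (forall t s, xi t <> r s) -> LeftP (r (i - 1)) (r i) (r (i + 1)) (xi 0) -> exists t, In (xi t) A.
Proof.
  intros R H L1 L2 XA XI X0 XN XL. apply NNPP. intros N.
  destruct (garc_simple R H) as [E [N1 [N2 N3]]].
  assert (NX : forall t, ~ In (xi t) (seg r a b ++ A)).
  { intros t I. apply in_app_or in I as [I|I]; [|apply N; exists t; auto].
    apply in_seg in I as [s [_ Es]]. now apply (XN t s). }
  destruct (stp_close r (a := a) (b := b) A) as [ST _]; [apply H|auto|].
  destruct (garc_sides R H (u := r (i - 1)) (p := r i) (v := r (i + 1))) as [_ [_ [KL _]]].
  - replace i with (S (i - 1)) at 2 by lia. apply ST; lia.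
  - rewrite Nat.add_1_r. apply ST; lia.
  - specialize (KL _ XL). rewrite face_to in KL; auto. rewrite wv_infinite in KL; auto. discriminate.
Qed.

Definition Dn (n : Z) (p : Point) : Prop := (fst p <= n)%Z.

(** [e] is a path to infinity, given by its offsets. A deviation would put an arc over [r i], and
    the copy of [e] at [r i] would have to meet it. The arc is a translate of a part of [r], so then
    the copy of [e] at [r j] would meet [r]. An arc that leaves the half-plane is completed along
    the column [n + 1]: either [e] stays away from this column, or the translation is vertical and
    the arc cannot leave. *)
Lemma visible_no_deviation kb n r i j e : isray r -> (forall t, (fst (r t) <= n)%Z) -> fst (r kb) = n ->
  kb < i -> (forall t, adj (e t) (e (S t))) -> (forall t t', e t = e t' -> t = t') ->
  adj (r i) (padd (r i) (e 0)) ->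
  (forall t s, padd (r i) (e t) <> r s) -> (forall t s, padd (r j) (e t) <> r s) ->
  LeftP (r (i - 1)) (r i) (r (i + 1)) (padd (r i) (e 0)) ->
  (forall t, fst (padd (r i) (e t)) <= n)%Z \/ fst (r i) = fst (r j) ->
  ~ deviates true (Dn n) r i j.
Proof.
  intros R HD Hw Lk EA EI E0 Ni Nj EL Hcase [m [k [x [M1 [K1 [EX [X0 [Com [B [N [DX [C [BB Last]]]]]]]]]]]]].
  pose proof R as [R0 [R1 R2]].
  assert (Xi : forall t t', x t = x t' -> t = t').
  { intros t t' Et. rewrite !EX in Et. assert (j + m + t = j + m + t'); [|lia]. apply R2. pts. }
  assert (XA : forall t, adj (padd (r i) (e t)) (padd (r i) (e (S t)))).
  { intros t. destruct (EA t) as [d Ed]. exists d. rewrite Ed. pts. }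
  assert (XI : forall t t', padd (r i) (e t) = padd (r i) (e t') -> t = t').
  { intros t t' Et. apply EI. pts. }
  assert (Nx : forall t s, x s <> padd (r i) (e t)).
  { intros t s Es. rewrite EX in Es. apply (Nj t (j + m + s)). unfold psub in Es. pts. }
  set (A := map x (seq 1 (k - 1))).
  assert (InA : forall p, In p A -> exists t, 1 <= t < k /\ p = x t).
  { intros p Hp. apply in_map_iff in Hp as [t [<- Ht]]. apply in_seq in Ht. exists t. split; auto; lia. }
  assert (NA : NoDup A) by (apply NoDup_map_inj; auto; apply seq_NoDup).
  assert (CA : chain adj (r (i + m) :: A)).
  { rewrite <- X0. apply (@chain_map_seq adj x (k - 1) 0). intros t _ Ht. rewrite <- Nat.add_1_r.
    apply Bd_adj, C. lia. }
  assert (LA : last A (r (i + m)) = x (k - 1)) by (apply last_map_seq; auto).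
  destruct Last as [[a [La Ea]]|[Nk [Fk Bk]]].
  - assert (HG : garc true r a (i + m) A).
    { split; [lia|]. split; [auto|]. split; [|split; [auto|split]].
      - intros p s Hp. apply InA in Hp as [t [Ht ->]]. apply N; lia.
      - rewrite <- Ea. unfold A. destruct k as [|[|k]]; [lia|exact B|exact B].
      - rewrite LA, <- Ea. now apply bondable_adj. }
    destruct (@trapped r a (i + m) A i (fun t => padd (r i) (e t))) as [t It]; auto; [lia|].
    apply InA in It as [s [_ Es]]. now apply (Nx t s).
  - assert (HE : forall t, (fst (padd (r i) (e t)) <= n)%Z).
    { destruct Hcase as [|Hf]; auto. exfalso. apply Fk. red. rewrite EX. unfold psub, padd. cbn.
      specialize (HD (j + m + k)). lia. }
    assert (Fx : fst (x k) = (n + 1)%Z).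
    { unfold Dn in Fk. assert (D' : (fst (x (k - 1)%nat) <= n)%Z).
      { destruct (Nat.eq_dec k 1) as [->|]; [simpl; rewrite X0; auto|apply DX; lia]. }
      apply Bd_adj in Bk as [d Ed]. rewrite Ed in *. unfold step, padd in *. destruct d; cbn in *; lia. }
    set (w := r kb) in *.
    (* The column [n + 1] is followed up or down to the eastern neighbour of [r kb], where the arc
       closes. *)
    set (d := if Z.leb (snd (x k)) (snd w) then DN else DS).
    set (hh := Z.to_nat (Z.abs (snd w - snd (x k)))).
    set (V := ln (x k) d hh).
    assert (HV : forall p, In p V -> fst p = (n + 1)%Z /\ p <> x k).
    { intros p Hp. apply in_ln in Hp as [t [Ht ->]]. split.
      - unfold sl. subst d. destruct (Z.leb_spec (snd (x k)) (snd w)); cbn [dvec fst snd]; lia.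
      - intros Es. rewrite <- (sl_0 (x k) d) in Es at 2. apply sl_inj in Es. lia. }
    assert (LV : last V (x k) = step w DE).
    { unfold V. rewrite ln_last. unfold sl, d, hh, step, padd. 
      destruct (Z.leb_spec (snd (x k)) (snd w)); cbn [dvec fst snd]; f_equal; lia. }
    assert (EA1 : chain adj (r (i + m) :: A ++ x k :: V)).
    { apply chain_cat; auto. rewrite LA. split; [now apply Bd_adj|]. apply ln_chain. }
    assert (HG : garc true r kb (i + m) (A ++ x k :: V)).
    { split; [lia|]. split; [|split; [|split; [auto|split]]].
      - apply NoDup_app; auto.
        + constructor; [|apply ln_NoDup]. intros I. apply HV in I. tauto.
        + intros p Hp. apply InA in Hp as [t [Ht ->]]. intros [Es|I].
          * apply Xi in Es. lia.
          * apply HV in I as [I _]. pose proof (DX t) as Dt. unfold Dn in Dt.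
            specialize (Dt ltac:(lia) ltac:(lia)). lia.
      - intros p s Hp. apply in_app_or in Hp as [Hp|[<-|Hp]].
        + apply InA in Hp as [t [Ht ->]]. apply N; lia.
        + apply Nk.
        + apply HV in Hp as [Hp _]. intros ->. specialize (HD s). lia.
      - unfold A. destruct k as [|[|k]]; [lia|exact B|exact B].
      - rewrite last_app_cons, LV. apply adj_sym. exists DE. reflexivity. }
    destruct (@trapped r kb (i + m) (A ++ x k :: V) i (fun t => padd (r i) (e t))) as [t It]; auto; [lia|].
    apply in_app_or in It as [It|[It|It]].
    + apply InA in It as [s [_ Es]]. now apply (Nx t s).
    + now apply (Nx t k).
    + apply HV in It as [It _]. specialize (HE t). lia.
Qed.

(* The three straight pieces lead from [r i] to the column [x = n + 1] below [r kb]. *)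
Lemma visible_left kb n r i a b c : isray r -> (forall t, (fst (r t) <= n)%Z) -> fst (r kb) = n -> kb < i ->
  (a = 0 \/ 1 <= b) -> 1 <= c -> (fst (r i) - Z.of_nat a + Z.of_nat c = n + 1)%Z ->
  (snd (r i) - Z.of_nat b < snd (r kb))%Z ->
  let q1 := sl (r i) DW a in let q2 := sl q1 DS b in
  let A1 := ln (r i) DW a ++ ln q1 DS b ++ ln q2 DE c in
  (forall p s, In p A1 -> p <> r s) ->
  LeftP (r (i - 1)) (r i) (r (i + 1)) (hd (r i) A1).
Proof.
  intros R HD Hw Lk Hab Hc Hx Hy q1 q2 A1 NA. pose proof R as [R0 [R1 R2]].
  set (q := r i) in *. set (w := r kb) in *. set (q3 := sl q2 DE c).
  set (hh := Z.to_nat (snd w - (snd q - Z.of_nat b))).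
  assert (Q1 : q1 = (fst q - Z.of_nat a, snd q)%Z) by (unfold q1, sl; cbn [dvec fst snd]; f_equal; lia).
  assert (Q2 : q2 = (fst q - Z.of_nat a, snd q - Z.of_nat b)%Z) by (unfold q2; rewrite Q1; unfold sl; cbn [dvec fst snd]; f_equal; lia).
  assert (Q3 : q3 = (n + 1, snd q - Z.of_nat b)%Z) by (unfold q3; rewrite Q2; unfold sl; cbn [dvec fst snd]; f_equal; lia).
  assert (I1 : forall p, In p (ln q DW a) -> snd p = snd q /\ (fst q - Z.of_nat a <= fst p < fst q)%Z).
  { intros p Hp. apply in_ln in Hp as [t [Ht ->]]. unfold sl; cbn [dvec fst snd]. lia. }
  assert (I2 : forall p, In p (ln q1 DS b) -> fst p = (fst q - Z.of_nat a)%Z /\ (snd q - Z.of_nat b <= snd p < snd q)%Z).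
  { intros p Hp. apply in_ln in Hp as [t [Ht ->]]. rewrite Q1. unfold sl; cbn [dvec fst snd]. lia. }
  assert (I3 : forall p, In p (ln q2 DE c) -> snd p = (snd q - Z.of_nat b)%Z /\ (fst q - Z.of_nat a < fst p <= n + 1)%Z).
  { intros p Hp. apply in_ln in Hp as [t [Ht ->]]. rewrite Q2. unfold sl; cbn [dvec fst snd]. lia. }
  set (V := ln q3 DN hh).
  assert (I4 : forall p, In p V -> fst p = (n + 1)%Z /\ (snd q - Z.of_nat b < snd p)%Z).
  { intros p Hp. apply in_ln in Hp as [t [Ht ->]]. rewrite Q3. unfold sl; cbn [dvec fst snd]. lia. }
  assert (Hqn : (fst q <= n)%Z) by apply HD.
  assert (ND : NoDup (A1 ++ V)).
  { unfold A1. rewrite <- !app_assoc. apply NoDup_app; [apply ln_NoDup| |].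
    - apply NoDup_app; [apply ln_NoDup| |].
      + apply NoDup_app; try apply ln_NoDup. intros p H3 H4. apply I3 in H3. apply I4 in H4. lia.
      + intros p H2 H. apply I2 in H2. apply in_app_or in H as [H|H]; [apply I3 in H|apply I4 in H]; lia.
    - intros p H1 H. apply I1 in H1. apply in_app_or in H as [H|H]; [apply I2 in H; lia|].
      apply in_app_or in H as [H|H]; [apply I3 in H|apply I4 in H]; lia. }
  assert (L1 : last A1 q = q3).
  { unfold A1. rewrite !last_cat. rewrite ln_last. fold q1. rewrite ln_last. fold q2. apply ln_last. }
  assert (CA : chain adj (q :: A1)).
  { unfold A1. apply chain_cat; [apply ln_chain|]. rewrite ln_last. fold q1.
    apply chain_cat; [apply ln_chain|]. rewrite ln_last. fold q2. apply ln_chain. }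
  assert (CV : chain adj (q :: A1 ++ V)).
  { apply chain_cat; auto. rewrite L1. apply ln_chain. }
  assert (Nh : 1 <= hh) by (unfold hh; lia).
  assert (LV : last (A1 ++ V) q = step w DE).
  { rewrite last_cat, L1. unfold V. rewrite ln_last, Q3. unfold sl, hh, step, padd. cbn [dvec fst snd].
    f_equal; lia. }
  assert (NV : forall p s, In p (A1 ++ V) -> p <> r s).
  { intros p s Hp. apply in_app_or in Hp as [Hp|Hp]; [now apply NA|]. apply I4 in Hp as [Hp _]. intros ->.
    specialize (HD s). lia. }
  destruct (@closed_simple r kb i (A1 ++ V)) as [E SC]; auto.
  { intros t _ _. now apply Bd_adj. }
  { fold q. rewrite LV. fold w. apply adj_sym. exists DE. reflexivity. }
  { rewrite length_app. unfold V, ln, seg. rewrite length_map, length_seq. unfold A1. rewrite !length_app.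
    unfold ln, seg. rewrite !length_map, !length_seq. lia. }
  destruct (stp_close r (A1 ++ V) Lk E) as [S1 [S2 S3]]. fold q w in S2, S3. rewrite LV in S3.
  assert (A1n : exists A0, A1 = A0 ++ [q3]).
  { destruct (@exists_last _ A1) as [A0 [z Ez]].
    - unfold A1. intros En. apply app_eq_nil in En as [_ En]. apply app_eq_nil in En as [_ En].
      unfold ln, seg in En. apply map_eq_nil in En. apply (f_equal (@length _)) in En. rewrite length_seq in En. simpl in En. lia.
    - exists A0. rewrite Ez in *. rewrite last_last in L1. now rewrite L1. }
  set (C := seg r kb i ++ A1 ++ V) in *.
  assert (S4 : stp (cl C) (sl q3 DN (hh - 1)) (step w DE)).
  { rewrite E. apply stp_r, stp_l. destruct A1n as [A0 ->]. rewrite <- app_assoc. apply stp_r. simpl.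
    unfold V. rewrite ln_seg. replace (step w DE) with (sl q3 DN (S (hh - 1))).
    - apply stp_seg; lia.
    - replace (S (hh - 1)) with hh by lia. rewrite <- LV, last_cat, last_last. unfold V. now rewrite ln_last. }
  destruct (simple_sides SC) as [k [Hk K]].
  (* On the column [n + 1] the curve runs north, with the outside to its east, that is, on its
     right. *)
  assert (k = 1%Z).
  { destruct (K _ _ _ S4 S3) as [_ [_ [_ KR]]].
    assert (W0 : wnd C (F (step w DE) DE) = 0%Z).
    { apply wnd_far_max; [apply SC|]. intros p Hp. unfold F, step, padd; cbn [dvec fst snd].
      unfold C in Hp. apply in_app_or in Hp as [Hp|Hp].
      - apply in_seg in Hp as [t [_ ->]]. specialize (HD t). lia.
      - apply in_app_or in Hp as [Hp|Hp].
        + unfold A1 in Hp. apply in_app_or in Hp as [Hp|Hp]; [apply I1 in Hp; lia|].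
          apply in_app_or in Hp as [Hp|Hp]; [apply I2 in Hp; lia|apply I3 in Hp; lia].
        + apply I4 in Hp. lia. }
    rewrite KR in W0; [lia|].
    replace (sl q3 DN (hh - 1)) with (step (step w DE) DS).
    - rewrite dirof_step. replace w with (step (step w DE) DW) at 2 by (apply (step_opp w DE)). rewrite dirof_step.
      unfold Right; cbn; lia.
    - rewrite Q3. unfold sl, step, padd, hh; cbn [dvec fst snd]. f_equal; lia. }
  subst k.
  assert (NT : forall s, S i <= s -> ~ In (r s) C).
  { intros s Hs I. unfold C in I. apply in_app_or in I as [I|I].
    - apply in_seg in I as [t [Ht Et]]. apply R2 in Et. lia.
    - exact (NV _ s I eq_refl). }
  assert (T0 : wnd C (r (S i)) = 0%Z) by (apply (@tail_out _ r C (S i) R); auto; apply SC).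
  assert (Hhd : hd w (A1 ++ V) = hd q A1) by (destruct A1n as [[|? ?] ->]; reflexivity).
  rewrite Hhd in S2.
  assert (S0 : stp (cl C) (r (i - 1)) q).
  { pose proof (S1 (i - 1) ltac:(lia) ltac:(lia)) as S0. now replace (S (i - 1)) with i in S0 by lia. }
  destruct (K _ _ _ S0 S2) as [Nab [_ [KL _]]].
  assert (Aq : adj q (r (S i))) by (apply Bd_adj, R1).
  assert (Ap : adj q (r (i - 1))).
  { apply adj_sym. unfold q. replace i with (S (i - 1)) at 2 by lia. apply Bd_adj, R1. }
  assert (Ah : adj q (hd q A1)).
  { destruct A1n as [A0 EA0]. rewrite EA0 in CA |- *. destruct A0; apply CA. }
  assert (Ih : In (hd q A1) A1) by (destruct A1n as [[|? ?] ->]; simpl; auto).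
  pose proof (@ray_turn _ r i R ltac:(lia)) as Tn. fold q in Tn. rewrite Nat.add_1_r in *.
  assert (Nd : dirof q (r (i - 1)) <> dirof q (hd q A1)) by (intros Ed; apply Nab; now apply (dirof_inj Ap Ah)).
  (* The tail of [r] is outside, hence to the right of the turn into the straight pieces; seen from
     [r], these start on the left. *)
  destruct (@left_or_right (dirof q (r (i - 1))) (dirof q (hd q A1)) (dirof q (r (S i)))) as [Q|Q].
  - auto.
  - auto.
  - intros Ed. apply (dirof_inj Aq Ah) in Ed. exact (NA _ _ Ih (eq_sym Ed)).
  - apply KL in Q. rewrite face_to in Q; auto; [|apply SC]. rewrite T0 in Q. discriminate.
  - clear - Q Tn Nd. unfold LeftP. dirs.
Qed.

Lemma visible_periodic kb n r e (P : nat -> Prop) : extremal true (Dn n) (S kb) r ->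
  (forall t, (fst (r t) <= n)%Z) -> fst (r kb) = n ->
  (forall t, adj (e t) (e (S t))) -> (forall t t', e t = e t' -> t = t') -> adj org (e 0) ->
  (forall N, exists i, N <= i /\ P i) ->
  (forall i, P i -> S kb < i -> (forall t s, padd (r i) (e t) <> r s) /\
     LeftP (r (i - 1)) (r i) (r (i + 1)) (padd (r i) (e 0))) ->
  (forall i t, P i -> fst (padd (r i) (e t)) <= n)%Z \/ (forall i j, P i -> P j -> fst (r i) = fst (r j)) ->
  rayper r.
Proof.
  intros H HD Hw EA EI E0 HP HV HC. pose proof H as [R _].
  assert (Ea : forall p, adj p (padd p (e 0))).
  { intros p. destruct E0 as [d Ed]. exists d. rewrite Ed. unfold org. pts. }
  destruct (@state_pigeon _ r (fun i => S kb < i /\ P i)) as [i [[Li Pi] [j [Lij [[Lj Pj] St]]]]].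
  { intros N. destruct (HP (Nat.max N (S (S kb)))) as [i [L Pi]]. exists i. split; [lia|]. split; auto; lia. }
  { intros; now apply isray_dom. }
  destruct (HV i Pi Li) as [Vi Fi]. destruct (HV j Pj Lj) as [Vj Fj].
  assert (W : forall i j, P i -> P j -> (forall t, fst (padd (r i) (e t)) <= n)%Z \/ fst (r i) = fst (r j)).
  { intros i' j' Pi' Pj'. destruct HC as [HC|HC]; [left; intros; now apply HC|right; now apply HC]. }
  destruct (compare H Li Lj St) as [C|[C|C]].
  - exists i, j. auto.
  - exfalso. revert C. apply visible_no_deviation with kb e; auto. lia.
  - exfalso. revert C. apply visible_no_deviation with kb e; auto. lia.
Qed.

(* The column [c] is visited arbitrarily far south. *)
Definition low (r : nat -> Point) (c : Z) : Prop := forall Y, exists i, fst (r i) = c /\ (snd (r i) < Y)%Z.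

Lemma low_many r c Y N : low r c -> exists i, N <= i /\ fst (r i) = c /\ (snd (r i) < Y)%Z.
Proof.
  intros H.
  assert (exists Y', (Y' <= Y)%Z /\ forall i, i < N -> (Y' <= snd (r i))%Z) as [Y' [L B]].
  { clear H. induction N as [|N [Y' [L B]]]; [exists Y; split; [lia|intros; lia]|].
    exists (Z.min Y' (snd (r N))). split; [lia|]. intros i Hi. destruct (Nat.eq_dec i N) as [->|]; [lia|].
    specialize (B i). lia. }
  destruct (H Y') as [i [Ei Li]]. exists i. split; [|split; [auto|lia]].
  destruct (Nat.le_gt_cases N i); auto. specialize (B i). lia.
Qed.

Lemma not_low_bound r (c1 : Z) m : (forall c, (c1 < c <= c1 + Z.of_nat m)%Z -> ~ low r c) ->
  forall Y0, exists Y, (Y <= Y0)%Z /\ forall i, (c1 < fst (r i) <= c1 + Z.of_nat m)%Z -> (Y <= snd (r i))%Z.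
Proof.
  intros H Y0. induction m as [|m IH]; [exists Y0; split; [lia|intros; lia]|].
  destruct IH as [Y [L B]]; [intros; apply H; lia|].
  assert (Nl : ~ low r (c1 + Z.of_nat (S m))%Z) by (apply H; lia).
  apply not_all_ex_not in Nl as [Y1 Nl]. exists (Z.min Y Y1). split; [lia|]. intros i Hi.
  destruct (Z.eq_dec (fst (r i)) (c1 + Z.of_nat (S m))%Z) as [Ec|].
  - destruct (Z.lt_ge_cases (snd (r i)) Y1); [|lia]. exfalso. apply Nl. exists i; auto.
  - specialize (B i). lia.
Qed.

Lemma z_max (P : Z -> Prop) n : (forall c, P c -> c <= n)%Z -> (exists c, P c) -> exists c, P c /\ forall c', P c' -> (c' <= c)%Z.
Proof.
  intros B [c Hc]. destruct (@nat_min (fun m => P (n - Z.of_nat m)%Z)) as [m [Pm Hm]].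
  { exists (Z.to_nat (n - c)). pose proof (B c Hc). replace (n - Z.of_nat (Z.to_nat (n - c)))%Z with c by lia. auto. }
  exists (n - Z.of_nat m)%Z. split; auto. intros c' Hc'. pose proof (B c' Hc').
  assert (m <= Z.to_nat (n - c')); [|lia]. apply Hm. replace (n - Z.of_nat (Z.to_nat (n - c')))%Z with c' by lia. auto.
Qed.

(** The bounding column has to be attained, because the auxiliary curves are closed beside [r kb].
    The leftmost ray keeps [z0] up to [kb + 1], so it still touches this column. *)
Theorem halfplane_periodic z0 kb n : isray z0 -> (forall t, (fst (z0 t) <= n)%Z) -> fst (z0 kb) = n ->
  exists r, isray r /\ rayper r.
Proof.
  intros IZ DZ Hz.
  destruct (@extremal_ray _ true (Dn n) (S kb) z0) as [r [H Er]]; auto; [lia| |].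
  { intros i _. apply DZ. }
  pose proof H as [R [_ [Dr _]]]. exists r. split; auto. pose proof R as [R0 [R1 R2]].
  assert (HD : forall t, (fst (r t) <= n)%Z).
  { intros t. destruct (Nat.le_gt_cases t (S kb)); [rewrite Er; auto|apply Dr; auto]. }
  assert (Hw : fst (r kb) = n) by (rewrite Er; auto).
  (* The visible vertices are the low ones of the easternmost low column, or the lowest ones of their
     columns, or the westernmost ones of their rows. *)
  destruct (classic (exists c, low r c)) as [HL|HL].
  - destruct (@z_max (low r) n) as [c [Lc Mc]]; auto.
    { intros c Hc. destruct (Hc 0%Z) as [i [<- _]]. apply HD. }
    assert (Hcn : (c <= n)%Z) by (destruct (Lc 0%Z) as [i [<- _]]; apply HD).
    destruct (@not_low_bound r c (Z.to_nat (n - c))) with (Y0 := snd (r kb)) as [Y [LY BY]].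
    { intros c' Hc' Hl. apply Mc in Hl. lia. }
    (* One step east, then south along the column [c + 1]. If [c = n] this is outside the
       half-plane, so the alternative with equal columns is used below. *)
    set (e := fun t : nat => (1, - Z.of_nat t)%Z : Point).
    apply visible_periodic with kb n e (fun i => fst (r i) = c /\ (snd (r i) < Y)%Z); auto.
    + intros t. exists DS. unfold e, step, padd; cbn [dvec fst snd]; f_equal; lia.
    + intros t t' E. unfold e in E. pose proof (f_equal fst E). pose proof (f_equal snd E). cbn [fst snd] in *. lia.
    + exists DE. reflexivity.
    + intros N. now apply low_many.
    + intros i [Ei Yi] Li.
      assert (V : forall q, (c < fst q)%Z -> (snd q < Y)%Z -> forall s, q <> r s).
      { intros q Q1 Q2 s ->. pose proof (HD s). specialize (BY s). lia. }
      split; [intros t s; apply V; unfold e, padd; cbn [fst snd]; lia|].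
      replace (padd (r i) (e 0)) with (hd (r i) (ln (r i) DW 0 ++ ln (sl (r i) DW 0) DS 0 ++
         ln (sl (sl (r i) DW 0) DS 0) DE (Z.to_nat (n + 1 - c)))).
      * apply visible_left with kb n; auto; try lia.
        intros p s Hp. unfold ln at 1 2 in Hp. simpl in Hp. apply in_ln in Hp as [t [Ht ->]].
        apply V; unfold sl; cbn [dvec fst snd]; lia.
      * unfold ln at 1 2. simpl. rewrite !sl_0. unfold ln. rewrite seg_cons by lia. simpl. 
        unfold sl, e, padd; cbn [dvec fst snd]. f_equal; lia.
    + right. intros i j [Ei _] [Ej _]. congruence.
  - assert (NL : forall c, ~ low r c) by (intros c Hc; apply HL; exists c; auto).
    destruct (classic (forall X, exists i, (fst (r i) < X)%Z)) as [HX|HX].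
    (* The ray extends infinitely far west and has no low column, so each visited column has a
       lowest vertex, from which the view to the south is free. *)
    + set (e := fun t : nat => (0, -1 - Z.of_nat t)%Z : Point).
      apply visible_periodic with kb n e (fun i => forall j, fst (r j) = fst (r i) -> (snd (r i) <= snd (r j))%Z); auto.
      * intros t. exists DS. unfold e, step, padd; cbn [dvec fst snd]; f_equal; lia.
      * intros t t' E. unfold e in E. pose proof (f_equal fst E). pose proof (f_equal snd E). cbn [fst snd] in *. lia.
      * exists DS. reflexivity.
      * intros N. 
        assert (exists X, forall i, i < N -> (X <= fst (r i))%Z) as [X BX].
        { clear. induction N as [|N [X B]]; [exists 0%Z; intros; lia|].
          exists (Z.min X (fst (r N))). intros i Hi. destruct (Nat.eq_dec i N) as [->|]; [lia|]. specialize (B i). lia. }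
        destruct (HX X) as [i0 Hi0].
        destruct (@not_low_bound r (fst (r i0) - 1) 1) with (Y0 := 0%Z) as [Y [_ BY]]; [intros; apply NL|].
        destruct (@z_max (fun v => exists i, fst (r i) = fst (r i0) /\ (- v)%Z = snd (r i)) (- Y)) as [v [[i [E1 E2]] Hv]].
        { intros v [i [E1 E2]]. specialize (BY i). lia. }
        { exists (- snd (r i0))%Z, i0. split; auto; lia. }
        exists i. split.
        -- destruct (Nat.le_gt_cases N i); auto. specialize (BX i). lia.
        -- intros j Ej. assert (- snd (r j) <= v)%Z; [|lia]. apply Hv. exists j. split; [congruence|lia].
      * intros i Hi Li.
        assert (V : forall t s, padd (r i) (e t) <> r s).
        { intros t s E. pose proof (Hi s) as Hs. unfold e in E. rewrite <- E in Hs. unfold padd in Hs; cbn [fst snd] in Hs. lia. }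
        split; auto.
        destruct (@not_low_bound r (fst (r i) - 1) (Z.to_nat (n + 1 - fst (r i)))) with (Y0 := Z.min (snd (r kb)) (snd (r i)))  as [Y [LY BY]].
        { intros; apply NL. }
        assert (Li' := HD i).
        replace (padd (r i) (e 0)) with (hd (r i) (ln (r i) DW 0 ++ ln (sl (r i) DW 0) DS (Z.to_nat (snd (r i) - Y + 1)) ++
         ln (sl (sl (r i) DW 0) DS (Z.to_nat (snd (r i) - Y + 1))) DE (Z.to_nat (n + 1 - fst (r i))))).
        -- apply visible_left with kb n; auto; try lia.
           intros p s Hp. unfold ln at 1 in Hp. simpl in Hp. rewrite !sl_0 in Hp. apply in_app_or in Hp as [Hp|Hp].
           ++ apply in_ln in Hp as [t [Ht ->]]. replace (sl (r i) DS t) with (padd (r i) (e (t - 1))); [apply V|].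
              unfold sl, e, padd; cbn [dvec fst snd]. f_equal; lia.
           ++ apply in_ln in Hp as [t [Ht ->]]. intros Es. specialize (BY s). pose proof (HD s) as Hs. rewrite <- Es in BY, Hs.
              unfold sl in BY, Hs; cbn [dvec fst snd] in BY, Hs. lia.
        -- unfold ln at 1. simpl. rewrite !sl_0. unfold ln. rewrite seg_cons by lia. simpl. 
           unfold sl, e, padd; cbn [dvec fst snd]. f_equal; lia.
      * left. intros i t _. unfold e, padd; cbn [fst]. specialize (HD i). lia.
    (* The ray is confined to a vertical strip and bounded from below, so it goes infinitely far
       north; the westernmost vertex of a visited row sees infinity to the west. *)
    + apply not_all_ex_not in HX as [X HX].
      assert (BX : forall i, (X <= fst (r i))%Z).
      { intros i. destruct (Z.lt_ge_cases (fst (r i)) X); auto. exfalso. apply HX. exists i; auto. }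
      destruct (@not_low_bound r (X - 1) (Z.to_nat (n + 1 - X))) with (Y0 := snd (r kb)) as [Y [LY BY']]; [intros; apply NL|].
      assert (BY : forall i, (Y <= snd (r i))%Z).
      { intros i. apply BY'. specialize (BX i). specialize (HD i). lia. }
      set (e := fun t : nat => (-1 - Z.of_nat t, 0)%Z : Point).
      apply visible_periodic with kb n e (fun i => forall j, snd (r j) = snd (r i) -> (fst (r i) <= fst (r j))%Z); auto.
      * intros t. exists DW. unfold e, step, padd; cbn [dvec fst snd]; f_equal; lia.
      * intros t t' E. unfold e in E. pose proof (f_equal fst E). pose proof (f_equal snd E). cbn [fst snd] in *. lia.
      * exists DW. reflexivity.
      * intros N.
        assert (exists Z0, forall i, i < N -> (snd (r i) <= Z0)%Z) as [Z0 BZ].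
        { clear. induction N as [|N [X B]]; [exists 0%Z; intros; lia|].
          exists (Z.max X (snd (r N))). intros i Hi. destruct (Nat.eq_dec i N) as [->|]; [lia|]. specialize (B i). lia. }
        destruct (box_list (Z.abs X + Z.abs n + Z.abs Y + Z.abs Z0)) as [L HL2].
        destruct (inj_leaves r L R2 0) as [i0 [_ Hi0]].
        assert (Hy : (Z0 < snd (r i0))%Z).
        { destruct (Z.lt_ge_cases Z0 (snd (r i0))); auto. exfalso. apply Hi0, HL2; specialize (BX i0); specialize (BY i0); specialize (HD i0); lia. }
        destruct (@z_max (fun v => exists i, snd (r i) = snd (r i0) /\ (- v)%Z = fst (r i)) (- X)) as [v [[i [E1 E2]] Hv]].
        { intros v [i [E1 E2]]. specialize (BX i). lia. }
        { exists (- fst (r i0))%Z, i0. split; auto; lia. }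
        exists i. split.
        -- destruct (Nat.le_gt_cases N i); auto. specialize (BZ i). lia.
        -- intros j Ej. assert (- fst (r j) <= v)%Z; [|lia]. apply Hv. exists j. split; [congruence|lia].
      * intros i Hi Li.
        assert (V : forall t s, padd (r i) (e t) <> r s).
        { intros t s E. pose proof (Hi s) as Hs. unfold e in E. rewrite <- E in Hs. unfold padd in Hs; cbn [fst snd] in Hs. lia. }
        split; auto. pose proof (HD i). pose proof (BX i). pose proof (BY i).
        (* West to the column [X - 1], south to the row [Y - 1], both free of [r], then [n + 2 - X]
           steps east to the column [n + 1]. Only the first vertex is shared with [e]. *)
        set (a := Z.to_nat (fst (r i) - X + 1)). set (b := Z.to_nat (snd (r i) - Y + 1)). 
        replace (padd (r i) (e 0)) with (hd (r i) (ln (r i) DW a ++ ln (sl (r i) DW a) DS b ++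
         ln (sl (sl (r i) DW a) DS b) DE (Z.to_nat (n + 2 - X)))).
        -- apply visible_left with kb n; auto; try lia.
           intros p s Hp. apply in_app_or in Hp as [Hp|Hp]; [|apply in_app_or in Hp as [Hp|Hp]];
             apply in_ln in Hp as [t [Ht ->]].
           ++ replace (sl (r i) DW t) with (padd (r i) (e (t - 1))); [apply V|].
              unfold sl, e, padd; cbn [dvec fst snd]. f_equal; lia.
           ++ intros Es. specialize (BX s). rewrite <- Es in BX. unfold sl in BX; cbn [dvec fst snd] in BX. lia.
           ++ intros Es. specialize (BY s). rewrite <- Es in BY. unfold sl in BY; cbn [dvec fst snd] in BY. lia.
        -- unfold ln at 1. rewrite seg_cons by lia. simpl. unfold sl, e, padd; cbn [dvec fst snd]. f_equal; lia.
      * left. intros i t _. unfold e, padd; cbn [fst]. specialize (HD i). lia.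
Qed.

End Sys.

Section Sys.
Context {SS : Sys}.

(** * Excursions behind a column *)

(* [f] reaches the column [n] for the first time at [f m], stays in [x <= n], and leaves it eastwards
   at [f (m + T)], below [f m] if [sg] and above it otherwise. *)
Definition excursion (sg : bool) (n : Z) (m T : nat) (f : nat -> Point) : Prop :=
  1 <= m /\ fst (f m) = n /\ (forall i, i < m -> (fst (f i) < n)%Z) /\ 1 <= T /\ fpath f (m + T) /\
  (forall t, t <= T -> (fst (f (m + t)%nat) <= n)%Z) /\ fst (f (m + T)) = n /\
  (if sg then (snd (f (m + T)%nat) < snd (f m))%Z else (snd (f m) < snd (f (m + T)%nat))%Z) /\
  (forall s, f (m + T + s) = sl (f (m + T)) DE s).

(* [f (m - 1)] lies inside the curve below, and hence so does the origin. *)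
Definition turns (sg : bool) (m : nat) (f : nat -> Point) : Prop :=
  if sg then Left DE (dirof (f m) (f (m + 1))) (dirof (f m) (f (m - 1)))
  else Right DE (dirof (f m) (f (m + 1))) (dirof (f m) (f (m - 1))).

(* The excursion closed by a piece of the column [n + 1]. *)
Definition curve (sg : bool) (m T : nat) (f : nat -> Point) : list Point :=
  seg f m (m + T) ++ step (f (m + T)) DE ::
    ln (step (f (m + T)) DE) (if sg then DN else DS) (Z.to_nat (Z.abs (snd (f m) - snd (f (m + T)%nat)))).

Lemma in_curve sg n m T f p : excursion sg n m T f -> In p (curve sg m T f) ->
  (exists t, t <= T /\ p = f (m + t)) \/ fst p = (n + 1)%Z.
Proof.
  intros [M [Fm [Fi [LT [P [FT [En [Sg Ex]]]]]]]] H. unfold curve in H. apply in_app_or in H as [H|[<-|H]].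
  - apply in_seg in H as [t [Ht ->]]. left. exists (t - m). split; [lia|f_equal; lia].
  - right. unfold step, padd; cbn [dvec fst snd]. lia.
  - right. apply in_ln in H as [t [Ht ->]]. unfold sl, step, padd; destruct sg; cbn [dvec fst snd]; lia.
Qed.

Lemma curve_in sg m T f t : t <= T -> In (f (m + t)) (curve sg m T f).
Proof. intros H. apply in_or_app. left. apply in_seg. exists (m + t). split; auto; lia. Qed.

Lemma curve_simple sg n m T f : excursion sg n m T f ->
  cl (curve sg m T f) = curve sg m T f ++ [f m] /\ Simple (curve sg m T f) /\
  (forall v, v < T -> stp (cl (curve sg m T f)) (f (m + v)) (f (m + v + 1))) /\
  stp (cl (curve sg m T f)) (f (m + T)) (f (m + T + 1)) /\
  stp (cl (curve sg m T f)) (step (f m) DE) (f m) /\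
  stp (cl (curve sg m T f)) (step (step (f m) DE) (if sg then DS else DN)) (step (f m) DE).
Proof.
  intros [M [Fm [Fi [LT [P [FT [En [Sg Ex]]]]]]]].
  set (d := if sg then DN else DS). set (q := step (f (m + T)) DE).
  set (hh := Z.to_nat (Z.abs (snd (f m) - snd (f (m + T)%nat)))).
  assert (Hh : 1 <= hh) by (unfold hh; destruct sg; lia).
  assert (Vx : forall t, fst (sl q d t) = (n + 1)%Z).
  { intros t. unfold sl, q, d, step, padd; destruct sg; cbn [dvec fst snd]; lia. }
  assert (Vl : last (ln q d hh) q = step (f m) DE).
  { rewrite ln_last. unfold sl, q, d, hh, step, padd; destruct sg; cbn [dvec fst snd]; f_equal; lia. }
  destruct P as [P0 [P1 P2]].
  assert (E1 : f (m + T + 1) = q).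
  { rewrite Ex. unfold q. rewrite sl_S, sl_0. reflexivity. }
  destruct (@closed_simple f m (m + T) (q :: ln q d hh)) as [E SC].
  - lia.
  - intros i j Hi Hj. apply P2; lia.
  - intros t H1 H2. apply Bd_adj, P1. lia.
  - rewrite ln_seg. apply seg_NoDup. intros i j; apply sl_inj.
  - intros p t Hp Ht Ep. rewrite ln_seg in Hp. apply in_seg in Hp as [s [_ ->]].
    pose proof (Vx s). rewrite Ep in H. specialize (FT (t - m)). replace (m + (t - m)) with t in FT by lia.
    specialize (FT ltac:(lia)). lia.
  - split; [exists DE; reflexivity|apply ln_chain].
  - rewrite last_cons, Vl. apply adj_sym. exists DE. reflexivity.
  - unfold ln, seg. cbn [length]. rewrite length_map, length_seq. lia.
  - fold (curve sg m T f) in E, SC. unfold curve. fold d q hh.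
    change (seg f m (m + T) ++ q :: ln q d hh) with (curve sg m T f). 
    destruct (@stp_close f m (m + T) (q :: ln q d hh)) as [S1 [S2 S3]]; [lia|exact E|].
    change (seg f m (m + T) ++ q :: ln q d hh) with (curve sg m T f) in E, SC, S1, S2, S3.
    rewrite last_cons, Vl in S3.
    split; [|split; [auto|split; [|split; [|split; [auto|]]]]].
    + rewrite E. unfold curve. fold d q hh. now rewrite <- app_assoc.
    + intros v Hv. rewrite Nat.add_1_r. apply S1; lia.
    + rewrite E1. exact S2.
    + rewrite E. apply stp_r. change ((q :: ln q d hh) ++ [f m]) with (q :: ln q d hh ++ [f m]).
      change (q :: ln q d hh ++ [f m]) with ((q :: ln q d hh) ++ [f m]). apply stp_l. rewrite ln_seg.
      replace (step (f m) DE) with (sl q d (S (hh - 1))).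
      * replace (step (sl q d (S (hh - 1))) (if sg then DS else DN)) with (sl q d (hh - 1)).
        -- apply stp_seg; lia.
        -- rewrite sl_S. unfold d. destruct sg; symmetry; [apply (step_opp _ DN)|apply (step_opp _ DS)].
      * replace (S (hh - 1)) with hh by lia. now rewrite <- Vl, ln_last.
Qed.

(** The orientation is read at the eastern neighbour of [f m]: the square to its east is outside,
    and the curve comes from the south if [sg] and from the north otherwise. *)
Lemma curve_sides sg n m T f : excursion sg n m T f -> forall u p v,
  stp (cl (curve sg m T f)) u p -> stp (cl (curve sg m T f)) p v ->
  u <> v /\ wnd (curve sg m T f) (F p (dirof p v)) = side sg /\
  (forall d, Left (dirof p u) (dirof p v) d -> wnd (curve sg m T f) (F p d) = side sg) /\
  (forall d, Right (dirof p u) (dirof p v) d -> wnd (curve sg m T f) (F p d) = (side sg - 1)%Z).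
Proof.
  intros H. destruct (curve_simple H) as [_ [SC [_ [_ [S3 S4]]]]].
  destruct (simple_sides SC) as [k [Hk K]]. assert (k = side sg); [|now subst k].
  destruct (K _ _ _ S4 S3) as [_ [_ [KL KR]]].
  assert (W : wnd (curve sg m T f) (F (step (f m) DE) DE) = 0%Z).
  { apply wnd_far_max; [apply SC|]. intros p Hp. pose proof H as [M [Fm [Fi [LT [P [FT _]]]]]].
    unfold F, step, padd; cbn [dvec fst snd]. destruct (in_curve p H Hp) as [[t [Ht ->]]|Hx]; [|lia].
    specialize (FT t Ht). lia. }
  assert (D1 : dirof (step (f m) DE) (f m) = DW).
  { rewrite <- (step_opp (f m) DE) at 2. apply dirof_step. }
  rewrite D1 in *. destruct sg; cbn [side].
  - rewrite dirof_step in *. rewrite KR in W; [lia|]. unfold Right; cbn; lia.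
  - rewrite dirof_step in *. rewrite KL in W; [lia|]. unfold Left; cbn; lia.
Qed.

Lemma prefix_off sg n m T f i : excursion sg n m T f -> i < m -> ~ In (f i) (curve sg m T f).
Proof.
  intros H L I. pose proof H as [M [Fm [Fi [LT [[_ [_ P2]] [FT _]]]]]].
  destruct (in_curve _ H I) as [[t [Ht E]]|E].
  - apply P2 in E; lia.
  - specialize (Fi i L). lia.
Qed.

Lemma prefix_wnd sg n m T f i : excursion sg n m T f -> i < m ->
  wnd (curve sg m T f) (f i) = wnd (curve sg m T f) (F (f m) (dirof (f m) (f (m - 1)))).
Proof.
  intros H L. destruct (curve_simple H) as [_ [SC _]]. pose proof H as [M [Fm [Fi [LT [[P0 [P1 P2]] _]]]]].
  rewrite face_to; [|apply SC| |apply prefix_off with n; auto; lia].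
  2:{ apply adj_sym. replace m with (S (m - 1)) at 2 by lia. apply Bd_adj, P1. lia. }
  replace (m - 1) with (i + (m - 1 - i)) by lia.
  symmetry. transitivity (wnd (curve sg m T f) (f (i + 0))); [|now rewrite Nat.add_0_r].
  apply (wv_seq (curve sg m T f) (fun t => f (i + t)) (n := m - 1 - i)).
  - apply SC.
  - intros t Ht. rewrite Nat.add_succ_r. apply Bd_adj, P1. lia.
  - intros t Ht. apply prefix_off with n; auto. lia.
Qed.

(** The part of [f] before [m] does not meet the curve, so the origin has the winding number of
    [f (m - 1)]. Whether the curve encloses the origin is thus decided by the turn at [f m]
    alone. *)
Lemma side_turn sg n m T f : excursion sg n m T f ->
  (turns sg m f <-> wnd (curve sg m T f) org = if sg then 1%Z else (-1)%Z) /\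
  (wnd (curve sg m T f) org <> 0%Z -> turns sg m f).
Proof.
  intros H. destruct (curve_simple H) as [_ [SC [S1 [_ [S3 S4]]]]]. 
  pose proof H as [M [Fm [Fi [LT [[P0 [P1 P2]] [FT _]]]]]].
  specialize (S1 0 ltac:(lia)). rewrite Nat.add_0_r in S1.
  destruct (curve_sides H S3 S1) as [Nab [_ [KL KR]]]. rewrite dirof_step in *.
  assert (W : wnd (curve sg m T f) org = wnd (curve sg m T f) (F (f m) (dirof (f m) (f (m - 1))))).
  { rewrite <- P0. now apply prefix_wnd with n. }
  assert (A1 : adj (f m) (f (m + 1))) by (rewrite Nat.add_1_r; apply Bd_adj, P1; lia).
  assert (A0 : adj (f m) (f (m - 1))).
  { apply adj_sym. replace m with (S (m - 1)) at 2 by lia. apply Bd_adj, P1. lia. }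
  assert (N1 : DE <> dirof (f m) (f (m + 1))).
  { intros E. apply Nab. rewrite E. now apply step_dirof. }
  assert (N2 : dirof (f m) (f (m - 1)) <> DE).
  { intros E. apply step_dirof in A0. rewrite E in A0. specialize (Fi (m - 1) ltac:(lia)). rewrite <- A0 in Fi.
    unfold step, padd in Fi; cbn [dvec fst snd] in Fi. lia. }
  assert (N3 : dirof (f m) (f (m - 1)) <> dirof (f m) (f (m + 1))).
  { intros E. apply (dirof_inj A0 A1) in E. apply P2 in E; lia. }
  rewrite W. unfold turns.
  assert (X : forall i o d, Left i o d -> Right i o d -> False) by (unfold Left, Right; intros; lia).
  destruct (left_or_right N1 N2 N3) as [Q|Q]; [rewrite (KL _ Q)|rewrite (KR _ Q)]; destruct sg; cbn [side].
  - tauto.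
  - split; [split; intros Q'; [destruct (X _ _ _ Q Q')|lia]|lia].
  - split; [split; intros Q'; [destruct (X _ _ _ Q' Q)|lia]|lia].
  - tauto.
Qed.

(* The excursion goes around the origin. *)
Lemma excursion_width n m T f : excursion true n m T f -> turns true m f -> (n <= Z.of_nat T)%Z.
Proof.
  intros H Ht. destruct (side_turn H) as [[W _] _]. specialize (W Ht).
  pose proof H as [M [Fm [Fi [LT [[P0 [P1 P2]] [FT _]]]]]].
  assert (Hn : (0 < n)%Z). { specialize (Fi 0 ltac:(lia)). rewrite P0 in Fi. exact Fi. }
  destruct (classic (exists p, In p (curve true m T f) /\ (fst p <= 0)%Z)) as [[p [Ip Lp]]|N].
  - destruct (in_curve _ H Ip) as [[t [Lt ->]]|E]; [|lia].
    assert (B : forall t, t <= T -> (n - Z.of_nat t <= fst (f (m + t)%nat))%Z).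
    { clear Ip Lp Lt t. induction t; intros Lt; [rewrite Nat.add_0_r; lia|].
      specialize (IHt ltac:(lia)). specialize (P1 (m + t) ltac:(lia)). apply Bd_adj in P1 as [d Ed].
      rewrite Nat.add_succ_r, Ed. unfold step, padd; destruct d; cbn [dvec fst snd]; lia. }
    specialize (B t Lt). lia.
  - rewrite wnd_far_x in W; [discriminate|]. intros p Hp. cbn.
    destruct (Z.lt_ge_cases 0 (fst p)); auto. exfalso. apply N. exists p; auto.
Qed.

Lemma excursion_ext sg n m T f g : excursion sg n m T f -> (forall i, i <= m + T -> g i = f i) ->
  (forall s, g (m + T + s) = sl (f (m + T)) DE s) -> excursion sg n m T g.
Proof.
  intros [M [Fm [Fi [LT [P [FT [En [Sg Ex]]]]]]]] E Es.
  split; [auto|]. split; [rewrite E; auto; lia|]. split; [intros i Hi; rewrite E; auto; lia|].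
  split; [auto|]. split; [now apply fpath_ext with f|]. split; [intros t Ht; rewrite E; auto; lia|].
  split; [rewrite E; auto|]. split; [rewrite !E by lia; auto|]. intros s. rewrite Es, E; auto.
Qed.

Lemma exit_time sg n m T f i : excursion sg n m T f -> (n < fst (f i))%Z <-> m + T < i.
Proof.
  intros [M [Fm [Fi [LT [P [FT [En [Sg Ex]]]]]]]]. split; intros H.
  - destruct (Nat.lt_ge_cases (m + T) i); auto. exfalso. destruct (Nat.lt_ge_cases i m).
    + specialize (Fi i ltac:(auto)). lia.
    + specialize (FT (i - m) ltac:(lia)). replace (m + (i - m)) with i in FT by lia. lia.
  - replace i with (m + T + (i - (m + T))) by lia. rewrite Ex. unfold sl; cbn [dvec fst snd]. lia.
Qed.

Definition enclosing n m T f := excursion true n m T f /\ turns true m f.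

(* The rightmost ones among the enclosing excursions with the same start. *)
Definition optimal n m T f := enclosing n m T f /\ forall g T' t, enclosing n m T' g -> m + 1 <= t ->
  (forall i, i <= t -> g i = f i) -> ~ betterP false (f (t - 1)) (f t) (f (t + 1)) (g (t + 1)).

(** The rightmost limit either never leaves the half-plane, and is a ray to which
    [halfplane_periodic] applies, or it leaves; then all approximations that agree with it long
    enough leave at the same time, and the limit is itself an excursion. *)
Lemma loop_optimal n m T f0 : enclosing n m T f0 ->
  (exists r, isray r /\ rayper r) \/ exists T' f, optimal n m T' f.
Proof.
  intros H0. pose proof H0 as [[M0 [Fm0 _]] Tn0].
  destruct (@greedy false (fun g => (forall i, i <= m + 1 -> g i = f0 i) /\
     ((isray g /\ forall i, (fst (g i) <= n)%Z) \/ exists T, enclosing n m T g)) f0 (m + 1)) as [R [E [C O]]].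
  { lia. }
  { split; auto. right. exists T; auto. }
  destruct (classic (forall i, (fst (R i) <= n)%Z)) as [HD|HD].
  - left. apply halfplane_periodic with R m n; auto.
    + apply isray_fpath. intros N. destruct (C (N + m)) as [z [[_ [[Rz _]|[Tz [Lz _]]]] Ez]].
      * apply fpath_ext with z; [intros; apply Ez; lia|]. now apply isray_fpath.
      * apply fpath_ext with z; [intros; apply Ez; lia|].
        destruct (Nat.lt_ge_cases (m + Tz) (N + m)) as [L|L].
        -- apply (exit_time _ Lz) in L. rewrite <- Ez in L by lia. specialize (HD (N + m)). lia.
        -- apply fpath_le with (m + Tz); [lia|]. apply Lz.
    + rewrite E by lia. auto.
  - right. apply not_all_ex_not in HD as [i Hi].
    assert (Key : forall N, i <= N -> exists z Tz, enclosing n m Tz z /\ (forall j, j <= N -> R j = z j) /\ m + Tz < i).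
    { intros N HN. destruct (C N) as [z [[_ [[_ Dz]|[Tz Lz]]] Ez]].
      - exfalso. apply Hi. rewrite Ez by auto. apply Dz.
      - exists z, Tz. split; auto. split; auto. apply (exit_time _ (proj1 Lz)). rewrite <- Ez by auto. lia. }
    destruct (Key i (le_n _)) as [z [Tz [Lz [Ez Li]]]].
    assert (EX : excursion true n m Tz R).
    { apply excursion_ext with z; [apply Lz|intros; apply Ez; lia|]. intros s.
      destruct (Key (i + m + Tz + s)) as [z' [Tz' [Lz' [Ez' Li']]]]; [lia|].
      assert (Tz' = Tz) as ->.
      { pose proof (exit_time (m + Tz + 1) (proj1 Lz)) as [_ X1]. pose proof (exit_time (m + Tz + 1) (proj1 Lz')) as [X2 _].
        pose proof (exit_time (m + Tz' + 1) (proj1 Lz')) as [_ X3]. pose proof (exit_time (m + Tz' + 1) (proj1 Lz)) as [X4 _].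
        rewrite <- Ez in X1, X4 by lia. rewrite <- Ez' in X2, X3 by lia.
        specialize (X2 (X1 ltac:(lia))). specialize (X4 (X3 ltac:(lia))). lia. }
      rewrite Ez' by lia. destruct Lz' as [[_ [_ [_ [_ [_ [_ [_ [_ Ex]]]]]]]] _]. rewrite Ex. 
      rewrite <- Ez' by lia. rewrite Ez by lia. reflexivity. }
    exists Tz, R. split; [split; auto|].
    + unfold turns in *. rewrite !E by lia. exact Tn0.
    + intros g T' t Lg Ht Eg. apply O; auto. split; [|right; exists T'; auto].
      intros j Hj. rewrite Eg by lia. apply E. lia.
Qed.

(* The translate of [f'] leaves [f] towards the outside of the curve of [f]. It then either returns to [f]
   or completes an excursion, and both contradict the optimality of [f]. *)
Lemma optimal_half n m T f n' m' T' f' v : optimal n m T f -> enclosing n' m' T' f' -> al (f m) = al (f' m') -> 1 <= v ->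
  (forall t, t <= v -> f (m + t) = padd (f' (m' + t)) (psub (f m) (f' m'))) ->
  ~ betterP false (f (m + v - 1)) (f (m + v)) (f (m + v + 1)) (padd (f' (m' + v + 1)) (psub (f m) (f' m'))).
Proof.
  intros [[H Tn] O] [H' Tn'] EA Lv Com B.
  pose proof H as [M [Fm [Fi [LT [P [FT [En [Sg Ex]]]]]]]].
  pose proof H' as [M' [Fm' [Fi' [LT' [P' [FT' [En' [Sg' Ex']]]]]]]].
  pose proof P as [P0 [P1 P2]]. pose proof P' as [P0' [P1' P2']].
  set (w := psub (f m) (f' m')) in *.
  set (X := fun t => padd (f' (m' + t)) w).
  assert (X0 : X 0 = f m) by (unfold X, w, psub; rewrite Nat.add_0_r; pts).
  assert (Fx : forall t, fst (X t) = (fst (f' (m' + t)%nat) - n' + n)%Z) by (intros t; unfold X, w, psub, padd; cbn [fst snd]; lia).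
  assert (Xs : forall s, X (T' + s) = sl (X T') DE s).
  { intros s. unfold X. rewrite Nat.add_assoc, Ex'. unfold sl, padd; cbn [dvec fst snd]. f_equal; lia. }
  (* Beyond the exit of [f'] the common part would be beyond the exit of [f] as well. Both then go
     straight east and could not separate. *)
  assert (LvT' : v <= T').
  { destruct (Nat.le_gt_cases v T') as [|Lc]; auto. exfalso.
    pose proof (proj2 (exit_time (m' + v) H')) as E1. specialize (E1 ltac:(lia)).
    pose proof (Fx v) as E2. unfold X in E2. rewrite <- Com in E2 by lia.
    pose proof (proj1 (exit_time (m + v) H)) as E3. specialize (E3 ltac:(lia)).
    assert (C1 : f (m + v + 1) = step (f (m + v)) DE).
    { replace (m + v + 1) with (m + T + S (v - T)) by lia. replace (m + v) with (m + T + (v - T)) by lia.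
      rewrite !Ex. apply sl_S. }
    assert (C2 : X (v + 1) = step (X v) DE).
    { replace (v + 1) with (T' + S (v - T')) by lia. replace v with (T' + (v - T')) at 2 by lia. rewrite !Xs. apply sl_S. }
    replace (m' + v + 1) with (m' + (v + 1)) in B by lia. fold (X (v + 1)) in B.
    rewrite C1, C2 in B. unfold X in B. rewrite <- Com in B by lia. clear - B. dirs. }
  assert (LvT : v <= T).
  { destruct (Nat.le_gt_cases v T) as [|Lc]; auto. exfalso.
    pose proof (proj2 (exit_time (m + v) H)) as E1. specialize (E1 ltac:(lia)).
    pose proof (Fx v) as E2. unfold X in E2. rewrite <- Com in E2 by lia.
    pose proof (proj1 (exit_time (m' + v) H')) as E3. specialize (E3 ltac:(lia)). lia. }
  assert (Xi : forall t t', t <= T' -> t' <= T' -> X t = X t' -> t = t').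
  { intros t t' L1 L2 Et. assert (m' + t = m' + t'); [|lia]. apply P2'; [lia|lia|]. unfold X in Et. pts. }
  assert (Xn : forall t, t <= T' -> (fst (X t) <= n)%Z).
  { intros t Lt. rewrite Fx. specialize (FT' t Lt). lia. }
  assert (ComX : forall t, t <= v -> X t = f (m + t)) by (intros t Lt; unfold X; rewrite Com; auto).
  replace (m' + v + 1) with (m' + (v + 1)) in B by lia. fold (X (v + 1)) in B.
  destruct (curve_simple H) as [_ [SC [S1 [S2 _]]]]. set (C := curve true m T f) in *.
  assert (AX : forall t, adj (X t) (X (S t))).
  { intros t. unfold X. apply adj_padd. destruct (Nat.lt_ge_cases t T').
    - rewrite Nat.add_succ_r. apply Bd_adj, P1'. lia.
    - replace (m' + S t) with (m' + T' + S (t - T')) by lia. replace (m' + t) with (m' + T' + (t - T')) by lia.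
      rewrite !Ex'. exists DE. apply sl_S. }
  assert (XW : ~ In (X (v + 1)) C -> wnd C (X (v + 1)) = 0%Z).
  { intros Nx.
    assert (Q1 : stp (cl C) (f (m + v - 1)) (f (m + v))).
    { replace (m + v) with (m + (v - 1) + 1) at 2 by lia. replace (m + v - 1) with (m + (v - 1)) by lia. apply S1. lia. }
    assert (Q2 : stp (cl C) (f (m + v)) (f (m + v + 1))).
    { destruct (Nat.eq_dec v T) as [->|]; [auto|apply S1; lia]. }
    destruct (curve_sides H Q1 Q2) as [_ [_ [_ KR]]].
    rewrite <- (face_to (p := f (m + v)) (x := X (v + 1)) C); [|apply SC| |auto].
    - change (0%Z) with (side true - 1)%Z. apply KR. 
      apply stp_in in Q1, Q2.
      assert (Dn1 : dirof (f (m + v)) (f (m + v - 1)) <> dirof (f (m + v)) (f (m + v + 1))).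
      {
        intros E. apply dirof_inj in E.
        - assert (L1 : (fst (f (m + v - 1)%nat) <= n)%Z) by (replace (m + v - 1) with (m + (v - 1)) by lia; apply FT; lia).
          destruct (Nat.eq_dec v T) as [->|].
          + rewrite E, Ex in L1. unfold sl in L1; cbn [dvec fst snd] in L1. lia.
          + apply P2 in E; lia.
        - apply adj_sym. replace (m + v) with (S (m + v - 1)) at 2 by lia. apply Bd_adj, P1. lia.
        - destruct (Nat.eq_dec v T) as [->|].
          + rewrite Ex. exists DE. rewrite sl_S, sl_0. reflexivity.
          + rewrite Nat.add_1_r. apply Bd_adj, P1. lia. }
      clear - B Dn1. dirs.
    - rewrite <- ComX by lia. rewrite Nat.add_1_r. apply AX. }
  destruct (@nat_min (fun u => v + 1 <= u /\ (In (X u) C \/ T' < u))) as [u [[Lu Hu] Mu]].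
  { exists (T' + 1). split; [lia|right; lia]. }
  assert (Nu : forall t, v < t -> t < u -> ~ In (X t) C /\ t <= T').
  { intros t L1 L2. split.
    - intros I. assert (u <= t); [|lia]. apply Mu. split; auto. lia.
    - destruct (Nat.le_gt_cases t T'); auto. assert (u <= t); [|lia]. apply Mu. split; auto. lia. }
  assert (Wu : forall t, v < t -> t < u -> wnd C (X t) = 0%Z).
  { intros t L1 L2. rewrite <- XW by (apply Nu; lia). replace t with (v + 1 + (t - (v + 1))) by lia.
    transitivity (wnd C (X (v + 1 + 0))); [|now rewrite Nat.add_0_r]. apply (wv_seq C (fun s => X (v + 1 + s)) (n := t - (v + 1))).
    - apply SC.
    - intros s Hs. replace (v + 1 + S s) with (S (v + 1 + s)) by lia. apply AX.
    - intros s Hs. apply Nu; lia. }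
  (* The start of [f] before [m] has winding number 1 with respect to the curve, whereas the
     translate is outside after the separation, so the two cannot meet. *)
  assert (NP : forall t i, 1 <= t -> t < u -> i <= m -> X t <> f i).
  { intros t i L1 L2 L3 E. destruct (Nat.le_gt_cases t v) as [L4|L4].
    - rewrite ComX in E by auto. apply P2 in E; lia.
    - destruct (Nu t L4 L2) as [N1 _]. destruct (Nat.eq_dec i m) as [->|].
      + apply N1. rewrite E. rewrite <- (Nat.add_0_r m) at 1. apply curve_in. lia.
      + pose proof (Wu t L4 L2) as W. rewrite E in W. unfold C in W.
        rewrite (prefix_wnd H) in W by lia.
        destruct (side_turn H) as [[W' _] _]. specialize (W' Tn). rewrite <- P0 in W'. rewrite (prefix_wnd H) in W' by lia.
        lia. }
  assert (HG : forall K, K <= T' -> (forall t i, 1 <= t -> t <= K -> i <= m -> X t <> f i) ->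
     fpath (cut f m X) (m + K) /\ (forall k, k < K -> Bd (X k) (X (S k)))).
  { intros K LK HK.
    destruct (@grow _ f m (fun t => f' (m' + t)) X w K) as [G1 [_ G2]]; auto.
    - apply fpath_le with (m + T); auto. lia.
    - now rewrite Nat.add_0_r.
    - intros k Hk. rewrite Nat.add_succ_r. apply P1'. lia.
    - intros k k' L1 L2 E. apply P2' in E; lia. }
  destruct (Nat.le_gt_cases u T') as [LuT|LuT].
  - destruct Hu as [Iu|]; [|lia].
    destruct (in_curve _ H Iu) as [[s [Ls Es]]|Es]; [|specialize (Xn u LuT); lia].
    assert (Lvs : v < s).
    { destruct (Nat.lt_ge_cases v s); auto. exfalso. rewrite <- ComX in Es by lia. apply Xi in Es; lia. }
    assert (NPu : forall t i, 1 <= t -> t <= u -> i <= m -> X t <> f i).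
    { intros t i L1 L2 L3. destruct (Nat.eq_dec t u) as [->|]; [|apply NP; lia]. rewrite Es. intros E. apply P2 in E; lia. }
    destruct (HG u LuT NPu) as [G1 G2].
    (* First case: the translate returns to [f] at [s]. The splice of [f], the translate and the
       rest of [f] is an enclosing excursion that turns further right at [m + v]. *)
    set (g := fun t => if t <? m + u then cut f m X t else f (t - (m + u) + (m + s))).
    assert (g1 : forall t, t < m + u -> g t = cut f m X t).
    { intros t Lt. unfold g. destruct (Nat.ltb_spec t (m + u)); [auto|lia]. }
    assert (g2 : forall t, m + u <= t -> g t = f (t - (m + u) + (m + s))).
    { intros t Lt. unfold g. destruct (Nat.ltb_spec t (m + u)); [lia|auto]. }
    assert (gm : forall i, i <= m -> g i = f i).
    { intros i Li. rewrite g1 by lia. apply cut_le. lia. }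
    assert (gX : forall t, t <= u -> g (m + t) = X t).
    { intros t Lt. destruct (Nat.eq_dec t u) as [->|].
      - rewrite g2 by lia. rewrite Es. f_equal. lia.
      - rewrite g1 by lia. apply cut_add. auto. }
    assert (gv : forall i, i <= m + v -> g i = f i).
    { intros i Li. destruct (Nat.le_gt_cases i m); [now apply gm|]. replace i with (m + (i - m)) by lia.
      rewrite gX by lia. apply ComX. lia. }
    apply (O g (u + (T - s)) (m + v)); [|lia|auto|].
    + split.
      * split; [auto|]. split; [rewrite gm; auto|]. split; [intros i Hi; rewrite gm; auto; lia|]. split; [lia|].
        split; [|split; [|split; [|split]]].
        -- split; [rewrite gm; auto; lia|]. split.
           ++ intros i Hi. destruct (Nat.lt_ge_cases (S i) (m + u)).
              ** rewrite !g1 by lia. apply G1. lia.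
              ** destruct (Nat.eq_dec (S i) (m + u)) as [Ei|].
                 --- rewrite Ei, gX by lia. replace i with (m + (u - 1)) by lia. rewrite gX by lia.
                     replace u with (S (u - 1)) at 2 by lia. apply G2. lia.
                 --- rewrite !g2 by lia. replace (S i - (m + u) + (m + s)) with (S (i - (m + u) + (m + s))) by lia.
                     apply P1. lia.
           ++ assert (W : forall i j, i < m + u -> m + u <= j -> j <= m + (u + (T - s)) -> g i <> g j).
              { intros i j L1 L2 L3 E. rewrite (g2 j) in E by auto. destruct (Nat.le_gt_cases i (m + v)).
                - rewrite gv in E by auto. apply P2 in E; lia.
                - replace i with (m + (i - m)) in E by lia. rewrite gX in E by lia.
                  apply (proj1 (Nu (i - m) ltac:(lia) ltac:(lia))). rewrite E.
                  replace (j - (m + u) + (m + s)) with (m + (j - (m + u) + s)) by lia. apply curve_in. lia. }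
              intros i j Hi Hj E. destruct (Nat.lt_ge_cases i (m + u)), (Nat.lt_ge_cases j (m + u)).
              ** rewrite !g1 in E by auto. apply G1 in E; lia.
              ** exfalso. apply (W i j); auto.
              ** exfalso. apply (W j i); auto.
              ** rewrite !g2 in E by auto. apply P2 in E; lia.
        -- intros t Ht. destruct (Nat.le_gt_cases t u).
           ++ rewrite gX by auto. apply Xn. lia.
           ++ rewrite g2 by lia. replace (m + t - (m + u) + (m + s)) with (m + (t - u + s)) by lia. apply FT. lia.
        -- rewrite g2 by lia. rewrite <- En. do 2 f_equal. lia.
        -- rewrite (gm m) by lia. rewrite g2 by lia. replace (m + (u + (T - s)) - (m + u) + (m + s)) with (m + T) by lia. auto.
        -- intros s'. rewrite !g2 by lia. replace (m + (u + (T - s)) - (m + u) + (m + s)) with (m + T) by lia.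
           rewrite <- Ex. f_equal. lia.
      * unfold turns in *. rewrite !gv by lia. auto.
    + replace (m + v + 1) with (m + (v + 1)) at 2 by lia. rewrite gX by lia. exact B.
  (* Second case: the translate ends its own excursion without meeting the curve again, and serves
     as the better excursion. *)
  - assert (Lu2 : u = T' + 1).
    { assert (u <= T' + 1); [|lia]. apply Mu. split; [lia|right; lia]. }
    destruct (HG T') as [G1 G2]; [lia|intros t i L1 L2 L3; apply NP; lia|].
    set (g := cut f m X).
    assert (gm : forall i, i <= m -> g i = f i) by (intros; now apply cut_le).
    assert (gX : forall t, g (m + t) = X t) by (intros; now apply cut_add).
    assert (gv : forall i, i <= m + v -> g i = f i).
    { intros i Li. destruct (Nat.le_gt_cases i m); [now apply gm|]. replace i with (m + (i - m)) by lia.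
      rewrite gX by lia. apply ComX. lia. }
    apply (O g T' (m + v)); [|lia|auto|].
    + split.
      * split; [auto|]. split; [rewrite gm; auto|]. split; [intros i Hi; rewrite gm; auto; lia|]. split; [lia|].
        split; [exact G1|]. split; [intros t Ht; rewrite gX; now apply Xn|].
        split; [rewrite gX, Fx; lia|]. split.
        -- rewrite gX, gm by lia. unfold X, w, psub, padd; cbn [fst snd]. lia.
        -- intros s. rewrite gX. rewrite <- Nat.add_assoc, gX. apply Xs.
      * unfold turns in *. rewrite !gv by lia. auto.
    + replace (m + v + 1) with (m + (v + 1)) at 2 by lia. rewrite gX by lia. exact B.
Qed.

(** At a first separation one of the two would turn further right than the other, and [optimal_half]
    excludes this in both orders. So they are translates of each other and exit at the same time. *)
Lemma optimal_same n m T f n' m' T' f' : optimal n m T f -> optimal n' m' T' f' -> al (f m) = al (f' m') ->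
  dirof (f m) (f (m + 1)) = dirof (f' m') (f' (m' + 1)) ->
  T' <= T.
Proof.
  intros O O' EA ED. pose proof O as [[H Tn] _]. pose proof O' as [[H' Tn'] _].
  pose proof H as [M [Fm [Fi [LT [P [FT [En [Sg Ex]]]]]]]].
  pose proof H' as [M' [Fm' [Fi' [LT' [P' [FT' [En' [Sg' Ex']]]]]]]].
  pose proof P as [P0 [P1 P2]]. pose proof P' as [P0' [P1' P2']].
  set (w := psub (f m) (f' m')).
  assert (A1 : forall n m T f, excursion true n m T f -> forall i, adj (f i) (f (i + 1))).
  { clear. intros n m T f [M [Fm [Fi [LT [P [FT [En [Sg Ex]]]]]]]] i. destruct (Nat.lt_ge_cases i (m + T)).
    - rewrite Nat.add_1_r. apply Bd_adj, P. lia.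
    - replace (i + 1) with (m + T + S (i - (m + T))) by lia. replace i with (m + T + (i - (m + T))) at 1 by lia.
      rewrite !Ex. exists DE. apply sl_S. }
  assert (In1 : forall n m T f, excursion true n m T f -> forall i, 1 <= i -> f (i - 1) <> f (i + 1)).
  { clear. intros n m T f H i Hi. pose proof H as [M [Fm [Fi [LT [P [FT [En [Sg Ex]]]]]]]]. intros E.
    destruct (Nat.lt_ge_cases (m + T) (i + 1)) as [L|L].
    - destruct (Nat.lt_ge_cases (m + T) (i - 1)) as [L'|L'].
      + replace (i + 1) with (m + T + (i + 1 - (m + T))) in E by lia. replace (i - 1) with (m + T + (i - 1 - (m + T))) in E by lia.
        rewrite !Ex in E. apply sl_inj in E. lia.
      + apply (exit_time _ H) in L. rewrite <- E in L. apply (exit_time _ H) in L. lia.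
    - apply P in E; lia. }
  assert (All : forall t, f (m + t) = padd (f' (m' + t)) w).
  { apply NNPP. intros N. apply not_all_ex_not in N.
    destruct (nat_min _ N) as [u [Nu Mu]]. clear N.
    assert (Q : forall t, t < u -> f (m + t) = padd (f' (m' + t)) w).
    { intros t Lt. apply NNPP. intros C. apply Mu in C. lia. }
    assert (Q0 : f (m + 0) = padd (f' (m' + 0)) w) by (rewrite !Nat.add_0_r; unfold w, psub; pts).
    assert (Q1 : f (m + 1) = padd (f' (m' + 1)) w).
    { rewrite <- (step_dirof (A1 _ _ _ _ H m)), <- (step_dirof (A1 _ _ _ _ H' m')), ED. unfold w, psub. pts. }
    assert (Lu : 2 <= u) by (destruct u as [|[|u]]; [tauto|tauto|lia]).
    set (v := u - 1). assert (Eu : u = v + 1) by lia.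
    assert (Hin : dirof (f (m + v)) (f (m + v - 1)) = dirof (f' (m' + v)) (f' (m' + v - 1))).
    { replace (m + v - 1) with (m + (v - 1)) by lia. replace (m' + v - 1) with (m' + (v - 1)) by lia.
      rewrite !Q by lia. apply dirof_padd. }
    pose proof (A1 _ _ _ _ H (m + v)) as B1. pose proof (A1 _ _ _ _ H' (m' + v)) as B2.
    assert (Nd : dirof (f (m + v)) (f (m + v + 1)) <> dirof (f' (m' + v)) (f' (m' + v + 1))).
    { intros E. apply Nu. rewrite Eu, !Nat.add_assoc. rewrite <- (step_dirof B1), <- (step_dirof B2), E.
      rewrite Q by lia. pts. }
    assert (D1 : dirof (f (m + v)) (padd (f' (m' + v + 1)) w) = dirof (f' (m' + v)) (f' (m' + v + 1))).
    { rewrite Q by lia. apply dirof_padd. }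
    assert (D2 : dirof (f' (m' + v)) (padd (f (m + v + 1)) (psub (f' m') (f m))) = dirof (f (m + v)) (f (m + v + 1))).
    { replace (f' (m' + v)) with (padd (f (m + v)) (psub (f' m') (f m))); [apply dirof_padd|].
      rewrite Q by lia. unfold w, psub. pts. }
    assert (Np : forall n m T f, excursion true n m T f -> 1 <= m -> dirof (f (m + v)) (f (m + v - 1)) <> dirof (f (m + v)) (f (m + v + 1))).
    { clear - A1 In1. intros n m T f H Lm E. apply dirof_inj in E.
      - apply (In1 _ _ _ _ H (m + v)); auto. lia.
      - apply adj_sym. pose proof (A1 _ _ _ _ H (m + v - 1)) as Aq. now replace (m + v - 1 + 1) with (m + v) in Aq by lia.
      - apply (A1 _ _ _ _ H). }
    destruct (@better_total false (dirof (f (m + v)) (f (m + v - 1))) (dirof (f (m + v)) (f (m + v + 1)))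
       (dirof (f' (m' + v)) (f' (m' + v + 1)))) as [Bt|Bt].
    - apply (Np _ _ _ _ H M).
    - rewrite Hin. apply not_eq_sym. apply (Np _ _ _ _ H' M').
    - exact Nd.
    - apply (optimal_half O (proj1 O') EA (v := v)); [lia|intros t Lt; apply Q; lia|]. red. fold w. rewrite D1. exact Bt.
    - apply (optimal_half O' (proj1 O) (eq_sym EA) (v := v)); [lia| |].
      + intros t Lt. rewrite Q by lia. unfold w, psub. pts.
      + red. rewrite D2, <- Hin. exact Bt. }
  destruct (Nat.le_gt_cases T' T) as [|L]; auto. exfalso.
  pose proof (proj2 (exit_time (m + T + 1) H) ltac:(lia)) as E1.
  rewrite <- Nat.add_assoc, All in E1.
  assert (L2 : m' + T' < m' + (T + 1)); [|lia]. apply (exit_time _ H').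
  unfold w, psub, padd in E1; cbn [fst snd] in E1. lia.
Qed.

Theorem loops_periodic : (forall N : nat, exists n m T f, (Z.of_nat N <= n)%Z /\ enclosing n m T f) -> exists r, isray r /\ rayper r.
Proof.
  intros H. apply NNPP. intros NR.
  destruct (@pigeon _ (list_prod tls [DE; DN; DS; DW]) (fun N st => exists n m T f, (Z.of_nat N <= n)%Z /\ optimal n m T f /\
     al (f m) = Some (fst st) /\ dirof (f m) (f (m + 1)) = snd st)) as [st Hst].
  - intros N. destruct (H N) as [n [m [T [f [L Lf]]]]].
    destruct (loop_optimal Lf) as [C|[T' [g Og]]]; [tauto|].
    assert (Dm : dom (g m)).
    { destruct Og as [[[M [_ [_ [LT [P _]]]]] _] _]. apply (@Bd_dom _ (g m) (g (S m))). apply P. lia. }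
    red in Dm. destruct (al (g m)) as [t|] eqn:Et; [|congruence].
    exists N, (t, dirof (g m) (g (m + 1))). split; auto. split.
    + apply in_prod; [now apply al_tls in Et|]. destruct (dirof (g m) (g (m + 1))); simpl; auto.
    + exists n, m, T', g. auto.
  - destruct (Hst 0) as [_ [_ [n [m [T [f [_ [O [E1 E2]]]]]]]]].
    (* The second excursion is taken beyond the column [T]; its length is at least its column, hence
       more than [T], but [optimal_same] bounds it by [T]. *)
    destruct (Hst (S T)) as [N' [LN [n' [m' [T' [f' [L' [O' [E1' E2']]]]]]]]].
    assert (T' <= T) by (apply (optimal_same O O'); congruence).
    destruct O' as [[Ex' Tn'] _]. pose proof (excursion_width Ex' Tn'). lia.
Qed.

End Sys.

(** * Existence of excursions *)

(* Signed number of crossings of the ray that runs west from the face at the origin. *)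
Definition chi (l : list Point) : Z := sumw (dl org) l.

Lemma chi_far l : (forall p, In p l -> (0 < fst p)%Z) -> chi l = 0%Z.
Proof.
  intros H. unfold chi. rewrite <- (sumw_0 l). apply sumw_ext. intros p q S.
  apply stp_in in S as [S _]. apply H in S. unfold dl, org; cbn [fst snd]. repeat (eqbs; cbn [andb]); reflexivity.
Qed.

Lemma chi_app l1 p l2 : chi (l1 ++ p :: l2) = (chi (l1 ++ [p]) + chi (p :: l2))%Z.
Proof. apply sumw_app. Qed.

Lemma chi_app1 h l1 p l2 : chi (h :: l1 ++ p :: l2) = (chi (h :: l1 ++ [p]) + chi (p :: l2))%Z.
Proof. exact (chi_app (h :: l1) p l2). Qed.

Lemma chi_rev l : chi (rev l) = (- chi l)%Z.
Proof. apply sumw_rev. intros; apply dl_anti. Qed.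

Lemma chi_seg r a b c : a <= b -> b <= c -> chi (seg r a c) = (chi (seg r a b) + chi (seg r b c))%Z.
Proof.
  intros H1 H2. destruct (@seg_split r a b c) as [E| ->]; [lia|lia| |].
  - destruct (Nat.eq_dec a b) as [->|].
    + rewrite seg_one. unfold chi at 2. simpl sumw. lia.
    + rewrite E, (@seg_cons r b c) by lia. rewrite chi_app. do 2 f_equal.
      replace b with (S (b - 1)) at 2 3 by lia. rewrite seg_snoc by lia. reflexivity.
  - replace a with 0 by lia. rewrite seg_one. unfold chi at 2. simpl sumw. lia.
Qed.

Lemma map_nth_all (l : list Point) d : map (fun k => nth k l d) (seq 0 (length l)) = l.
Proof.
  induction l as [|p l IH]; [reflexivity|]. simpl. f_equal. rewrite <- IH at 2. rewrite <- seq_shift, map_map.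
  reflexivity.
Qed.

Definition ext (f : nat -> Point) (m : nat) (S : list Point) : nat -> Point :=
  cut f m (fun k => nth k (f m :: S) org).

Lemma ext_le f m l i : i <= m -> ext f m l i = f i.
Proof. apply cut_le. Qed.

Lemma ext_add f m l k : ext f m l (m + k) = nth k (f m :: l) org.
Proof. apply (@cut_add f m (fun k => nth k (f m :: l) org)). reflexivity. Qed.

Lemma ext_seg f m l : seg (ext f m l) m (m + length l) = f m :: l.
Proof.
  transitivity (map (fun k => nth k (f m :: l) org) (seq 0 (S (length l)))); [|exact (map_nth_all (f m :: l) org)].
  unfold seg. replace (S (m + length l) - m) with (S (length l)) by lia.
  generalize (S (length l)) as n. intros n.
  assert (G : forall a, map (ext f m l) (seq (m + a) n) = map (fun k => nth k (f m :: l) org) (seq a n)).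
  { induction n; intros a; [reflexivity|]. cbn [seq map]. rewrite ext_add. f_equal. rewrite <- Nat.add_succ_r. apply IHn. }
  specialize (G 0). now rewrite Nat.add_0_r in G.
Qed.

Lemma ext_in f m l i : m < i -> i <= m + length l -> In (ext f m l i) l.
Proof.
  intros H1 H2. replace i with (m + S (i - m - 1)) by lia. rewrite ext_add. simpl. apply nth_In. lia.
Qed.

Lemma ext_last f m l : ext f m l (m + length l) = last l (f m).
Proof.
  rewrite ext_add. destruct l as [|p l] using rev_ind; [reflexivity|].
  rewrite last_last, length_app. simpl. replace (length l + 1) with (S (length l)) by lia.
  rewrite app_nth2, Nat.sub_diag by lia. reflexivity.
Qed.

Section Sys.
Context {SS : Sys}.

Lemma ext_fpath f m l : fpath f m -> chain Bd (f m :: l) -> NoDup l -> (forall p i, In p l -> i <= m -> p <> f i) ->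
  fpath (ext f m l) (m + length l).
Proof.
  intros [P0 [P1 P2]] C N D. split; [rewrite ext_le; auto; lia|]. split.
  - intros i Hi. destruct (Nat.lt_ge_cases i m); [rewrite !ext_le by lia; auto|].
    rewrite chain_stp in C. apply C. rewrite <- ext_seg. apply stp_seg; lia.
  - assert (W : forall i j, i <= m -> m < j -> j <= m + length l -> ext f m l i <> ext f m l j).
    { intros i j L1 L2 L3. rewrite (ext_le f l L1). apply not_eq_sym. apply D; auto. now apply ext_in. }
    intros i j Hi Hj E. destruct (Nat.le_gt_cases i m), (Nat.le_gt_cases j m).
    + rewrite !ext_le in E by auto. now apply P2.
    + exfalso. apply (W i j); auto.
    + exfalso. apply (W j i); auto.
    + replace i with (m + (i - m)) in * by lia. replace j with (m + (j - m)) in * by lia. rewrite !ext_add in E.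
      f_equal. apply (proj1 (NoDup_nth (f m :: l) org)) in E; cbn [length]; auto; try lia.
      constructor; auto. intros I. now apply (D _ m I).
Qed.

(** The path is continued straight east to make it an excursion. As [N >= 1], the part that closes
    the curve is east of the origin and crosses nothing; the winding number of the curve is thus
    [chi (f m :: l)], and a non-zero value forces the turn. *)
Lemma arc_loop f m N l : fpath f m -> (1 <= N)%Z -> fst (f m) = N -> (forall i, i < m -> (fst (f i) < N)%Z) ->
  l <> [] -> chain Bd (f m :: l) -> NoDup l -> (forall p i, In p l -> i <= m -> p <> f i) ->
  (forall p, In p l -> (fst p <= N)%Z) -> fst (last l (f m)) = N -> chi (f m :: l) <> 0%Z ->
  exists sg T g, excursion sg N m T g /\ turns sg m g.
Proof.
  intros P LN Fm Fi Nl C ND D Fl En X. set (z := last l (f m)) in *.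
  assert (Ez : exists l0, l = l0 ++ [z]).
  { destruct (exists_last Nl) as [l0 [z' E]]. exists l0. unfold z. rewrite E, last_last. reflexivity. }
  set (T := length l). set (g := cut (ext f m l) (m + T) (sl z DE)).
  assert (G1 : forall i, i <= m + T -> g i = ext f m l i) by (intros; now apply cut_le).
  assert (Gz : ext f m l (m + T) = z) by apply ext_last.
  set (sg := Z.ltb (snd z) (snd (f m))).
  assert (LT : 1 <= T) by (unfold T; destruct l; [congruence|simpl; lia]).
  assert (Iz : In z l) by (destruct Ez as [l0 E]; rewrite E; apply in_or_app; simpl; auto).
  assert (M : 1 <= m).
  { destruct m; [|lia]. destruct P as [P0 _]. rewrite P0 in Fm. cbn in Fm. lia. }
  assert (H : excursion sg N m T g).
  { split; [auto|]. split; [rewrite G1, ext_le by lia; auto|]. split; [intros i Hi; rewrite G1, ext_le by lia; auto|].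
    split; [auto|]. split; [|split; [|split; [|split]]].
    - apply fpath_ext with (ext f m l); auto. now apply ext_fpath.
    - intros t Ht. rewrite G1 by lia. destruct (Nat.eq_dec t 0) as [->|].
      + rewrite Nat.add_0_r, ext_le by lia. lia.
      + apply Fl, ext_in; lia.
    - rewrite G1, Gz by lia. auto.
    - rewrite !G1, Gz, ext_le by lia. unfold sg. destruct (Z.ltb_spec (snd z) (snd (f m))); [auto|].
      assert (z <> f m) by (apply D; auto). destruct (Z.eq_dec (snd z) (snd (f m))); [|lia].
      exfalso. apply H0. apply pt_eq; congruence.
    - intros s. rewrite (G1 (m + T)), Gz by lia. unfold g. apply cut_add. rewrite sl_0. auto. }
  exists sg, T, g. split; auto. apply (side_turn H).
  destruct (curve_simple H) as [Ecl _].
  unfold wnd. rewrite Ecl. change (chi (curve sg m T g ++ [g m]) <> 0%Z). unfold curve.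
  assert (Es : seg g m (m + T) = f m :: l).
  { rewrite <- ext_seg. unfold seg. apply map_ext_in. intros i Hi. apply in_seq in Hi. apply G1. fold T in Hi. lia. }
  rewrite Es. rewrite <- app_assoc. destruct Ez as [l0 E]. rewrite E in *. 
  set (V := (step (g (m + T)) DE :: _) ++ [g m]).
  replace ((f m :: l0 ++ [z]) ++ V) with (f m :: l0 ++ z :: V) by (simpl; now rewrite <- app_assoc).
  rewrite chi_app1, (chi_far (z :: V)); [lia|].
  intros p [<-|Hp]; [lia|]. unfold V in Hp. apply in_app_or in Hp as [Hp|[<-|[]]]; [|rewrite G1, ext_le by lia; lia].
  assert (Ip : In p (curve sg m T g)) by (unfold curve; apply in_or_app; right; exact Hp).
  destruct (in_curve _ H Ip) as [[t [Ht ->]]|]; [|lia]. exfalso.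
  destruct Hp as [Hp|Hp].
  - apply (f_equal fst) in Hp. rewrite (G1 (m + T)), Gz in Hp by lia. unfold step, padd in Hp; cbn [dvec fst snd] in Hp.
    pose proof H as [_ [_ [_ [_ [_ [FT _]]]]]]. specialize (FT t Ht). lia.
  - apply in_ln in Hp as [s [_ Hp]]. apply (f_equal fst) in Hp. rewrite (G1 (m + T)), Gz in Hp by lia. unfold sl, step, padd in Hp.
    pose proof H as [_ [_ [_ [_ [_ [FT _]]]]]]. specialize (FT t Ht). destruct sg; cbn [dvec fst snd] in Hp; lia.
Qed.

Section NoLoops.
Variable n0 : Z.
Hypothesis Hn0 : (1 <= n0)%Z.
Hypothesis NL : forall n sg m T g, (n0 <= n)%Z -> excursion sg n m T g -> ~ turns sg m g.

(** Induction over the columns. The vertex just before the first visit of the next column lies in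
    the column [N]. Between the first visit of [N] and that vertex the path stays in [[x <= N]], so
    a non-zero crossing number would yield a forbidden excursion by [arc_loop]. *)
Lemma chi_first_visits k : forall f m tau, fpath f m -> fst (f m) = (n0 + Z.of_nat k)%Z ->
  (forall i, i < m -> (fst (f i) < n0 + Z.of_nat k)%Z) -> tau <= m -> fst (f tau) = n0 ->
  (forall i, i < tau -> (fst (f i) < n0)%Z) -> chi (seg f tau m) = 0%Z.
Proof.
  induction k as [|k IH]; intros f m tau P Fm Fi Lt Ft Fti.
  - assert (tau = m) as ->.
    { destruct (Nat.eq_dec tau m); auto. specialize (Fi tau ltac:(lia)). lia. }
    rewrite seg_one. reflexivity.
  - set (N := (n0 + Z.of_nat k)%Z) in *. pose proof P as [P0 [P1 P2]].
    assert (St : forall i, i < m -> (Z.abs (fst (f (S i)) - fst (f i)) <= 1)%Z).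
    { intros i Hi. specialize (P1 i Hi). apply Bd_adj in P1 as [d ->]. unfold step, padd; destruct d; cbn [dvec fst snd]; lia. }
    destruct (@nat_min (fun i => N <= fst (f i))%Z) as [m' [Hm' Mm']].
    { exists m. lia. }
    assert (Lm' : m' <= m) by (apply Mm'; lia).
    assert (Fi' : forall i, i < m' -> (fst (f i) < N)%Z).
    { intros i Hi. destruct (Z.lt_ge_cases (fst (f i)) N); auto. apply Mm' in H. lia. }
    assert (Fm' : fst (f m') = N).
    { destruct m' as [|m']; [rewrite P0 in *; cbn in *; lia|]. specialize (Fi' m' ltac:(lia)). specialize (St m' ltac:(lia)). lia. }
    assert (Lt' : tau <= m').
    { destruct (Nat.le_gt_cases tau m'); auto. specialize (Fti m' ltac:(auto)). lia. }
    assert (Lm : m' < m) by (destruct (Nat.eq_dec m' m) as [E|]; [rewrite E in Fm'; lia|lia]).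
    assert (Fm1 : fst (f (m - 1)) = N).
    { pose proof (St (m - 1) ltac:(lia)) as S1. replace (S (m - 1)) with m in S1 by lia. specialize (Fi (m - 1) ltac:(lia)). lia. }
    rewrite (@chi_seg f tau m' m), (IH f m' tau) by (auto; try lia; apply fpath_le with m; auto).
    rewrite (@chi_seg f m' (m - 1) m) by lia.
    assert (E2 : chi (seg f (m - 1) m) = 0%Z).
    { apply chi_far. intros p Hp. apply in_seg in Hp as [t [Ht ->]]. assert (t = m - 1 \/ t = m) as [-> | ->] by lia; lia. }
    rewrite E2. destruct (Nat.eq_dec m' (m - 1)) as [E|Ne]; [rewrite E, seg_one; reflexivity|].
    destruct (Z.eq_dec (chi (seg f m' (m - 1))) 0) as [->|X]; [reflexivity|]. exfalso.
    rewrite seg_cons in X by lia.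
    destruct (@arc_loop f m' N (seg f (S m') (m - 1))) as [sg [T [g [Hg Tg]]]]; auto.
    + apply fpath_le with m; auto.
    + lia.
    + rewrite seg_cons by lia. discriminate.
    + rewrite <- seg_cons by lia. apply seg_chain. intros t T1 T2. apply P1. lia.
    + unfold seg. apply NoDup_map_NoDup_ForallPairs; [|apply seq_NoDup]. intros i j Hi Hj. apply in_seq in Hi, Hj. apply P2; lia.
    + intros p i Hp Hi E. apply in_seg in Hp as [t [Ht ->]]. apply P2 in E; lia.
    + intros p Hp. apply in_seg in Hp as [t [Ht ->]]. specialize (Fi t ltac:(lia)). lia.
    + replace (m - 1) with (S (m - 2)) by lia. rewrite seg_snoc by lia. rewrite last_last.
      replace (S (m - 2)) with (m - 1) by lia. auto.
    + apply (@NL N sg m' T g); auto. lia.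
Qed.

End NoLoops.

(** A closed walk with a repeated vertex splits there into two shorter ones whose winding numbers
    add up, so one of them still winds around the origin. Walks of at most two points have winding
    number 0. *)
Lemma simple_cycle_ind k : forall c, length c <= k -> chain Bd (cl c) -> wnd c org <> 0%Z ->
  exists c', Simple c' /\ chain Bd (cl c') /\ incl c' c /\ wnd c' org <> 0%Z.
Proof.
  induction k as [|k IH]; intros c L C W.
  { destruct c; [exfalso; apply W; reflexivity|simpl in L; lia]. }
  destruct (classic (NoDup c)) as [N|N].
  - exists c. split; [|split; [auto|split; [apply incl_refl|auto]]]. split; auto. split.
    + now apply chain_Bd_adj.
    + destruct c as [|p [|q [|s c]]]; [exfalso; apply W; reflexivity| | |simpl; lia].
      * exfalso. simpl in C. apply (@Bd_neq _ p p); tauto.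
      * exfalso. apply W. unfold wnd. simpl. rewrite (dl_anti org p q). lia.
  - assert (exists a p b d, c = a ++ p :: b ++ p :: d) as [a [p [b [d E]]]].
    { clear - N. induction c as [|p c IH]; [exfalso; apply N; constructor|].
      destruct (classic (In p c)) as [I|I].
      - apply in_split in I as [b [d ->]]. exists [], p, b, d. reflexivity.
      - destruct IH as [a [q [b [d ->]]]]; [intros N'; apply N; constructor; auto|]. exists (p :: a), q, b, d. reflexivity. }
    subst c. rewrite wnd_split in W. rewrite length_app in L. simpl in L. rewrite length_app in L. simpl in L.
    rewrite chain_stp in C.
    destruct (Z.eq_dec (wnd (p :: b) org) 0) as [Z1|Z1].
    + destruct (IH (a ++ p :: d)) as [c' [S' [C' [I' W']]]]; [rewrite length_app; simpl; lia| |lia|].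
      * rewrite chain_stp. intros x y S. apply C. apply stp_cl_rot. apply stp_cl_rot in S.
        simpl in *. rewrite <- !app_assoc in *. apply (stp_app (p :: b) p). right. exact S.
      * exists c'. split; auto. split; auto. split; auto. intros x Hx. apply I' in Hx. apply in_app_or in Hx.
        apply in_or_app. destruct Hx as [|[<-|]]; [auto|right; left; auto|right; right; apply in_or_app; right; right; auto].
    + destruct (IH (p :: b)) as [c' [S' [C' [I' W']]]]; [simpl; lia| |lia|].
      * rewrite chain_stp. intros x y S. apply C. apply stp_cl_rot. 
        simpl in *. rewrite <- !app_assoc in *. apply (stp_app (p :: b) p). left. exact S.
      * exists c'. split; auto. split; auto. split; auto. intros x Hx. apply I' in Hx.
        apply in_or_app. right. destruct Hx as [<-|Hx]; [left; auto|right; apply in_or_app; auto].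
Qed.

(* Let [g] be the first point of [r] on a far cycle [c], and [N] the easternmost column of [c]. The
   crossing numbers of [r] followed by [c] from [g] to [N], in both directions, vanish, so all the
   winding of [c] happens between its first and its last visit of the column [N]. *)
Theorem loops_exist r : isray r -> (forall X, exists i, (X < fst (r i))%Z) ->
  (forall k, exists c, chain Bd (cl c) /\ (forall p i, In p c -> i <= k -> p <> r i) /\ wnd c org <> 0%Z) ->
  forall n1, exists n sg m T g, (n1 <= n)%Z /\ excursion sg n m T g /\ turns sg m g.
Proof.
  intros R U BC n1. apply NNPP. intros NN. pose proof R as [R0 [R1 R2]].
  set (n0 := Z.max n1 1).
  assert (NL : forall n sg m T g, (n0 <= n)%Z -> excursion sg n m T g -> ~ turns sg m g).
  { intros n sg m T g L E Tn. apply NN. exists n, sg, m, T, g. split; auto. lia. }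
  assert (Ln0 : (1 <= n0)%Z) by lia.
  destruct (@nat_min (fun i => n0 <= fst (r i))%Z) as [tau [Ht Mt]].
  { destruct (U n0) as [i Hi]. exists i. lia. }
  assert (Fti : forall i, i < tau -> (fst (r i) < n0)%Z).
  { intros i Hi. destruct (Z.lt_ge_cases (fst (r i)) n0); auto. apply Mt in H. lia. }
  assert (Ft : fst (r tau) = n0).
  { destruct tau as [|t]; [rewrite R0 in Ht; cbn in Ht; lia|]. specialize (Fti t ltac:(lia)).
    pose proof (R1 t) as B. apply Bd_adj in B as [d Ed]. rewrite Ed in *. unfold step, padd in *; destruct d; cbn [dvec fst snd] in *; lia. }
  destruct (BC tau) as [c0 [C0 [D0 W0]]].
  destruct (@simple_cycle_ind (length c0) c0) as [c [SC [Cc [Ic W]]]]; auto.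
  destruct (@nat_min (fun t => In (r t) c)) as [T [IT MT]].
  { apply NNPP. intros N. apply W. rewrite <- R0. apply (@tail_out _ r c 0 R); [apply SC|].
    intros s _ I. apply N. exists s; auto. }
  assert (OT : forall t, t < T -> ~ In (r t) c) by (intros t L I; apply MT in I; lia).
  assert (LT : tau < T).
  { destruct (Nat.lt_ge_cases tau T) as [|L]; auto. exfalso. apply Ic in IT. apply (D0 _ T IT L). reflexivity. }
  assert (WT : forall t, t < T -> wnd c (r t) <> 0%Z).
  { intros t Lt E. apply W. rewrite <- E, <- R0. symmetry. apply (wv_seq c r (n := t)); [apply SC| |].
    - intros s _. apply Bd_adj, R1.
    - intros s Ls. apply OT. lia. }
  destruct (@exists_max c fst) as [pm [Ipm Hpm]]; [intros ->; now apply W|].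
  set (N := fst pm) in *.
  assert (FT : forall t, t < T -> (fst (r t) < N)%Z).
  { intros t Lt. destruct (Z.lt_ge_cases (fst (r t)) N); auto. exfalso. apply (WT t Lt).
    apply wnd_far_max; [apply SC|]. intros p Hp. apply Hpm in Hp. lia. }
  assert (LN : (n0 < N)%Z) by (rewrite <- Ft; apply FT; auto).
  set (g := r T) in *. destruct (in_split _ _ IT) as [l1 [l2 El]].
  set (cs := l2 ++ l1).
  assert (NDc : NoDup (g :: cs)).
  { destruct SC as [ND _]. rewrite El in ND. apply NoDup_swap in ND. exact ND. }
  assert (Inc : forall p, In p (g :: cs) <-> In p c).
  { intros p. rewrite El. unfold cs. simpl. rewrite !in_app_iff. simpl. tauto. }
  assert (Ccs : chain Bd (g :: cs ++ [g])).
  { change (chain Bd (cl (g :: cs))). rewrite chain_stp in *. intros x y S. apply Cc. rewrite El.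
    apply stp_cl_rot. exact S. }
  assert (Wcs : chi (g :: cs ++ [g]) <> 0%Z).
  { change (wnd (g :: cs) org <> 0%Z). intros E. apply W. rewrite <- E, El. apply wnd_rot. }
  assert (Lcs : 2 <= length cs).
  { destruct SC as [_ [_ L3]]. rewrite El, length_app in L3. unfold cs. rewrite length_app. simpl in L3. lia. }
  assert (Fcs : forall p, In p cs -> (fst p <= N)%Z) by (intros p Hp; apply Hpm, Inc; right; auto).
  assert (Dcs : forall p i, In p cs -> i <= T -> p <> r i).
  { intros p i Hp Hi E. destruct (Nat.eq_dec i T) as [->|].
    - inversion NDc; subst. auto.
    - apply (OT i); [lia|]. apply Inc. right. now rewrite <- E. }
  assert (PT : fpath r T) by now apply isray_fpath.
  assert (NDcs : NoDup cs) by (inversion NDc; auto).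
  destruct (Z.eq_dec (fst g) N) as [Eg|Eg].
  - destruct (@exists_last _ cs) as [cs0 [z Ez]]; [intros E; rewrite E in Lcs; simpl in Lcs; lia|].
    assert (Bz : Bd z g).
    { rewrite Ez, <- app_assoc in Ccs. simpl in Ccs. apply (chain_app Bd (g :: cs0)) in Ccs as [_ Ccs]. apply Ccs. }
    assert (Iz : In z cs) by (rewrite Ez; apply in_or_app; simpl; auto).
    assert (Fz : fst z = N).
    (* [r] arrives at [g] from the west, and [c] has no vertex further east, so the remaining
       neighbours of [g] are in its own column. *)
    { pose proof (Fcs z Iz) as Lz. apply Bd_sym, Bd_adj in Bz as [d Ed].
      assert (Bt : Bd (r (T - 1)) g) by (unfold g; replace T with (S (T - 1)) at 2 by lia; apply R1).
      apply Bd_sym, Bd_adj in Bt as [d' Ed']. pose proof (FT (T - 1) ltac:(lia)) as F1.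
      assert (Nz : z <> r (T - 1)) by (apply Dcs; auto; lia). rewrite Ed' in F1, Nz. rewrite Ed in *.
      unfold step, padd in *. destruct d, d'; cbn [dvec fst snd] in *; try lia; congruence. }
    destruct (@arc_loop r T N cs) as [sg [T' [h [Hh Th]]]]; auto.
    + lia.
    + intros E; rewrite E in Lcs; simpl in Lcs; lia.
    + rewrite app_comm_cons in Ccs. 
      rewrite Ez in Ccs |- *. simpl in Ccs. rewrite <- app_assoc in Ccs. simpl in Ccs.
      now apply (chain_app Bd (g :: cs0)) in Ccs.
    + rewrite Ez, last_last. auto.
    + intros X. apply Wcs. rewrite Ez, <- app_assoc. simpl app. rewrite chi_app1, <- Ez. fold g in X. rewrite X.
      rewrite chi_far; [reflexivity|]. intros p [<-|[<-|[]]]; lia.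
    + apply (@NL N sg T T' h); auto. lia.
  - assert (Lg : (fst g < N)%Z) by (assert ((fst g <= N)%Z) by (apply Hpm; auto); lia).
    destruct (@first_hit Point (fun p => fst p = N) cs) as [P [w1 [Q [E1 [Fw1 FP]]]]].
    { exists pm. split; auto. apply Inc in Ipm as [E|]; auto. exfalso. apply Eg. now rewrite E. }
    assert (Ic1 : forall p, In p P \/ p = w1 \/ In p Q -> In p cs).
    { intros p Hp. rewrite E1. apply in_or_app. simpl. intuition. }
    assert (FP' : forall p, In p P -> (fst p < N)%Z).
    { intros p Hp. specialize (FP p Hp). assert ((fst p <= N)%Z) by (apply Fcs, Ic1; auto). lia. }
    assert (Hk : exists k, N = (n0 + Z.of_nat k)%Z) by (exists (Z.to_nat (N - n0)); lia). destruct Hk as [k Hk].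
    (* the crossing number vanishes along any extension of the ray that ends where it first reaches column N *)
    assert (KEY : forall (L : list Point) (w : Point), chain Bd (g :: L ++ [w]) -> NoDup (L ++ [w]) -> (forall p, In p (L ++ [w]) -> In p cs) ->
       (forall p, In p L -> (fst p < N)%Z) -> fst w = N ->
       fpath (ext r T (L ++ [w])) (T + length (L ++ [w])) /\ ext r T (L ++ [w]) (T + length (L ++ [w])) = w /\
       (forall i, i < T + length (L ++ [w]) -> (fst (ext r T (L ++ [w]) i) < N)%Z) /\
       chi (g :: L ++ [w]) = (- chi (seg r tau T))%Z).
    { intros L w CL NDL IL FL Fw.
      assert (PF : fpath (ext r T (L ++ [w])) (T + length (L ++ [w]))) by (apply ext_fpath; auto).
      assert (EL : ext r T (L ++ [w]) (T + length (L ++ [w])) = w) by (rewrite ext_last; apply last_last).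
      assert (FF : forall i, i < T + length (L ++ [w]) -> (fst (ext r T (L ++ [w]) i) < N)%Z).
      { intros i Hi. destruct (Nat.le_gt_cases i T) as [Li|Li].
        - rewrite ext_le by auto. destruct (Nat.eq_dec i T) as [->|]; [auto|apply FT; lia].
        - pose proof (@ext_in r T (L ++ [w]) i Li ltac:(lia)) as I. apply in_app_or in I as [I|[I|[]]]; [auto|].
          exfalso. pose proof (eq_trans EL I) as E. apply (proj2 (proj2 PF)) in E; lia. }
      split; auto. split; auto. split; auto.
      assert (X : chi (seg (ext r T (L ++ [w])) tau (T + length (L ++ [w]))) = 0%Z).
      { apply (@chi_first_visits n0 Ln0 NL k); auto.
        - rewrite EL. congruence.
        - intros i Hi. rewrite <- Hk. auto.
        - lia.
        - rewrite ext_le by lia. auto.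
        - intros i Hi. rewrite ext_le by lia. auto. }
      rewrite (@chi_seg _ tau T) in X by lia. rewrite ext_seg in X.
      replace (seg (ext r T (L ++ [w])) tau T) with (seg r tau T) in X; [fold g in X; lia|].
      unfold seg. apply map_ext_in. intros i Hi. apply in_seq in Hi. symmetry. apply ext_le. lia. }
    assert (C1 : chain Bd (g :: P ++ [w1])).
    { rewrite E1, <- app_assoc in Ccs. now apply (chain_app Bd (g :: P)) in Ccs. }
    assert (C2 : chain Bd (w1 :: Q ++ [g])).
    { rewrite E1, <- app_assoc in Ccs. now apply (chain_app Bd (g :: P)) in Ccs. }
    assert (ND1 : NoDup (P ++ [w1])).
    { rewrite E1 in NDcs. replace (P ++ w1 :: Q) with ((P ++ [w1]) ++ Q) in NDcs by (now rewrite <- app_assoc).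
      now apply NoDup_app_remove_r in NDcs. }
    destruct (KEY P w1) as [PF [EL [FF X1]]]; auto.
    { intros p Hp. apply in_app_or in Hp as [|[<-|[]]]; apply Ic1; auto. }
    assert (Tot : chi (g :: cs ++ [g]) = (chi (g :: P ++ [w1]) + chi (w1 :: Q ++ [g]))%Z).
    { rewrite E1, <- app_assoc. simpl app. apply chi_app1. }
    assert (Back : forall (L : list Point) (w : Point), (exists L', w1 :: Q = L' ++ w :: L) -> (forall p, In p L -> (fst p < N)%Z) -> fst w = N ->
       chi (w :: L ++ [g]) = chi (seg r tau T)).
    { intros L w [L' EL'] FL Fw.
      assert (Cw : chain Bd (w :: L ++ [g])).
      { change (w1 :: Q ++ [g]) with ((w1 :: Q) ++ [g]) in C2. rewrite EL', <- app_assoc in C2. now apply chain_app in C2. }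
      assert (NDw : NoDup (w :: L)).
      { rewrite E1 in NDcs. apply NoDup_app_remove_l in NDcs. rewrite EL' in NDcs. now apply NoDup_app_remove_l in NDcs. }
      apply (chain_rev Bd _ Bd_sym) in Cw. simpl in Cw. rewrite rev_app_distr in Cw. simpl in Cw.
      destruct (KEY (rev L) w) as [_ [_ [_ X2]]]; auto.
      - apply NoDup_rev in NDw. exact NDw.
      - intros p Hp. rewrite E1. apply in_or_app. right. rewrite EL'. apply in_or_app. right.
        apply in_app_or in Hp as [Hp|[<-|[]]]; [right; now apply in_rev|left; auto].
      - intros p Hp. apply FL. now apply in_rev.
      - assert (E : chi (g :: rev L ++ [w]) = (- chi (w :: L ++ [g]))%Z).
        { rewrite <- chi_rev. simpl rev. now rewrite rev_app_distr. }
        lia. }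
    (* Searching [Q] backwards yields the last visit [w2] of the column [N]. The contributions
       before [w1] and after [w2] cancel. *)
    destruct (classic (exists p : Point, In p (rev Q) /\ fst p = N)) as [HQ|HQ].
    + apply first_hit in HQ as [L [w2 [M' [E2 [Fw2 FL]]]]].
      assert (EQ : Q = rev M' ++ w2 :: rev L).
      { rewrite <- (rev_involutive Q), E2, rev_app_distr. simpl. now rewrite <- app_assoc. }
      set (M := rev M') in *. 
      assert (X2 : chi (w2 :: rev L ++ [g]) = chi (seg r tau T)).
      { apply Back; auto.
        - exists (w1 :: M). rewrite EQ. reflexivity.
        - intros p Hp. assert (In p cs) by (apply Ic1; right; right; rewrite EQ; apply in_or_app; right; right; auto).
          apply Fcs in H. assert (fst p <> N) by (apply FL; now apply in_rev). lia. }
      assert (X3 : chi (w1 :: M ++ [w2]) <> 0%Z).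
      { intros X3. apply Wcs. rewrite Tot, X1, EQ, <- app_assoc. simpl app. rewrite chi_app1, X3, X2. lia. }
      set (m1 := T + length (P ++ [w1])) in *. set (f := ext r T (P ++ [w1])) in *.
      destruct (@arc_loop f m1 N (M ++ [w2])) as [sg [T' [h [Hh Th]]]]; auto.
      * lia.
      * rewrite EL. auto.
      * intros E. now apply app_eq_nil in E as [_ E].
      * rewrite EL. rewrite EQ, <- app_assoc in C2. now apply (chain_app Bd (w1 :: M)) in C2.
      * rewrite E1, EQ in NDcs. apply NoDup_app_remove_l in NDcs. apply NoDup_cons_iff in NDcs as [_ ND2].
        replace (M ++ w2 :: rev L) with ((M ++ [w2]) ++ rev L) in ND2 by (now rewrite <- app_assoc).
        now apply NoDup_app_remove_r in ND2.
      * assert (IQ : forall p, In p (M ++ [w2]) -> In p Q).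
        { intros p Hp. rewrite EQ. apply in_app_or in Hp as [|[<-|[]]]; apply in_or_app; simpl; auto. }
        intros p i Hp Hi E. apply IQ in Hp. destruct (Nat.le_gt_cases i T) as [Li|Li].
        -- unfold f in E. rewrite ext_le in E by auto. apply (Dcs p i); auto.
        -- assert (I : In (f i) (P ++ [w1])) by (apply ext_in; auto).
           rewrite <- E in I. rewrite E1 in NDcs. 
           replace (P ++ w1 :: Q) with ((P ++ [w1]) ++ Q) in NDcs by (now rewrite <- app_assoc).
           clear - NDcs I Hp. induction (P ++ [w1]) as [|y l IH]; [destruct I|]. simpl in NDcs. inversion NDcs; subst.
           destruct I as [->|I]; [apply H1; apply in_or_app; auto|auto].
      * intros p Hp. apply Fcs, Ic1. right. right. rewrite EQ. apply in_app_or in Hp as [|[<-|[]]]; apply in_or_app; simpl; auto.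
      * rewrite last_last. auto.
      * rewrite EL. exact X3.
      * apply (@NL N sg m1 T' h); auto. lia.
    (* If [w1] is the only visit of the column, the two contributions already make up the whole
       cycle, which would have crossing number 0. *)
    + apply Wcs. rewrite Tot, X1, (Back Q w1); [lia| | |auto].
      * exists []. reflexivity.
      * intros p Hp. assert (In p cs) by (apply Ic1; auto). apply Fcs in H. destruct (Z.eq_dec (fst p) N); [|lia].
        exfalso. apply HQ. exists p. split; auto. rewrite <- in_rev. auto.
Qed.

End Sys.

(** * Reflection *)

Definition refl (p : Point) : Point := (fst p, - snd p)%Z.
Definition flip (d : Dir) : Dir := match d with DN => DS | DS => DN | d => d end.

Lemma refl_refl p : refl (refl p) = p.
Proof. destruct p; unfold refl; cbn [fst snd]; f_equal; lia. Qed.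

Lemma refl_inj p q : refl p = refl q -> p = q.
Proof. intros E. rewrite <- (refl_refl p), E. apply refl_refl. Qed.

Lemma refl_step p d : refl (step p d) = step (refl p) (flip d).
Proof. unfold refl, step, padd; destruct d; cbn [flip dvec fst snd]; f_equal; lia. Qed.

Lemma flip_flip d : flip (flip d) = d.
Proof. now destruct d. Qed.

Lemma dirof_refl p q : adj p q -> dirof (refl p) (refl q) = flip (dirof p q).
Proof. intros [d ->]. now rewrite refl_step, !dirof_step. Qed.

Section Refl.
Context {SS : Sys}.

Definition ratt (d : Dir) (t t' : tile) : Prop := att (flip d) t t'.
Definition ral (p : Point) : option tile := al (refl p).

Lemma rbd p q : bdOf ratt ral p q <-> Bd (refl p) (refl q).
Proof.
  split; intros [d [t [t' [E [H1 [H2 H3]]]]]]; exists (flip d), t, t'.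
  - rewrite E. split; [apply refl_step|]. split; [auto|]. split; [|auto]. rewrite <- E. auto.
  - split; [|split; [auto|split; [auto|]]].
    + apply refl_inj. rewrite E, refl_step, flip_flip. reflexivity.
    + unfold ratt. now rewrite flip_flip.
Qed.

Lemma rpath z n : pathOf (bdOf ratt ral) z n <-> fpath (fun i => refl (z i)) n.
Proof.
  split; intros [H0 [H1 H2]].
  - split; [now rewrite H0|]. split.
    + intros i Hi. now apply rbd, H1.
    + intros i j Hi Hj E. apply H2; auto. now apply refl_inj.
  - split; [apply refl_inj; now rewrite H0|]. split.
    + intros i Hi. now apply rbd, H1.
    + intros i j Hi Hj E. apply H2; auto. now rewrite E.
Qed.

(** Reflection in the horizontal axis exchanges excursions that exit above and below their entry, so
    [loops_periodic] is proved only for the latter. Working over the class [Sys] makes the reflected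
    assembly another instance. *)
Program Definition reflS : Sys := {| tile := tile; att := ratt; al := ral; tls := tls |}.
Next Obligation.
  unfold ratt in *. apply att_sym in H. now destruct d.
Qed.
Next Obligation. now apply al_tls in H. Qed.
Next Obligation.
  apply rpath in H. unfold ral in *. rewrite refl_step. apply (@sys_grow SS (fun i => refl (z i)) n (flip d) t t'); auto.
  intros i Hi E. apply (H1 i Hi). apply refl_inj. now rewrite refl_step.
Qed.
Next Obligation.
  destruct (sys_reach (refl p) H) as [z [n [Hz E]]]. exists (fun i => refl (z i)), n. split.
  - apply rpath. apply fpath_ext with z; auto. intros; apply refl_refl.
  - rewrite E. apply refl_refl.
Qed.

Lemma isray_refl r : @isray reflS r <-> isray (fun i => refl (r i)).
Proof.
  rewrite (@isray_fpath reflS), isray_fpath. split; intros H n.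
  - apply rpath. apply H.
  - apply rpath. apply H.
Qed.

Lemma rayper_refl r : @rayper reflS r -> rayper (fun i => refl (r i)).
Proof.
  intros [i [j [L H]]]. exists i, j. split; auto. intros m. destruct (H m) as [E1 E2]. split; [|exact E2].
  unfold refl, padd in *. pose proof (f_equal fst E1). pose proof (f_equal snd E1). cbn [fst snd] in *. f_equal; lia.
Qed.

Lemma excursion_refl n m T f : excursion false n m T f -> @excursion reflS true n m T (fun i => refl (f i)).
Proof.
  intros [M [Fm [Fi [LT [P [FT [En [Sg Ex]]]]]]]].
  split; [auto|]. split; [auto|]. split; [auto|]. split; [auto|]. split.
  { apply rpath. apply fpath_ext with f; auto. intros; apply refl_refl. }
  split; [auto|]. split; [auto|]. split; [cbn [refl snd]; lia|].
  intros s. rewrite Ex. unfold refl, sl; cbn [dvec fst snd]. f_equal; lia.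
Qed.

Lemma turns_refl n m T f : excursion false n m T f -> turns false m f -> turns true m (fun i => refl (f i)).
Proof.
  intros [M [Fm [Fi [LT [[P0 [P1 P2]] [FT _]]]]]] H. unfold turns in *.
  assert (A1 : adj (f m) (f (m + 1))) by (rewrite Nat.add_1_r; apply Bd_adj, P1; lia).
  assert (A0 : adj (f m) (f (m - 1))).
  { apply adj_sym. replace m with (S (m - 1)) at 2 by lia. apply Bd_adj, P1. lia. }
  assert (N : dirof (f m) (f (m - 1)) <> DE).
  { intros E. apply step_dirof in A0. rewrite E in A0. specialize (Fi (m - 1) ltac:(lia)). rewrite <- A0 in Fi.
    unfold step, padd in Fi; cbn [dvec fst snd] in Fi. lia. }
  assert (N' : dirof (f m) (f (m + 1)) <> DE).
  { intros E. apply step_dirof in A1. rewrite E in A1. specialize (FT 1 ltac:(lia)). rewrite <- A1 in FT.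
    unfold step, padd in FT; cbn [dvec fst snd] in FT. lia. }
  rewrite !dirof_refl by auto. clear - H N N'. dirs.
Qed.

Lemma loops_periodic_any : (forall n1, exists n sg m T g, (n1 <= n)%Z /\ excursion sg n m T g /\ turns sg m g) ->
  exists r, isray r /\ rayper r.
Proof.
  intros H.
  destruct (@pigeon _ [true; false] (fun N sg => exists n m T g, (Z.of_nat N <= n)%Z /\ excursion sg n m T g /\ turns sg m g)) as [sg Hs].
  { intros N. destruct (H (Z.of_nat N)) as [n [sg [m [T [g [L [E Tn]]]]]]]. exists N, sg. split; auto. split.
    - destruct sg; simpl; auto.
    - exists n, m, T, g. auto. }
  destruct sg.
  - apply loops_periodic. intros N. destruct (Hs N) as [N' [LN [n [m [T [g [L [E Tn]]]]]]]].
    exists n, m, T, g. split; [lia|]. split; auto.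
  - destruct (@loops_periodic reflS) as [r [Hr Pr]].
    + intros N. destruct (Hs N) as [N' [LN [n [m [T [g [L [E Tn]]]]]]]].
      exists n, m, T, (fun i => refl (g i)). split; [lia|]. split.
      * now apply excursion_refl.
      * now apply turns_refl with n T.
    + exists (fun i => refl (r i)). split; [now apply isray_refl|now apply rayper_refl].
Qed.

(** Closed walks count as far out when they miss a long initial part of the leftmost ray. If such
    walks exist but this ray is bounded to the east, it is already a ray in a half-plane that
    touches its border. *)
Theorem periodic_ray r0 : isray r0 -> exists r, isray r /\ rayper r.
Proof.
  intros I0. destruct (@extremal_ray _ true (fun _ => True) 1 r0) as [r [H _]]; auto.
  pose proof H as [R _].
  destruct (classic (forall k, exists c, chain Bd (cl c) /\ (forall p i, In p c -> i <= k -> p <> r i) /\ wnd c org <> 0%Z)) as [BC|NBC].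
  - destruct (classic (forall X, exists i, (X < fst (r i))%Z)) as [U|U].
    + apply loops_periodic_any. now apply loops_exist with r.
    + apply not_all_ex_not in U as [X U].
      assert (B : forall i, (fst (r i) <= X)%Z).
      { intros i. destruct (Z.le_gt_cases (fst (r i)) X); auto. exfalso. apply U. exists i; auto. }
      destruct (@z_max (fun v => exists i, fst (r i) = v) X) as [n [[kb E] M]].
      * intros v [i <-]. auto.
      * exists (fst (r 0)), 0. auto.
      * apply halfplane_periodic with r kb n; auto. intros t. apply M. exists t; auto.
  - apply not_all_ex_not in NBC as [k0 NBC].
    destruct (classic (exists B, forall a b A, loop r a b A -> b <= B)) as [[B HB]|U].
    + exists r. split; auto. now apply loops_bounded_periodic with B.
    + apply loops_unbounded_periodic with r k0; auto.
      * intros c _ C D. apply NNPP. intros W. apply NBC. exists c. auto.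
      * intros B. apply NNPP. intros N. apply U. exists B. intros a b A HL.
        destruct (Nat.le_gt_cases b B); auto. exfalso. apply N. exists a, b, A. auto.
Qed.

End Refl.

(** * Extracting an induced periodic path *)

Section Chordless.
Context {SS : Sys}.

Lemma farthest r : isray r -> forall a, exists b, a < b /\ Bd (r a) (r b) /\ forall b', Bd (r a) (r b') -> b' <= b.
Proof.
  intros [R0 [R1 R2]] a.
  destruct (eventually_out r (map (step (r a)) [DE; DN; DS; DW]) R2) as [N HN].
  assert (B : forall b, Bd (r a) (r b) -> b < N).
  { intros b Hb. destruct (Nat.lt_ge_cases b N) as [|L]; auto. exfalso. apply (HN b L).
    apply Bd_adj in Hb as [d ->]. destruct d; simpl; auto. }
  destruct (@nat_min (fun k => k <= N /\ Bd (r a) (r (N - k)))) as [k [[Lk Bk] Mk]].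
  { pose proof (B _ (R1 a)). exists (N - S a). replace (N - (N - S a)) with (S a) by lia. split; auto; lia. }
  assert (M : forall b', Bd (r a) (r b') -> b' <= N - k).
  { intros b' Hb. pose proof (B _ Hb). assert (k <= N - b'); [|lia]. apply Mk.
    replace (N - (N - b')) with b' by lia. split; auto; lia. }
  exists (N - k). split; [|auto]. specialize (M (S a) (R1 a)). lia.
Qed.

Theorem induced_periodic r : isray r -> rayper r -> exists (q : nat -> Point) (K L : nat) (V : Point),
  isray q /\ (forall k l, k < l -> Bd (q k) (q l) -> l = S k) /\ 1 <= L /\
  (forall t, K <= t -> q (t + L) = padd (q t) V /\ al (q (t + L)) = al (q t)).
Proof.
  intros R [i0 [j0 [Lij Per]]]. pose proof R as [R0 [R1 R2]].
  set (P := j0 - i0). set (v := psub (r j0) (r i0)).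
  assert (Sh : forall n, i0 <= n -> r (n + P) = padd (r n) v /\ al (r (n + P)) = al (r n)).
  { intros n Ln. destruct (Per (n - i0)) as [E1 E2]. replace (i0 + (n - i0)) with n in * by lia.
    replace (j0 + (n - i0)) with (n + P) in * by (unfold P; lia). split; auto. unfold v, psub. pts. }
  assert (ShB : forall a b, i0 <= a -> i0 <= b -> (Bd (r (a + P)) (r (b + P)) <-> Bd (r a) (r b))).
  { intros a b La Lb. destruct (Sh a La) as [A1 A2]. destruct (Sh b Lb) as [B1 B2]. split; intros H.
    - apply Bd_shift with (1 := H) (v := psub (r i0) (r j0)); auto; unfold v, psub in *; pts.
    - apply Bd_shift with (1 := H) (v := v); auto. }
  destruct (choice _ (farthest R)) as [f Hf].
  assert (fP : forall a, i0 <= a -> f (a + P) = f a + P).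
  { intros a La. destruct (Hf a) as [F1 [F2 F3]]. destruct (Hf (a + P)) as [G1 [G2 G3]].
    assert (f (a + P) = f (a + P) - P + P) as E by lia.
    apply Nat.le_antisymm.
    - assert (G2' : Bd (r (a + P)) (r (f (a + P) - P + P))) by (rewrite <- E; exact G2).
      apply (proj1 (ShB a (f (a + P) - P) La ltac:(lia))) in G2'. apply F3 in G2'. lia.
    - apply G3. apply (proj2 (ShB a (f a) La ltac:(lia))). auto. }
  set (a := fix a k := match k with 0 => 0 | S k => f (a k) end).
  assert (aS : forall k, a (S k) = f (a k)) by reflexivity.
  assert (aI : forall k l, k < l -> a k < a l).
  { intros k l H. induction H as [|l H IH]; rewrite aS; [apply (proj1 (Hf (a k)))|]. pose proof (proj1 (Hf (a l))). lia. }
  assert (aG : forall k, k <= a k).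
  { induction k; [lia|]. pose proof (aI k (S k)). lia. }
  assert (fcP : forall c b, i0 <= b -> f (b + c * P) = f b + c * P).
  { induction c; intros b Lb; [now rewrite !Nat.add_0_r|].
    replace (b + S c * P) with (b + c * P + P) by lia. rewrite fP, IHc by lia. lia. }
  assert (ScP : forall c n, i0 <= n -> r (n + c * P) = padd (r n) (Z.of_nat c * fst v, Z.of_nat c * snd v)%Z /\ al (r (n + c * P)) = al (r n)).
  { induction c; intros n Ln.
    - rewrite Nat.add_0_r. split; auto. unfold padd. destruct (r n); cbn [fst snd]; f_equal; lia.
    - replace (n + S c * P) with (n + c * P + P) by lia. destruct (Sh (n + c * P) ltac:(lia)) as [E1 E2].
      destruct (IHc n Ln) as [E3 E4]. split; [|congruence]. rewrite E1, E3. unfold padd; cbn [fst snd]; f_equal; lia. }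
  destruct (@pigeon _ (seq 0 P) (fun n u => a n mod P = u)) as [u Hu].
  { intros N. exists N, (a N mod P). split; auto. split; auto. apply in_seq. 
    pose proof (Nat.mod_upper_bound (a N) P). unfold P in *. lia. }
  (* [K >= i0] guarantees that the position [a K] lies in the periodic part of [r]. *)
  destruct (Hu i0) as [K [LK EK]]. destruct (Hu (S K)) as [K2 [LK2 EK2]].
  pose proof (aI K K2 ltac:(lia)) as La. pose proof (aG K).
  assert (exists c, a K2 = a K + c * P) as [c Ec].
  { pose proof (Nat.div_mod_eq (a K) P). pose proof (Nat.div_mod_eq (a K2) P).
    assert (a K / P <= a K2 / P) by (apply Nat.Div0.div_le_mono; lia).
    exists (a K2 / P - a K / P). nia. }
  set (L := K2 - K).
  assert (aL : forall t, K <= t -> a (t + L) = a t + c * P).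
  { intros t Ht. replace t with (K + (t - K)) by lia. induction (t - K) as [|s IH].
    - replace (K + 0 + L) with K2 by lia. rewrite Nat.add_0_r. auto.
    - replace (K + S s + L) with (S (K + s + L)) by lia. replace (K + S s) with (S (K + s)) by lia.
      rewrite !aS, IH. apply fcP. destruct (Nat.eq_dec s 0) as [->|]; [rewrite Nat.add_0_r; lia|].
      pose proof (aI K (K + s) ltac:(lia)). lia. }
  exists (fun k => r (a k)), K, L, (Z.of_nat c * fst v, Z.of_nat c * snd v)%Z.
  split; [|split; [|split; [lia|]]].
  - split; auto. split.
    + intros k. rewrite aS. apply Hf.
    + intros k l E. apply R2 in E. destruct (Nat.lt_trichotomy k l) as [H1|[H1|H1]]; auto; apply aI in H1; lia.
  - intros k l Lkl B. apply Hf in B. rewrite <- aS in B.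
    destruct (Nat.eq_dec l (S k)); auto. pose proof (aI (S k) l ltac:(lia)). lia.
  - intros t Ht. rewrite aL by auto. apply ScP. pose proof (aG t). lia.
Qed.

End Chordless.

(** * The tile assembly system *)

Section TAS.
Variables (Sigma : Type) (T : list (Tile Sigma)) (s : Tile Sigma) (amax : Assembly Sigma).
Hypothesis Hconf : confluent T s.
Hypothesis Hmax : is_max_producible T s amax.

Definition fits (d : Dir) (t t' : Tile Sigma) : Prop := t d = t' (dopp d).

Lemma bond_sym (a : Assembly Sigma) u v : bond a u v -> bond a v u.
Proof.
  intros [d [t [t' [-> [H1 [H2 H3]]]]]]. exists (dopp d), t', t.
  split; [symmetry; apply (step_opp u d)|]. split; auto. split; auto. rewrite dopp_dopp. auto.
Qed.

Lemma connected_from (a : Assembly Sigma) : 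
  (forall v, in_dom a v -> clos_refl_trans Point (fun x y => bond a x y \/ bond a y x) org v) -> bconnected a.
Proof.
  intros H u v Hu Hv. apply rt_trans with org; [|auto].
  assert (W : forall x y, clos_refl_trans Point (fun x y => bond a x y \/ bond a y x) x y -> clos_refl_trans Point (fun x y => bond a x y \/ bond a y x) y x).
  { intros x y Hxy. induction Hxy; [apply rt_step; tauto|apply rt_refl|eapply rt_trans; eauto]. }
  auto.
Qed.

Lemma sequence_connected (a : Assembly Sigma) (z : nat -> Point) n : z 0 = org ->
  (forall i, i < n -> bond a (z i) (z (S i))) -> forall i, i <= n ->
  clos_refl_trans Point (fun x y => bond a x y \/ bond a y x) org (z i).
Proof.
  intros H0 HB. induction i; intros Hi; [rewrite H0; apply rt_refl|].
  apply rt_trans with (z i); [apply IHi; lia|]. apply rt_step. left. apply HB. lia.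
Qed.

(** The tiles of the path together with [t'] form a producible assembly: additional bonds among them
    do no harm, since only connectedness is required. Maximality puts its domain inside that of
    [amax], and confluence makes the tiles agree. *)
Lemma grow_amax z n d t t' : pathOf (bdOf fits amax) z n -> amax (z n) = Some t ->
  (forall i, i <= n -> z i <> step (z n) d) -> In t' (s :: T) -> fits d t t' -> amax (step (z n) d) = Some t'.
Proof.
  intros [H0 [H1 H2]] Et Nq It Fit. destruct Hmax as [[HT [HC HO]] HM].
  set (q := step (z n) d) in *.
  set (b := fun v => if pt_dec v q then Some t' else if in_dec pt_dec v (map z (seq 0 (S n))) then amax v else None).
  assert (bz : forall i, i <= n -> b (z i) = amax (z i)).
  { intros i Hi. unfold b. destruct (pt_dec (z i) q) as [E|_]; [now apply Nq in E|].
    destruct (in_dec pt_dec (z i) (map z (seq 0 (S n)))) as [|N]; auto. exfalso. apply N. apply in_map, in_seq. lia. }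
  assert (bq : b q = Some t') by (unfold b; destruct (pt_dec q q); congruence).
  assert (bB : forall i, i < n -> bond b (z i) (z (S i))).
  { intros i Hi. destruct (H1 i Hi) as [d' [u [u' [E1 [E2 [E3 E4]]]]]]. exists d', u, u'.
    rewrite !bz by lia. auto. }
  assert (PB : producible T s b).
  { split; [|split].
    - intros v u Hv. unfold b in Hv. destruct (pt_dec v q); [injection Hv as <-; destruct It; auto|].
      destruct (in_dec pt_dec v (map z (seq 0 (S n)))); [eauto|discriminate].
    - apply connected_from. intros v Hv. unfold in_dom, b in Hv. destruct (pt_dec v q) as [->|].
      + apply rt_trans with (z n); [apply (@sequence_connected b z n); auto|]. apply rt_step. left.
        exists d, t, t'. rewrite bz by lia. auto.
      + destruct (in_dec pt_dec v (map z (seq 0 (S n)))) as [I|]; [|congruence].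
        apply in_map_iff in I as [i [<- Hi]]. apply in_seq in Hi. apply (@sequence_connected b z n); auto. lia.
    - change (0%Z, 0%Z) with org. rewrite <- H0, bz by lia. now rewrite H0. }
  assert (Dq : in_dom amax q) by (apply (HM b PB); unfold in_dom; congruence).
  unfold in_dom in Dq. destruct (amax q) as [u|] eqn:Eu; [|congruence].
  f_equal. apply (Hconf (conj HT (conj HC HO)) PB q); auto.
Qed.

Lemma reach_amax p : amax p <> None -> exists z n, pathOf (bdOf fits amax) z n /\ z n = p.
Proof.
  intros Hp. destruct Hmax as [[HT [HC HO]] HM].
  assert (D0 : in_dom amax org) by (unfold in_dom, org; congruence).
  pose proof (HC org p D0 Hp) as W. clear Hp.
  apply clos_rt_rtn1 in W. induction W as [|y w Hyw _ [z [n [Hz Ez]]]].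
  - exists (fun _ => org), 0. split; auto. split; auto. split; intros; lia.
  - destruct (classic (exists i, i <= n /\ z i = w)) as [[i [Li Ei]]|N].
    + exists z, i. split; auto. destruct Hz as [H0 [H1 H2]]. split; auto. split; intros; [apply H1|apply H2]; auto; lia.
    + exists (cut z n (fun _ => w)), (S n). split; [|now rewrite cut_gt by lia].
      apply pathOf_snoc; auto.
      * rewrite Ez. destruct Hyw as [|Hyw]; [auto|now apply bond_sym].
      * intros i Li Ei. apply N. exists i; auto.
Qed.

Lemma fits_sym d t t' : fits d t t' -> fits (dopp d) t' t.
Proof. unfold fits. rewrite dopp_dopp. auto. Qed.

Lemma amax_tiles p t : amax p = Some t -> In t (s :: T).
Proof. intros H. destruct Hmax as [[HT _] _]. destruct (HT _ _ H); simpl; auto. Qed.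

(** The seed is added to the tiles because it may not occur in [T]. *)
Definition tasS : Sys := @mkSys (Tile Sigma) fits amax (s :: T) fits_sym amax_tiles grow_amax reach_amax.

(** Every tile is reached by a simple bonded path. If all these had fewer than [N] steps, the domain
    would lie in a box of radius [N] and be finite. *)
Lemma long_paths : ~ finite_assembly amax -> forall N, exists z, @fpath tasS z N.
Proof.
  intros HI N. apply NNPP. intros C. apply HI.
  destruct (box_list (Z.of_nat N)) as [L HL]. exists L. intros v Hv.
  destruct (reach_amax Hv) as [z [n [Hz <-]]].
  assert (Ln : n < N).
  { destruct (Nat.lt_ge_cases n N) as [|Ln]; auto. exfalso. apply C. exists z. now apply (@fpath_le tasS) with n. }
  assert (B : forall i, i <= n -> (Z.abs (fst (z i)) <= Z.of_nat i /\ Z.abs (snd (z i)) <= Z.of_nat i)%Z).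
  { destruct Hz as [H0 [H1 _]]. induction i; intros Hi; [rewrite H0; cbn; lia|].
    specialize (IHi ltac:(lia)). destruct (H1 i ltac:(lia)) as [d [_ [_ [E _]]]]. rewrite E.
    unfold step, padd; destruct d; cbn [dvec fst snd]; lia. }
  specialize (B n (le_n _)). apply HL; lia.
Qed.

Lemma disp_app l1 l2 : disp (l1 ++ l2) = padd (disp l1) (disp l2).
Proof.
  induction l1 as [|d l1 IH]; [simpl; destruct (disp l2); reflexivity|].
  simpl. rewrite IH. unfold padd; cbn [fst snd]. f_equal; lia.
Qed.

(** The word [m] spells the first [K] steps of [q] and [p] the next [L]. Inducedness is what makes
    the binding graph of the restriction of [amax] to [q] exactly the path, without chords. *)
Lemma induced_up_path (q : nat -> Point) K L V : @isray tasS q ->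
  (forall k l, k < l -> @Bd tasS (q k) (q l) -> l = S k) -> 1 <= L ->
  (forall t, K <= t -> q (t + L) = padd (q t) V /\ amax (q (t + L)) = amax (q t)) ->
  contains_up_path T s amax.
Proof.
  intros [Q0 [Q1 Q2]] Ind HL Per.
  destruct Hmax as [[HT [HC HO]] HM].
  set (dr := fun k => dirof (q k) (q (S k))).
  assert (Hdr : forall k, q (S k) = padd (q k) (dvec (dr k))).
  { intros k. symmetry. apply (@step_dirof (q k) (q (S k))). apply (@Bd_adj tasS), Q1. }
  assert (Pdr : forall c t, K <= t -> dr (t + c * L) = dr t).
  { induction c; intros t Ht; [now rewrite Nat.add_0_r|].
    replace (t + S c * L) with (t + c * L + L) by lia. rewrite <- (IHc t Ht). unfold dr.
    destruct (Per (t + c * L) ltac:(lia)) as [-> _]. 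
    replace (S (t + c * L + L)) with (S (t + c * L) + L) by lia. destruct (Per (S (t + c * L)) ltac:(lia)) as [-> _].
    apply dirof_padd. }
  set (m := map dr (seq 0 K)). set (p := map dr (seq K L)).
  assert (Lm : length m = K) by (unfold m; now rewrite length_map, length_seq).
  assert (Lp : length p = L) by (unfold p; now rewrite length_map, length_seq).
  assert (Nth : forall a n k, k < n -> nth k (map dr (seq a n)) DE = dr (a + k)).
  { intros a n k Hk. rewrite (nth_indep _ DE (dr 0)) by (rewrite length_map, length_seq; lia).
    rewrite map_nth, seq_nth by lia. reflexivity. }
  assert (WL : forall k, wletter m p k = dr k).
  { intros k. unfold wletter. rewrite Lm, Lp. destruct (Nat.ltb_spec k K) as [H|H].
    - unfold m. now rewrite Nth.
    - pose proof (Nat.mod_upper_bound (k - K) L ltac:(lia)). unfold p. rewrite Nth by lia.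
      pose proof (Nat.div_mod_eq (k - K) L) as E.
      rewrite <- (Pdr ((k - K) / L)) by lia. f_equal. nia. }
  assert (DS : forall k, disp (map dr (seq 0 k)) = q k).
  { induction k; [simpl; now rewrite Q0|]. rewrite seq_S, map_app, disp_app, IHk, Hdr. simpl. f_equal.
    unfold padd; destruct (dvec (dr k)); cbn [fst snd]; f_equal; lia. }
  assert (VT : forall k, vertex m p k = q k).
  { intros k. unfold vertex. rewrite (map_ext _ _ WL). apply DS. }
  set (b := fun v => if excluded_middle_informative (exists k, v = q k) then amax v else None).
  assert (bq : forall k, b (q k) = amax (q k)).
  { intros k. unfold b. destruct (excluded_middle_informative (exists k0, q k = q k0)) as [|N]; auto.
    exfalso. apply N. exists k; auto. }
  assert (Dq : forall k, amax (q k) <> None) by (intros k; apply (@Bd_dom tasS _ _ (Q1 k))).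
  assert (bD : forall v, in_dom b v -> exists k, v = q k).
  { intros v Hv. unfold in_dom, b in Hv. destruct (excluded_middle_informative (exists k, v = q k)); auto. congruence. }
  assert (bB : forall k, bond b (q k) (q (S k))).
  { intros k. destruct (Q1 k) as [d [t [t' [E1 [E2 [E3 E4]]]]]]. exists d, t, t'. rewrite !bq. auto. }
  exists m, p, b. split.
  2:{ intros v Hv. apply bD in Hv as [k ->]. apply bq. }
  split; [intros E; rewrite E in Lp; simpl in Lp; lia|]. split; [|split; [|split; [|split]]].
  - split; [|split].
    + intros v t Hv. destruct (bD v) as [k ->]; [unfold in_dom; congruence|]. rewrite bq in Hv. eauto.
    + apply connected_from. intros v Hv. apply bD in Hv as [k ->]. apply (@sequence_connected b q k); auto.
    + change (0%Z, 0%Z) with org. rewrite <- Q0, bq, Q0. exact HO.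
  - intros i j. rewrite !VT. apply Q2.
  - intros v. split.
    + intros Hv. apply bD in Hv as [k ->]. exists k. now rewrite VT.
    + intros [k ->]. rewrite VT. unfold in_dom. rewrite bq. apply Dq.
  - intros u v. split.
    + intros H. pose proof H as [d [t [t' [E1 [E2 [E3 E4]]]]]].
      destruct (bD u) as [k Ek]; [unfold in_dom; congruence|]. destruct (bD v) as [l El]; [unfold in_dom; congruence|].
      rewrite Ek, bq in E2. rewrite El, bq in E3. 
      assert (B : @Bd tasS (q k) (q l)) by (exists d, t, t'; rewrite <- Ek, <- El at 1; auto).
      destruct (Nat.lt_trichotomy k l) as [H1|[H1|H1]].
      * apply Ind in B as ->; auto. exists k. left. rewrite !VT. auto.
      * subst l. now apply (@Bd_neq tasS) in B.
      * apply (@Bd_sym tasS) in B. apply Ind in B as ->; auto. exists l. right. rewrite !VT. auto.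
    + intros [k [[-> ->]|[-> ->]]]; rewrite !VT; [apply bB|apply bond_sym, bB].
  - intros i w w' Ew.
    assert (Lw : length w <= L) by (rewrite <- Lp, <- Ew, length_app; lia).
    assert (Ew2 : w = map dr (seq K (length w))).
    { assert (E : forall l l' : list Dir, length l = length w -> l ++ l' = w ++ w' -> w = l).
      { clear. induction w as [|d w IH]; intros [|e l] l' El E; try discriminate El; auto.
        injection El as El. injection E as -> E. f_equal. now apply IH with l'. }
      apply E with (map dr (seq (K + length w) (L - length w))).
      - now rewrite length_map, length_seq.
      - rewrite Ew. unfold p. rewrite <- map_app, <- seq_app. do 2 f_equal. lia. }
    assert (E1 : padd (disp m) (disp w) = q (K + length w)).
    { rewrite <- disp_app, Ew2 at 1. unfold m. rewrite <- map_app, <- seq_app. apply DS. }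
    assert (Dp : disp p = V).
    { destruct (Per K (le_n _)) as [E _].
      assert (E' : padd (disp m) (disp p) = q (K + L)).
      { rewrite <- disp_app. unfold m, p. rewrite <- map_app, <- seq_app. apply DS. }
      assert (E0 : disp m = q K) by apply DS. rewrite E0, E in E'. clear - E'.
      pose proof (f_equal fst E'). pose proof (f_equal snd E'). unfold padd in *; cbn [fst snd] in *.
      apply pt_eq; lia. }
    assert (E2 : forall i, padd (disp m) (padd (disp (concat (repeat p i))) (disp w)) = q (K + length w + i * L)
       /\ amax (q (K + length w + i * L)) = amax (q (K + length w))).
    { clear i. induction i as [|i [IH1 IH2]].
      - simpl. rewrite Nat.add_0_r, <- E1. split; auto.
      - replace (K + length w + S i * L) with (K + length w + i * L + L) by lia.
        destruct (Per (K + length w + i * L) ltac:(lia)) as [P1 P2]. split; [|congruence]. rewrite P1, <- IH1.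
        cbn [repeat concat]. rewrite disp_app, Dp. unfold padd; cbn [fst snd]; f_equal; lia. }
    destruct (E2 i) as [E3 E4]. rewrite E3, E1, !bq. exact E4.
Qed.

End TAS.

Unset Implicit Arguments.

Theorem mainTheorem6 :
  forall (Sigma : Type), (exists l : list Sigma, forall g : Sigma, In g l) ->
  forall (T : list (Tile Sigma)) (s : Tile Sigma),
    confluent T s ->
    forall amax : Assembly Sigma, is_max_producible T s amax ->
      finite_assembly amax \/ contains_up_path T s amax.
Proof.
  intros Sigma _ T s Hc amax Hm.
  destruct (classic (finite_assembly amax)) as [HF|HI]; [auto|right].
  set (SS := tasS Hc Hm).
  destruct (@konig SS (long_paths Hc Hm HI)) as [r0 I0].
  destruct (@periodic_ray SS r0 I0) as [r [Hr Pr]].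
  destruct (@induced_periodic SS r Hr Pr) as [q [K [L [V [Hq [Ind [HL Per]]]]]]].
  exact (@induced_up_path _ _ _ _ Hc Hm q K L V Hq Ind HL Per).
Qed.
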